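(* There is a function $f$ such that for all integers $\gamma,k\geq 0$, every $(\gamma,k)$-apex graph with girth at least $5$ is $3$-colourable with clustering at most $f(\gamma,k)$.
   Context: Graphs are finite, simple and undirected. The Euler genus of a surface (compact 2-dimensional manifold) with $h$ handles and $c$ cross-caps is $2h+c$; the Euler genus of a graph is the minimum Euler genus of a surface in which it embeds without crossings. For integers $\gamma,k\geq 0$, a graph $G$ is $(\gamma,k)$-apex if there exists $A\subseteq V(G)$ with $|A|\leq k$ such that $G-A$ has Euler genus at most $\gamma$. The girth of a graph is the length of its shortest cycle (infinite for a forest). A $3$-colouring assigns one of at most three colours to each vertex (not necessarily properly). A monochromatic component is a connected component of the subgraph induced by all vertices of a single colour. A colouring has clustering $c$ if every monochromatic component has at most $c$ vertices. *)

(* Defs.v *)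
From HB Require Import structures.
From Stdlib Require Import Relation_Operators.
From mathcomp Require Import all_boot all_order all_algebra.
From mathcomp Require Import generic_quotient boolp classical_sets functions.
From mathcomp Require Import reals topology normedtype.
Import numFieldNormedType.Exports.

Set Implicit Arguments.
Unset Strict Implicit.
Unset Printing Implicit Defensive.

Import Order.TTheory GRing.Theory Num.Theory.

Local Open Scope nat_scope.

Record sgraph := SGraph {
  vertex :> finType;
  adj : rel vertex;
  adj_sym : symmetric adj;
  adj_irrefl : irreflexive adj }.

Section Induced.
Variables (G : sgraph) (A : {set G}).

Definition induced_adj : rel {x : G | x \in A} :=
  fun x y => adj (val x) (val y).

Lemma induced_adj_sym : symmetric induced_adj.
Proof. by move=> x y; apply: adj_sym. Qed.

Lemma induced_adj_irrefl : irreflexive induced_adj.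
Proof. by move=> x; apply: adj_irrefl. Qed.

Definition induced : sgraph := SGraph induced_adj_sym induced_adj_irrefl.
End Induced.

Definition delete (G : sgraph) (A : {set G}) : sgraph := induced (~: A).

(* [ucycle] also accepts sequences of at most two vertices (an edge walked back
   and forth, for instance); these are not cycles of a graph. *)
Definition girth_at_least (g : nat) (G : sgraph) : Prop :=
  forall s : seq G, ucycle (@adj G) s -> 3 <= size s -> g <= size s.

Definition component (G : sgraph) (x : G) : {set G} :=
  [set y | connect (@adj G) x y].

Definition has_clustering (G : sgraph) (K : finType) (col : G -> K)
    (c : nat) : Prop :=
  forall (a : K) (x : induced [set v | col v == a]), #|component x| <= c.

Definition colourable_with_clustering (q : nat) (G : sgraph) (c : nat) : Prop :=
  exists col : G -> 'I_q, has_clustering col c.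

(* The sphere with h handles and c cross-caps. The sphere is the one-point
   compactification of the plane, from which 2h + c disjoint open discs are
   removed. For i < h, the boundaries of discs 2i and 2i+1 are identified by a
   reflection (a translation would produce a Klein handle), which gives a handle.
   For j < c, antipodal points on the boundary of disc 2h+j are identified,
   which gives a cross-cap.
   The discs are those of the maximum norm, that is, squares of side 2. *)
Section Surface.
Local Open Scope classical_set_scope.
Local Open Scope ring_scope.
Local Open Scope quotient_scope.
Variable R : realType.

Local Notation plane := (R * R)%type.
Local Notation sphere := (one_point_compactification plane).

Definition max_norm (v : plane) : R := Num.max `|v.1| `|v.2|.

Definition disc_centre (n : nat) : plane := ((4 * n)%:R, 0).

Definition open_disc (n : nat) : set sphere :=
  [set Some z | z in [set z : plane | max_norm (z - disc_centre n) < 1]].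

Variables h c : nat.

Definition holed_sphere : set sphere :=
  ~` \bigcup_(n in [set n | (n < 2 * h + c)%N]) open_disc n.

Inductive attach : sphere -> sphere -> Prop :=
| attach_handle i (v : plane) : (i < h)%N -> max_norm v = 1 ->
    attach (Some (disc_centre (2 * i) + v))
           (Some (disc_centre (2 * i).+1 + (- v.1, v.2)))
| attach_crosscap j (v : plane) : (j < c)%N -> max_norm v = 1 ->
    attach (Some (disc_centre (2 * h + j) + v))
           (Some (disc_centre (2 * h + j) - v)).

Definition glued : rel holed_sphere := fun x y =>
  `[< clos_refl_sym_trans holed_sphere
        (fun a b => attach (set_val a) (set_val b)) x y >].

Lemma glued_refl : reflexive glued.
Proof. by move=> x; apply/asboolP; apply: rst_refl. Qed.

Lemma glued_sym : symmetric glued.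
Proof. by move=> x y; apply/asboolP/asboolP; apply: rst_sym. Qed.

Lemma glued_trans : transitive glued.
Proof.
by move=> y x z /asboolP xy /asboolP yz; apply/asboolP; apply: rst_trans xy yz.
Qed.

Definition glued_equiv : equiv_rel holed_sphere :=
  EquivRel glued glued_refl glued_sym glued_trans.

Definition surface : topologicalType :=
  quotient_topology {eq_quot glued_equiv}.
End Surface.

Section Embedding.
Local Open Scope classical_set_scope.
Local Open Scope ring_scope.
Variables (R : realType) (G : sgraph) (S : topologicalType).

(* Vertices are mapped to distinct points, and an edge uv to a simple arc
   [edge_arc u v] from u to v that meets the rest of the drawing only at its
   ends; [edge_arc v u] is the same arc traversed backwards. The values of
   [edge_arc] outside [0, 1] and at non-adjacent pairs are irrelevant. *)
Record embedding := Embedding {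
  point_of : G -> S;
  edge_arc : G -> G -> R -> S;
  point_of_inj : injective point_of;
  arc_continuous : forall u v, adj u v ->
    {within `[0, 1], continuous (edge_arc u v)};
  arc_inj : forall u v, adj u v -> {in `[0, 1]%R &, injective (edge_arc u v)};
  arc0 : forall u v, adj u v -> edge_arc u v 0 = point_of u;
  arc1 : forall u v, adj u v -> edge_arc u v 1 = point_of v;
  arc_rev : forall u v, adj u v -> {in `[0, 1]%R, forall t,
    edge_arc v u t = edge_arc u v (1 - t)};
  arc_avoids_points : forall u v w, adj u v -> {in `]0, 1[%R, forall t,
    edge_arc u v t <> point_of w};
  arc_disjoint : forall u v u' v', adj u v -> adj u' v' ->
    [set u; v]%SET != [set u'; v']%SET ->
    {in `]0, 1[%R &, forall t t', edge_arc u v t <> edge_arc u' v' t'} }.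
End Embedding.

Definition embeds_in (R : realType) (G : sgraph) (S : topologicalType) : Prop :=
  inhabited (embedding R G S).

(* The minimum of 2h + c over the surfaces in which G embeds is at most gamma. *)
Definition euler_genus_at_most (R : realType) (gamma : nat) (G : sgraph) : Prop :=
  exists h c : nat, 2 * h + c <= gamma /\ embeds_in R G (surface R h c).

Definition apex (R : realType) (gamma k : nat) (G : sgraph) : Prop :=
  exists A : {set G},
    #|A| <= k /\ euler_genus_at_most R gamma (delete A).

(* Main.v *)
(* Idea. Work with the drawing of G - A in a surface of Euler genus at most
   gamma. After at most two vertices are moved to A, it avoids the point at
   infinity. Cut the bounded part of the surface into a fine grid of square
   cells. If the mesh is fine enough, the cells met by the drawing of a vertex
   or of an edge make G - A a minor of the multigraph Q of cells, adjacent
   when they share a side. An even set of edges of Q is a closed 1-cochain on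
   the grid, hence, up to boundedly many periods, the coboundary of a function
   on the corners; counting even subgraphs gives Euler's inequality g (m - n -
   gamma') <= 2 m for every minor H of Q with n vertices, m edges and girth at
   least g. No Jordan curve theorem is needed.
   Hence G - A has about 5/3 n edges at most, and its minors are sparse.
   Without 4-cycles all but boundedly many vertices have at most one neighbour
   in A, so G has about 8/3 n < 3 n edges. After dropping the few vertices of
   high degree, contracting heavy stars of clusters repeatedly splits the rest
   into clusters of bounded size with few edges in between, so on average a
   cluster P meets fewer than 3 |P| edges. Removing vertices with at least
   three neighbours outside, one at a time, cannot exhaust P: what is left is
   a bounded island, each of whose vertices has at most two neighbours
   outside. Colour the rest by induction, and give each vertex of the island a
   colour that its outer neighbours avoid. *)
Require Import Defs.
From mathcomp Require Import all_boot.
From mathcomp Require Import zify.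
Set Implicit Arguments.
Unset Strict Implicit.
Unset Printing Implicit Defensive.

(** * Euler's inequality for minors of a cell complex *)

(** Only the inequality half of Euler's formula is needed, and an additive error that depends on the
    surface alone is harmless. So faces are never constructed: classes of corners of the grid stand
    for them, coefficients modulo 2 treat handles and cross-caps alike, and the crude number of
    periods of the grid replaces the genus. Arcs of a drawing can be arbitrarily wild, but disjoint
    closed sets are a positive distance apart in the compact squares, which is all that a fine mesh
    uses. The inequality serves twice, with different strength. Contraction destroys the girth, so
    minors only get the bound for girth 3; it is used to find clusters, where any linear bound would
    do. The bound for girth 5 enters a single count of arcs in the uncontracted graph, where the gap
    between 8/3 and 3 pays for the vertices of high degree, the arcs between clusters and the
    additive errors. *)

Definition rel_in (T : finType) (e : rel T) (S : {set T}) : rel T :=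
  fun x y => [&& e x y, x \in S & y \in S].

(** The empty set qualifies. So [model_inh] asks separately for nonempty branch sets, while the
    fibres of a contraction may be required to be linked over all vertices, used or not. *)
Definition linked (T : finType) (e : rel T) (S : {set T}) : Prop :=
  {in S &, forall x y, connect (rel_in e S) x y}.

Notation "\xor_ ( i | P ) F" := (\big[addb/false]_(i | P) F)
  (at level 41, F at level 41, i at level 50).
Notation "\xor_ ( i 'in' A ) F" := (\big[addb/false]_(i in A) F)
  (at level 41, F at level 41, i, A at level 50).

(* A surface cut into cells. A flag is a side of a cell, seen from that cell, and
   [opposite] passes to the cell across (a fixed point of [opposite] is a side on
   the boundary). Corners need not be identified: [glue] relates those that are
   the same point of the surface. [exactness] says that the first cohomology
   modulo 2 is detected by the periods. *)
Record complex := Complex {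
  cell : finType;
  flag : finType;
  corner : finType;
  period_index : finType;
  own : flag -> cell;
  opposite : flag -> flag;
  end0 : flag -> corner;
  end1 : flag -> corner;
  glue : rel corner;
  period : (flag -> bool) -> period_index -> bool;
  oppositeK : involutive opposite;
  opposite_ends : forall x,
    (glue (end0 x) (end0 (opposite x)) && glue (end1 x) (end1 (opposite x)))
    || (glue (end0 x) (end1 (opposite x)) && glue (end1 x) (end0 (opposite x)));
  cell_even : forall (t : corner -> bool) c,
    \xor_(x | own x == c) (t (end0 x) (+) t (end1 x)) = false;
  periodD : forall C C' i,
    period (fun x => C x (+) C' x) i = period C i (+) period C' i;
  exactness : forall C : flag -> bool,
    (forall x, C (opposite x) = C x) ->
    (forall c, \xor_(x | own x == c) C x = false) ->
    (forall i, period C i = false) ->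
    exists t : corner -> bool, (forall p q, glue p q -> t p = t q) /\
      (forall x, C x = t (end0 x) (+) t (end1 x)) }.

Definition cell_adj (Q : complex) : rel (cell Q) := fun a b =>
  [exists x, [&& own x == a, own (opposite x) == b & opposite x != x]].

(* A minor of the graph of cells; [bag] gives the branch sets of the vertices. *)
Record model (Q : complex) (V : finType) (e : rel V) (U : {set V})
    (bag : cell Q -> option V) : Prop := Model {
  model_inh : forall v, v \in U -> exists c, bag c = Some v;
  model_linked : forall v, v \in U ->
    linked (@cell_adj Q) [set c | bag c == Some v];
  model_edge : forall u v, u \in U -> v \in U -> e u v ->
    exists x : flag Q, bag (own x) = Some u /\ bag (own (opposite x)) = Some v }.

Definition arcs (V : finType) (e : rel V) (U : {set V}) : {set V * V} :=
  [set p | [&& e p.1 p.2, p.1 \in U & p.2 \in U]].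

(** Stated for even subgraphs because the boundaries of the face classes in [euler_ineq] need not be
    single cycles. Ordered pairs are counted, hence the factor 2. *)
Definition even_girth_ge (V : finType) (e : rel V) (U : {set V}) (g : nat) :=
  forall D : rel V, symmetric D ->
    (forall u v, D u v -> [&& e u v, u \in U & v \in U]) ->
    (forall u, \xor_(v | true) D u v = false) -> (exists u v, D u v) ->
    2 * g <= #|[set p : V * V | D p.1 p.2]|.

Lemma xor_pred1 (T : finType) (P : pred T) (x : T) :
  \xor_(y | P y) (y == x) = P x.
Proof.
rewrite (eq_bigr (fun y => if y == x then true else false)); last first.
  by move=> y _; case: (y == x).
rewrite -big_mkcondr /=; case Px: (P x).
  by rewrite (big_pred1 x) // => y /=; case: eqP => [->|]; rewrite ?Px ?andbF.
by apply: big_pred0 => y; case: eqP => [->|]; rewrite ?Px ?andbF.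
Qed.

(** The two elements of an orbit cancel; comparing ranks singles out one of them. *)
Lemma xor_involution (T : finType) (f : T -> T) (P : pred T) (F : T -> bool) :
  involutive f -> (forall x, P (f x) = P x) -> (forall x, F (f x) = F x) ->
  (forall x, f x = x -> F x = false) -> \xor_(x | P x) F x = false.
Proof.
move=> fK Pf Ff F0.
rewrite (bigID (fun x => enum_rank x < enum_rank (f x))) /=.
rewrite [X in _ (+) X](_ : _ = \xor_(x | P x && (enum_rank x < enum_rank (f x))) F x).
  exact: addbb.
rewrite (reindex f) /=; last by exists f => x _; apply: fK.
rewrite (bigID (fun x => f x == x)) /= big1 => [|x /andP[_ /eqP fx]]; last first.
  by rewrite Ff F0.
rewrite /= ; apply: eq_big => [x|x _]; last by rewrite Ff.
rewrite Pf fK -leqNgt -andbA; congr (_ && _).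
rewrite leq_eqVlt; case: (ltnP (enum_rank x) (enum_rank (f x))) => [lt|ge].
  rewrite orbT /=; apply/eqP => fx; by rewrite fx ltnn in lt.
rewrite orbF; apply/negP => /andP[/eqP H /negP]; apply; apply/eqP.
by symmetry; apply/enum_rank_inj/val_inj.
Qed.

Lemma pigeonhole_fibre (T T' : finType) (A : {set T}) (B : {set T'}) (f : T -> T') :
  A != set0 -> {in A, forall x, f x \in B} ->
  exists2 b, b \in B & #|A| <= #|B| * #|[set x in A | f x == b]|.
Proof.
case/set0Pn => a aA fB.
have EA : #|A| = \sum_(b in B) #|[set x in A | f x == b]|.
  rewrite -sum1_card (partition_big f (mem B)) //=; apply: eq_bigr => b _.
  by rewrite -sum1_card; apply: eq_bigl => x; rewrite !inE.
have [b bB bmax] := @arg_maxnP _ (f a) (mem B) (fun b => #|[set x in A | f x == b]|) (fB _ aA).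
exists b => //; rewrite EA -sum_nat_const; apply: leq_sum => c cB.
exact: bmax.
Qed.

Section Euler.
Variables (Q : complex) (V : finType) (e : rel V) (U : {set V}).
Variable bag : cell Q -> option V.
Hypotheses (esym : symmetric e) (eirr : irreflexive e).
Hypothesis mod : model e U bag.

(** [C] is the set of sides crossed by a path of cells, modulo 2: a cell on the way is left as often
    as it is entered, so only the ends can have odd boundary. *)
Lemma path_lift (S : {set cell Q}) (a b : cell Q) :
  connect (rel_in (@cell_adj Q) S) a b ->
  exists C : flag Q -> bool,
    [/\ forall x, C (opposite x) = C x,
        forall x, C x -> [&& opposite x != x, own x \in S & own (opposite x) \in S] &
        forall c, \xor_(x | own x == c) C x = (a == c) (+) (b == c)].
Proof.
case/connectP => p + ->; elim: p a => [|a' p IH] a /=.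
  move=> _; exists (fun=> false); split=> // c; by rewrite big1 // addbb.
case/andP=> /and3P[/existsP[x /and3P[/eqP xa /eqP xa' xx] aS a'S]] /IH[C [C1 C2 C3]].
exists (fun y => (y == x) (+) (y == opposite x) (+) C y); split.
- move=> y; rewrite C1; congr (_ (+) _).
  by rewrite (can2_eq (@oppositeK Q) (@oppositeK Q)) (inj_eq (can_inj (@oppositeK Q))) addbC.
- move=> y; case Cy: (C y); first by move=> _; apply: C2.
  rewrite addbF; case: eqP => [->|_] /=; first by rewrite xx xa xa' aS.
  case: eqP => [->|//] _; rewrite oppositeK xa xa' aS a'S eq_sym xx //.
- move=> c; rewrite !big_split /= C3 !xor_pred1 xa xa'.
  by case: (a == c); case: (a' == c); case: (_ == c).
Qed.

(* The cochain of a single edge: the chosen side, closed up by paths inside the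
   two bags to their base cells [r u] and [r v]. *)
Lemma edge_lift (r : V -> cell Q) (u v : V) (x : flag Q) :
  {in U, forall w, bag (r w) = Some w} -> u \in U -> v \in U -> u != v ->
  bag (own x) = Some u -> bag (own (opposite x)) = Some v ->
  exists C : flag Q -> bool,
    [/\ forall y, C (opposite y) = C y,
        forall y, C y -> (opposite y != y) && [|| y == x, y == opposite x |
           [exists w in U, (bag (own y) == Some w) && (bag (own (opposite y)) == Some w)]],
        C x &
        forall c, \xor_(y | own y == c) C y = (r u == c) (+) (r v == c)].
Proof.
move=> rU uU vU uv xu xv.
have xx : opposite x != x.
  by apply/negP => /eqP E; move: xv; rewrite E xu => -[] /eqP; rewrite (negbTE uv).
have [||Cu [Cu1 Cu2 Cu3]] := path_lift (model_linked mod uU (x := r u) (y := own x) _ _).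
- by rewrite inE rU.
- by rewrite inE xu.
have [||Cv [Cv1 Cv2 Cv3]] := path_lift (model_linked mod vU (x := r v) (y := own (opposite x)) _ _).
- by rewrite inE rU.
- by rewrite inE xv.
exists (fun y => ((y == x) (+) (y == opposite x)) (+) (Cu y (+) Cv y)); split.
- move=> y; rewrite Cu1 Cv1; congr (_ (+) _).
  by rewrite (can2_eq (@oppositeK Q) (@oppositeK Q)) (inj_eq (can_inj (@oppositeK Q))) addbC.
- move=> y; case: eqP => [->|_] /=; first by rewrite xx.
  case: eqP => [->|_] /=; first by rewrite oppositeK eq_sym xx.
  case Cuy: (Cu y) => /=.
    move=> _; case/and3P: (Cu2 _ Cuy) => -> /=; rewrite !inE => H1 H2.
    by apply/existsP; exists u; rewrite uU H1 H2.
  move/Cv2 => /and3P[-> /=]; rewrite !inE => H1 H2.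
  by apply/existsP; exists v; rewrite vU H1 H2.
- rewrite eqxx (eq_sym x) (negbTE xx) /=.
  case Cux: (Cu x).
    case/and3P: (Cu2 _ Cux) => _ _; rewrite inE xv => /eqP[vu].
    by rewrite vu eqxx in uv.
  case Cvx: (Cv x) => //.
  case/and3P: (Cv2 _ Cvx) => _; rewrite inE xu => /eqP[vu].
  by rewrite vu eqxx in uv.
- move=> c; rewrite !big_split /= Cu3 Cv3 !xor_pred1.
  by case: (own x == c); case: (own _ == c); case: (r u == c); case: (r v == c).
Qed.

Let rk (u : V) := enum_rank u.
Let E : {set V * V} := [set p in arcs e U | rk p.1 < rk p.2].

Lemma card_arcs : #|arcs e U| = 2 * #|E|.
Proof.
have -> : #|arcs e U| = #|E| + #|[set p in arcs e U | ~~ (rk p.1 < rk p.2)]|.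
  rewrite -(cardsID [set p | rk p.1 < rk p.2] (arcs e U)).
  by congr (_ + _); apply: eq_card=> p; rewrite !inE // andbC.
rewrite mul2n -addnn; congr addn.
have sw : involutive (fun p : V * V => (p.2, p.1)) by case.
rewrite -(card_imset E (can_inj sw)); apply: eq_card => -[u v].
apply/idP/imsetP.
  rewrite !inE /= -leqNgt => /andP[/and3P[euv uU vU] le].
  exists (v, u) => //; rewrite !inE /= esym euv uU vU /= ltn_neqAle le andbT.
  by apply/negP => /eqP/val_inj/enum_rank_inj vu; rewrite vu eirr in euv.
case=> -[u' v'] /=; rewrite !inE /= => /andP[/and3P[euv uU vU] lt] [-> ->] /=.
by rewrite esym euv uU vU -leqNgt ltnW.
Qed.

(** Let m be the size of [E], half the number of arcs, and p the number of periods. Some class [F]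
    of edge sets with the same odd vertices and the same periods has at least 2^(m - n - p) members,
    where n is the size of [U]. By [exactness] each member differs from a fixed [D1] by the
    coboundary of a function on corners, and the values of this function on the classes in [K], the
    stand-ins for faces, determine it. So m <= n + p + #|K|, while the girth gives g #|K| <= 2 m. *)
Lemma euler_ineq (g : nat) : even_girth_ge e U g ->
  g * #|arcs e U| <= 2 * g * (#|U| + #|period_index Q|) + 2 * #|arcs e U|.
Proof.
move=> girth.
have [E0|/set0Pn[p0 p0E]] := eqVneq E set0.
  by rewrite card_arcs E0 cards0 !muln0.
have EP p : p \in E -> [/\ e p.1 p.2, p.1 \in U, p.2 \in U & rk p.1 < rk p.2].
  by rewrite !inE -!andbA => /and4P[].
have [x0 [x0u _]] : exists x : flag Q, bag (own x) = Some p0.1 /\ bag (own (opposite x)) = Some p0.2.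
  by case: (EP _ p0E) => *; apply: (model_edge mod).
have {x0u} /fin_all_exists[f fP] : forall p : V * V, exists x : flag Q, p \in E ->
    bag (own x) = Some p.1 /\ bag (own (opposite x)) = Some p.2.
  move=> p; case pE: (p \in E); last by exists x0.
  have [ep p1 p2 _] := EP p pE.
  by have [x xP] := model_edge mod p1 p2 ep; exists x.
have /fin_all_exists[r rP] : forall w : V, exists c : cell Q, w \in U -> bag c = Some w.
  move=> w; case wU: (w \in U); last by exists (own x0).
  by have [c cw] := model_inh mod wU; exists c.
have f_own p (pE : p \in E) : bag (own (f p)) = Some p.1 by case: (fP p pE).
have f_opp p (pE : p \in E) : bag (own (opposite (f p))) = Some p.2 by case: (fP p pE).
pose internal y := [exists w in U, (bag (own y) == Some w) && (bag (own (opposite y)) == Some w)].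
have /fin_all_exists[c cP] : forall p : V * V, exists C : {ffun flag Q -> bool}, p \in E ->
    [/\ forall y, C (opposite y) = C y,
        forall y, C y -> (opposite y != y) && [|| y == f p, y == opposite (f p) | internal y],
        C (f p) &
        forall a, \xor_(y | own y == a) C y = (r p.1 == a) (+) (r p.2 == a)].
  move=> p; case pE: (p \in E); last by exists [ffun=> false].
  have [ep p1 p2 p12] := EP p pE.
  have [||||||C [C1 C2 C3 C4]] := @edge_lift r p.1 p.2 (f p).
  - by move=> w /rP.
  - by [].
  - by [].
  - by apply/negP => /eqP p1E; rewrite p1E ltnn in p12.
  - exact: f_own.
  - exact: f_opp.
  exists (finfun C) => _; split.
  - by move=> y; rewrite !ffunE.
  - by move=> y; rewrite !ffunE => /C2.
  - by rewrite ffunE.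
  - by move=> a; rewrite -C4; apply: eq_bigr => y _; rewrite ffunE.
pose lift (D : {set V * V}) y := \xor_(p in D) c p y.
pose bd (D : {set V * V}) w := \xor_(p in D) ((p.1 == w) (+) (p.2 == w)).
have f_internal p : p \in E -> internal (f p) = false.
  move=> pE; apply/existsP => -[w /and3P[_ /eqP w1 /eqP w2]].
  move: w1 w2; rewrite (f_own _ pE) (f_opp _ pE) => -[w1] [w2].
  by case: (EP _ pE) => _ _ _; rewrite w1 w2 ltnn.
have lift_f (D : {set V * V}) p : D \subset E -> p \in E -> lift D (f p) = (p \in D).
  move=> DE pE; rewrite /lift -[RHS](xor_pred1 (fun q => q \in D)); apply: eq_bigr => q qD.
  have qE := subsetP DE _ qD; have [_ c2 c3 _] := cP q qE.
  case: eqP => [->|/eqP qp]; first by case: (cP p pE).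
  apply/negP => /c2; rewrite f_internal // orbF => /andP[_ /orP[]] /eqP fpq.
    move/eqP: qp; case; case: (p) (q) (f_own p pE) (f_opp p pE) (f_own q qE) (f_opp q qE) fpq.
    by move=> p1 p2 [q1 q2] /= H1 H2 + + fpq; rewrite -fpq H1 H2 => -[->] [->].
  have [_ _ _ l1] := EP p pE; have [_ _ _ l2] := EP q qE.
  move: (f_own p pE) (f_opp p pE) (f_own q qE) (f_opp q qE); rewrite fpq oppositeK.
  by move=> -> -> [H1] [H2]; rewrite H1 H2 in l1; move: (ltn_trans l1 l2); rewrite ltnn.
(* The lifts live on the allowed flags. Cutting along these, the corners fall
   into classes on which every potential of a lift is constant; each class [k]
   has an even boundary [Drel k] in the graph. *)
pose allowed y := (opposite y != y) && (internal y || [exists p in E, (y == f p) || (y == opposite (f p))]).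
have lift_allowed (D : {set V * V}) y : D \subset E -> ~~ allowed y -> lift D y = false.
  move=> DE nal; rewrite /lift big1 // => p pD; have pE := subsetP DE _ pD.
  apply/negP => cy; move/negP: nal; apply; have [_ c2 _ _] := cP p pE.
  move: (c2 _ cy) => /andP[yy H]; rewrite /allowed yy; case: (internal y) H => //=.
  by rewrite orbF => H; apply/existsP; exists p; rewrite pE.
have lift_bd (D D' : {set V * V}) a : D \subset E -> D' \subset E ->
    {in U, bd D =1 bd D'} ->
    \xor_(y | own y == a) lift D y = \xor_(y | own y == a) lift D' y.
  have aux (D0 : {set V * V}) : D0 \subset E ->
     \xor_(y | own y == a) lift D0 y
     = \xor_(p in D0) ((r p.1 == a) (+) (r p.2 == a)).
    move=> DE; rewrite /lift exchange_big /=; apply: eq_bigr => p pD.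
    by case: (cP p (subsetP DE _ pD)).
  move=> DE D'E bdE; rewrite !aux //.
  have raE w w' : w \in U -> w' \in U -> r w = a -> (r w' == a) = (w' == w).
    move=> wU w'U <-; apply/eqP/eqP => [rr|-> //].
    by move: (rP w' w'U); rewrite rr (rP w wU) => -[].
  have [/existsP[w /andP[wU /eqP rw]]|/existsPn no] := boolP [exists w in U, r w == a].
    have step (D0 : {set V * V}) : D0 \subset E ->
      \xor_(p in D0) ((r p.1 == a) (+) (r p.2 == a)) = bd D0 w.
      move=> DE0; apply: eq_bigr => p pD; have [_ p1 p2 _] := EP p (subsetP DE0 _ pD).
      by rewrite !(raE w).
    by rewrite !step // bdE.
  have step (D0 : {set V * V}) : D0 \subset E ->
      \xor_(p in D0) ((r p.1 == a) (+) (r p.2 == a)) = false.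
    move=> DE0; rewrite big1 // => p pD; have [_ p1 p2 _] := EP p (subsetP DE0 _ pD).
    by move: (no p.1) (no p.2); rewrite p1 p2 /= => /negbTE-> /negbTE->.
  by rewrite !step.
(* Members of one fibre of [code] differ by an even edge set whose lift has no periods, to which
   [exactness] applies. Comparing with a fixed [D1] makes any large fibre usable, not only the one
   over zero. *)
pose code (D : {set V * V}) := ([set w in U | bd D w], [ffun i => period (lift D) i]).
pose codes := setX (powerset U) [set: {ffun period_index Q -> bool}].
have card_codes : #|codes| = 2 ^ (#|U| + #|period_index Q|).
  by rewrite cardsX card_powerset cardsT card_ffun card_bool expnD.
have [||b _ Fcard] := @pigeonhole_fibre _ _ (powerset E) codes code.
- by apply/set0Pn; exists set0; rewrite inE sub0set.
- move=> D _; rewrite !inE andbT; apply/subsetP => w; by rewrite inE => /andP[].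
rewrite card_powerset card_codes in Fcard.
set F := [set x in _ | _] in Fcard.
have [D1 D1F] : exists D, D \in F.
  apply/set0Pn; rewrite -card_gt0; case: posnP Fcard => // ->.
  by rewrite muln0 leqNgt expn_gt0.
pose zeta (a b : corner Q) := [|| glue a b, glue b a |
   [exists x, ~~ allowed x && (((a == end0 x) && (b == end1 x)) || ((a == end1 x) && (b == end0 x)))]].
have zeta_sym : symmetric zeta.
  move=> a a'; rewrite /zeta orbCA; do 2!congr orb; apply: eq_existsb => x.
  by rewrite orbC [in RHS]andbC [in X in X || _]andbC [in X in _ || X]andbC andbC.
have csym := sym_connect_sym zeta_sym.
pose rt := root zeta.
have rtE a a' : zeta a a' -> rt a = rt a'.
  by move=> z; apply/(rootP csym); apply: connect1.
pose delta k (x : flag Q) := (rt (end0 x) == k) (+) (rt (end1 x) == k).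
have delta_opp k x : delta k (opposite x) = delta k x.
  have gE a a' : glue a a' -> rt a = rt a' by move=> gl; apply: rtE; rewrite /zeta gl.
  rewrite /delta; case/orP: (opposite_ends x) => /andP[/gE-> /gE->] //.
  exact: addbC.
have delta_allowed k x : ~~ allowed x -> delta k x = false.
  move=> nal; rewrite /delta (rtE (end0 x) (end1 x)) ?addbb //.
  by apply/or3P/Or33; apply/existsP; exists x; rewrite nal !eqxx.
pose y u v := if rk u < rk v then f (u, v) else opposite (f (v, u)).
have yE u v : (u, v) \in arcs e U -> 
    [/\ bag (own (y u v)) = Some u, bag (own (opposite (y u v))) = Some v & y v u = opposite (y u v)].
  rewrite inE /= => /and3P[euv uU vU]; rewrite /y.
  have [lt|gt|/val_inj/enum_rank_inj uv] := ltngtP (rk u) (rk v).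
  - have pE : (u, v) \in E by rewrite !inE /= euv uU vU.
    by rewrite (f_own _ pE) (f_opp _ pE).
  - have pE : (v, u) \in E by rewrite !inE /= esym euv uU vU.
    by rewrite (f_opp _ pE) oppositeK (f_own _ pE).
  - by rewrite uv eirr in euv.
pose Drel k u v := ((u, v) \in arcs e U) && delta k (y u v).
have arc_sym u v : ((u, v) \in arcs e U) = ((v, u) \in arcs e U).
  by rewrite !inE /= esym [in X in _ && X]andbC.
have Dsym k : symmetric (Drel k).
  move=> u v; rewrite /Drel -arc_sym; case a: (_ \in _) => //=.
  by have [_ _ ->] := yE _ _ a; rewrite delta_opp.
(* [cell_even], for the indicator of the class [k], is summed over the cells in the bag of [u].
   Sides inside the bag occur twice and cancel, sides that are not allowed contribute nothing, and
   what is left are the chosen sides of the edges at [u]. *)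
have Deven k u : \xor_(v | true) Drel k u v = false.
  case uU: (u \in U); last by rewrite big1 // => v _; rewrite /Drel inE /= uU andbF.
  have H0 : \xor_(x | bag (own x) == Some u) delta k x = false.
    rewrite (partition_big (@own Q) (fun a => bag a == Some u)) //= big1 // => a /eqP au.
    rewrite -[RHS](cell_even (fun q => rt q == k) a); apply: eq_big => [x|x _ //].
    by case: (own x =P a) => [->|_]; rewrite ?andbF ?au ?eqxx.
  rewrite (bigID (fun x => bag (own (opposite x)) == Some u)) /= in H0.
  rewrite (@xor_involution _ (@opposite Q)) /= in H0; first last.
  - by move=> x xx; apply: delta_allowed; rewrite /allowed xx eqxx.
  - exact: delta_opp.
  - by move=> x; rewrite oppositeK andbC.
  - exact: oppositeK.
  rewrite -[RHS]H0 /=.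
  pose nbr v := (u, v) \in arcs e U.
  transitivity (\xor_(x in [set y u v | v in nbr]) delta k x).
    rewrite big_imset => [|v v' vn v'n E'] /=.
      rewrite [RHS]big_mkcond; apply: eq_bigr => v _; rewrite /Drel unfold_in /nbr.
      by case: (_ \in _).
    have [_ H1 _] := yE _ _ vn; have [_ H2 _] := yE _ _ v'n.
    by rewrite E' H2 in H1; case: H1.
  rewrite big_mkcond [RHS]big_mkcond /=; apply: eq_bigr => x _.
  case: imsetP => [[v vn ->]|no].
    have [H1 H2 _] := yE _ _ vn; rewrite H1 H2 eqxx /=.
    case: eqP => // -[uv]; move: vn; rewrite unfold_in /nbr uv inE /=.
    by rewrite eirr.
  case: andP => // -[/eqP xu xnu]; symmetry; apply: delta_allowed; apply/negP.
  case/andP => _ /orP[/existsP[w /and3P[_ w1 w2]]|/existsP[p /andP[pE H]]].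
    by move: w1; rewrite xu => /eqP[uw]; rewrite uw w2 in xnu.
  have [ep p1 p2 p12] := EP p pE; case: no.
  case/orP: H => /eqP xE.
    have p1u : p.1 = u by move: xu; rewrite xE f_own // => -[].
    exists p.2; last by rewrite /y -p1u p12 xE -surjective_pairing.
    by rewrite unfold_in /nbr inE /= -p1u ep p1.
  have p2u : p.2 = u by move: xu; rewrite xE f_opp // => -[].
  exists p.1; first by rewrite unfold_in /nbr inE /= -p2u esym ep p1 p2.
  rewrite /y -p2u; have -> : (rk p.2 < rk p.1) = false by lia.
  by rewrite xE -surjective_pairing.
pose K := [set k | [exists p : V * V, Drel k p.1 p.2]].
(* The class [k] acts as a face with boundary [Drel k]. The chosen side of an edge has two end
   corners, so an edge lies on at most two faces. *)
have cardK : g * #|K| <= #|arcs e U|.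
  have H1 : #|K| * (2 * g) <= \sum_(k in K) #|[set p : V * V | Drel k p.1 p.2]|.
    rewrite -sum_nat_const; apply: leq_sum => k; rewrite inE => /existsP[p Dp].
    apply: girth => //; last by exists p.1, p.2.
    by move=> u v; rewrite /Drel inE => /andP[].
  have H2 : \sum_(k in K) #|[set p : V * V | Drel k p.1 p.2]|
      <= \sum_(p in arcs e U) \sum_(k in K) delta k (y p.1 p.2).
    rewrite exchange_big /=; apply: leq_sum => k _.
    rewrite -sum1_card big_mkcond [X in _ <= X]big_mkcond /=; apply: leq_sum => -[u v] _.
    by rewrite !inE /Drel /= inE /=; case: (e u v && _) => //=; case: (delta _ _).
  have H3 : \sum_(p in arcs e U) \sum_(k in K) delta k (y p.1 p.2) <= #|arcs e U| * 2.
    rewrite -sum_nat_const; apply: leq_sum => p _.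
    set a := rt (end0 (y p.1 p.2)); set a' := rt (end1 (y p.1 p.2)).
    have H4 a0 : \sum_(k : corner Q) (a0 == k : nat) = 1.
      by rewrite (bigD1 a0) //= eqxx big1 // => k /negbTE; rewrite eq_sym => ->.
    have <- : \sum_(k : corner Q) ((a == k : nat) + (a' == k)) = 2.
      by rewrite big_split /= !H4.
    rewrite big_mkcond; apply: leq_sum => k _; case: ifP => // _.
    by rewrite /delta -/a -/a'; case: (a == k); case: (a' == k).
  by move: (leq_trans H1 (leq_trans H2 H3)); rewrite mulnCA mulnC leq_pmul2r // mulnC.
(* Potentials are constant on classes. An edge whose two ends are in different classes puts both
   classes in [K]; an edge with both ends in one class belongs to all members of [F] or to none.
   Hence the trace of [t D] on [K] determines [D]. *)
have cardF : #|F| <= 2 ^ #|K|.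
  have /fin_all_exists[t tP] : forall D : {set V * V}, exists t : {ffun corner Q -> bool},
      D \in F -> (forall a a', zeta a a' -> t a = t a') /\
        (forall p, p \in E -> (p \in D) (+) (p \in D1) = t (end0 (f p)) (+) t (end1 (f p))).
    move=> D; case DF: (D \in F); last by exists [ffun=> false].
    move: DF D1F; rewrite !inE => /andP[DE /eqP codeD] /andP[D1E /eqP codeD1].
    have : code D = code D1 by rewrite codeD codeD1.
    case => /setP bdE /ffunP perE.
    have liftC (D0 : {set V * V}) x : D0 \subset E -> lift D0 (opposite x) = lift D0 x.
      move=> D0E; apply: eq_bigr => p pD0.
      by case: (cP p (subsetP D0E _ pD0)).
    have [|||t [tg tE]] := @exactness Q (fun x => lift D x (+) lift D1 x).
    - by move=> x; rewrite !liftC.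
    - move=> a; rewrite big_split /= (lift_bd D D1) ?addbb // => w wU.
      by have := bdE w; rewrite !inE wU.
    - by move=> i; rewrite periodD; have := perE i; rewrite !ffunE => ->; rewrite addbb.
    exists (finfun t) => _; split=> [a a'|p pE]; rewrite !ffunE; last first.
      by rewrite -tE !lift_f.
    case/or3P => [/tg //|/tg //|/existsP[x /andP[nal]]].
    have := tE x; rewrite !lift_allowed // => H.
    have {}H : t (end0 x) = t (end1 x) by case: (t _) (t _) H => [] [].
    by case/orP => /andP[/eqP-> /eqP->].
  have trt D a : D \in F -> t D (rt a) = t D a.
    move=> DF; have [tz _] := tP D DF.
    have : connect zeta (rt a) a by rewrite csym connect_root.
    move: (rt a) => a0 /connectP[q + ->]; elim: q a0 => //= a1 q IH a' /andP[/tz-> /IH].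
    by [].
  pose kode D := [set k in K | t D k].
  have kodeK : {in F &, injective kode}.
    move=> D D' DF D'F /setP kE; apply/setP => p.
    have [pE|pE] := boolP (p \in E); last first.
      move: DF D'F; rewrite !inE => /andP[/subsetP DE _] /andP[/subsetP D'E _].
      by apply/idP/idP => [/DE|/D'E] H; rewrite H in pE.
    have [_ /(_ p pE) H1] := tP D DF; have [_ /(_ p pE) H2] := tP D' D'F.
    suff : (p \in D) (+) (p \in D1) = (p \in D') (+) (p \in D1) by apply: addIb.
    rewrite H1 H2 -(trt D (end0 _)) // -(trt D (end1 _)) // -(trt D' (end0 _)) // -(trt D' (end1 _)) //.
    have [->|ne] := eqVneq (rt (end0 (f p))) (rt (end1 (f p))); first by rewrite !addbb.
    have [ep p1 p2 p12] := EP p pE.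
    have dK k : delta k (f p) -> k \in K.
      move=> dk; rewrite inE; apply/existsP; exists p.
      by rewrite /Drel inE ep p1 p2 /y /= p12 -surjective_pairing.
    have K0 : rt (end0 (f p)) \in K by apply: dK; rewrite /delta eqxx eq_sym (negbTE ne).
    have K1 : rt (end1 (f p)) \in K by apply: dK; rewrite /delta eqxx (negbTE ne).
    have := kE (rt (end0 (f p))); have := kE (rt (end1 (f p))).
    have kodeE D0 k : k \in K -> (k \in kode D0) = t D0 k.
      by move=> kK; rewrite in_set kK.
    by rewrite !kodeE // => -> ->.
  rewrite -card_powerset -(card_in_imset kodeK); apply/subset_leq_card/subsetP => _ /imsetP[D _ ->].
  by rewrite inE; apply/subsetP => k; rewrite inE => /andP[].
have : 2 ^ #|E| <= 2 ^ (#|U| + #|period_index Q| + #|K|).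
  by rewrite [X in _ <= X]expnD; apply: (leq_trans Fcard); rewrite leq_pmul2l // expn_gt0.
rewrite leq_exp2l // => /(leq_mul (leqnn g)); rewrite mulnDr => H.
by rewrite card_arcs in cardK *; lia.
Qed.
End Euler.

(** * Sparse minors *)

Lemma rel_inS (T : finType) (e : rel T) (A B : {set T}) :
  A \subset B -> subrel (connect (rel_in e A)) (connect (rel_in e B)).
Proof.
move=> /subsetP AB; apply: connect_sub => x y /and3P[exy xA yA].
by apply: connect1; rewrite /rel_in exy !AB.
Qed.

Lemma even_degree_second (V : finType) (D : rel V) (u v : V) :
  \xor_(w | true) D u w = false -> D u v -> exists2 w, w != v & D u w.
Proof.
move=> ev Duv; case: (pickP (fun w => (w != v) && D u w)) => [w /andP[]|no].
  by exists w.
move: ev; rewrite (bigD1 v) //= Duv big1 // => w wv.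
by have := no w; rewrite wv.
Qed.

(** A path is prolonged at its head [x], where parity gives a neighbour [z] other than the successor
    [y]. Once [z] lies on the path, the piece up to [z] closes up, and [z != y] makes it longer than
    2. *)
Lemma even_graph_cycle (V : finType) (D : rel V) :
  symmetric D -> irreflexive D -> (forall u, \xor_(v | true) D u v = false) ->
  (exists u v, D u v) -> exists2 s, ucycle D s & 3 <= size s.
Proof.
move=> Dsym Dirr Deven [u [v Duv]].
have : uniq [:: u, v & [::]] && path D u (v :: [::]).
  rewrite /= inE Duv !andbT; apply/eqP => uv; by rewrite uv Dirr in Duv.
have [n] := ubnP (#|V| - size [:: u; v]).
elim: n u v [::] {Duv} => // n IH x y p Hn /andP[us Ds].
have [z zy Dxz] := even_degree_second (Deven x) (proj1 (andP Ds)).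
have xz : z != x by apply/eqP => zx; rewrite zx Dirr in Dxz.
have [zp|zp] := boolP (z \in p); last first.
  have uz : uniq (z :: [:: x, y & p]) by rewrite cons_uniq us !inE !negb_or xz zy zp.
  apply: (IH z x (y :: p)); last by rewrite uz /= Dsym Dxz.
  have := max_card (mem (z :: [:: x, y & p])).
  by rewrite (card_uniqP uz) /=; move: Hn => /=; lia.
case/splitPr: zp us Ds {Hn} => p1 p2 us Ds.
exists [:: x, y & rcons p1 z]; last by rewrite /= size_rcons.
apply/andP; split.
  move: Ds; rewrite /= rcons_path last_rcons (Dsym z) Dxz andbT => /andP[-> /=].
  by rewrite -cat_rcons cat_path => /andP[].
by move: us; rewrite -cat_rcons -!cat_cons cat_uniq => /andP[].
Qed.

(** [D] contains a cycle, and each of its at least [g] vertices has degree at least two in [D]. *)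
Lemma even_girth_geP (V : finType) (e : rel V) (U : {set V}) (g : nat) :
  irreflexive e -> (forall s, ucycle e s -> 3 <= size s -> g <= size s) ->
  even_girth_ge e U g.
Proof.
move=> eirr girth D Dsym De Deven Dne.
have Dsub : subrel D e by move=> u v /De/and3P[].
have Dirr : irreflexive D by move=> u; apply/negP => /Dsub; rewrite eirr.
have [s /andP[sc su] s3] := even_graph_cycle Dsym Dirr Deven Dne.
have gs : g <= size s by apply: girth => //; apply/andP; split => //; apply: sub_cycle sc.
have -> : #|[set p : V * V | D p.1 p.2]| = \sum_u \sum_v D u v.
  rewrite -sum1_card pair_big /= big_mkcond /=; apply: eq_bigr => -[u v] _.
  by rewrite inE /=; case: (D u v).
have H : forall u, u \in s -> 2 <= \sum_v D u v.
  move=> u /(next_cycle sc); move: (next s u) => v Duv.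
  have [w wv Duw] := even_degree_second (Deven u) Duv.
  by rewrite (bigD1 v) // (bigD1 w) //= Duv Duw.
apply: (@leq_trans (\sum_(u in s) 2)).
  by rewrite sum_nat_const (card_uniqP su) mulnC leq_mul2r gs orbT.
by rewrite big_mkcond /=; apply: leq_sum => u _; case: ifP => // /H.
Qed.

Lemma connect_rel_in_sym (T : finType) (e : rel T) (S : {set T}) :
  symmetric e -> connect_sym (rel_in e S).
Proof.
move=> esym; apply: sym_connect_sym => x y.
by rewrite /rel_in esym [in X in _ && X]andbC.
Qed.

Definition quotient_bag (T V W : Type) (bag : T -> option V) (S : pred V) (q : V -> W) c :=
  if bag c is Some v then if S v then Some (q v) else None else None.

(** A minor of a minor: a path within a fibre of [q] lifts to a chain of cells, which passes from
    bag to bag across the sides given by [model_edge]. *)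
Lemma quotient_model (Q : complex) (V : finType) (e h : rel V) (U S R : {set V})
    (bag : cell Q -> option V) (q : V -> V) :
  model e U bag -> S \subset U ->
  (forall r, linked e [set v in S | q v == r]) -> R \subset q @: S ->
  (forall r r', r \in R -> r' \in R -> h r r' ->
     exists u v, [/\ u \in S, v \in S, e u v, q u = r & q v = r']) ->
  model h R (quotient_bag bag (mem S) q).
Proof.
move=> mod SU ql RS hE.
have qb c r : quotient_bag bag (mem S) q c = Some r <->
   exists v, [/\ bag c = Some v, v \in S & q v = r].
  rewrite /quotient_bag; split.
    by case: (bag c) => // v /=; case: ifP => // vS [<-]; exists v.
  by case=> v [-> /= -> ->].
split.
- move=> r /(subsetP RS)/imsetP[v vS rE]; have [c cv] := model_inh mod (subsetP SU _ vS).
  by exists c; apply/qb; exists v.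
- move=> r _ a b; rewrite !inE => /eqP/qb[u [au uS qu]] /eqP/qb[v [bv vS qv]].
  set B := [set c | _].
  have sub w : w \in S -> q w = r -> [set c | bag c == Some w] \subset B.
    move=> wS qw; apply/subsetP => c; rewrite !inE => /eqP cw.
    by apply/eqP/qb; exists w.
  have /connectP[p] := ql r u v ltac:(by rewrite inE uS qu eqxx) ltac:(by rewrite inE vS qv eqxx).
  elim: p a u au uS qu => [|w p IH] a u au uS qu /=.
    move=> _ vu; subst v; apply: (rel_inS (sub u uS qu)).
    by apply: (model_linked mod (subsetP SU _ uS)); rewrite inE ?au ?bv.
  case/andP => /and3P[euw _]; rewrite inE => /andP[wS /eqP qw] pw vE.
  have [x [xu xw]] := model_edge mod (subsetP SU _ uS) (subsetP SU _ wS) euw.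
  have c1 : connect (rel_in (@cell_adj Q) B) a (own x).
    apply: (rel_inS (sub u uS qu)).
    by apply: (model_linked mod (subsetP SU _ uS)); rewrite inE ?au ?xu.
  apply: (connect_trans c1); apply: connect_trans (IH (own (opposite x)) w xw wS qw pw vE).
  have [->|xx] := eqVneq (opposite x) x; first exact: connect0.
  apply: connect1; rewrite /rel_in; apply/and3P; split.
  + by apply/existsP; exists x; rewrite !eqxx.
  + by apply: (subsetP (sub u uS qu)); rewrite inE xu.
  + by apply: (subsetP (sub w wS qw)); rewrite inE xw.
- move=> r r' rR r'R /(hE _ _ rR r'R)[u [v [uS vS euv qu qv]]].
  have [x [xu xv]] := model_edge mod (subsetP SU _ uS) (subsetP SU _ vS) euv.
  by exists x; split; apply/qb; [exists u | exists v].
Qed.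

Definition quotient_rel (V : finType) (e : rel V) (S : {set V}) (q : V -> V) : rel V :=
  fun r r' => (r != r') && [exists u in S, exists v in S, [&& e u v, q u == r & q v == r']].

(* [arcs] counts each edge twice: the bounds on the numbers of edges are
   [5/3 (n + gamma)] and [3 (n + gamma)]. *)
Record sparse (V : finType) (e : rel V) (U : {set V}) (gamma : nat) : Prop := Sparse {
  sparse_sub : forall S : {set V}, S \subset U -> 3 * #|arcs e S| <= 10 * (#|S| + gamma);
  sparse_minor : forall (S R : {set V}) (q : V -> V), S \subset U ->
    (forall r, linked e [set v in S | q v == r]) -> R \subset q @: S ->
    #|arcs (quotient_rel e S q) R| <= 6 * (#|R| + gamma) }.

(** With a arcs, n vertices and p periods, [euler_ineq] for g = 5 gives 3 a <= 10 (n + p) on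
    subgraphs. A quotient may contain triangles, but it is simple, and g = 3 gives a <= 6 (n +
    p). *)
Lemma model_sparse (Q : complex) (V : finType) (e : rel V) (U : {set V}) (bag : cell Q -> option V) :
  symmetric e -> irreflexive e -> (forall s, ucycle e s -> 3 <= size s -> 5 <= size s) ->
  model e U bag -> sparse e U #|period_index Q|.
Proof.
move=> esym eirr girth mod; split.
  move=> S SU.
  have mS : model e S (quotient_bag bag (mem S) id).
    apply: (quotient_model mod SU) => [r||].
    - by move=> u v; rewrite !inE => /andP[_ /eqP->] /andP[_ /eqP->]; apply: connect0.
    - by rewrite imset_id.
    - by move=> r r' rS r'S err; exists r, r'.
  have := euler_ineq esym eirr mS (even_girth_geP eirr girth).
  lia.
move=> S R q SU ql RS.
have hirr : irreflexive (quotient_rel e S q) by move=> r; rewrite /quotient_rel eqxx.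
have hsym : symmetric (quotient_rel e S q).
  have aux r r' : quotient_rel e S q r r' -> quotient_rel e S q r' r.
    case/andP => ne /existsP[u /andP[uS /existsP[v /and4P[vS euv qu qv]]]].
    rewrite /quotient_rel eq_sym ne; apply/existsP; exists v; rewrite vS.
    by apply/existsP; exists u; rewrite uS esym euv qu qv.
  by move=> r r'; apply/idP/idP; apply: aux.
have mS : model (quotient_rel e S q) R (quotient_bag bag (mem S) q).
  apply: (quotient_model mod SU) => // r r' rR r'R.
  case/andP => ne /existsP[u /andP[uS /existsP[v /and4P[vS euv /eqP qu /eqP qv]]]].
  by exists u, v.
have := euler_ineq hsym hirr mS (even_girth_geP hirr (fun s _ h => h)).
lia.
Qed.

(** * Clusterings of bounded degree graphs *)

(* Each vertex picks its heaviest neighbour among those removed after it. Since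
   [th] is a proper 2-colouring of the resulting forest, the picks of one colour
   class form disjoint stars. *)
Lemma heavy_forest (T : finType) (w : T -> T -> nat) (d : nat) (R : {set T}) :
  (forall x y, w x y = w y x) ->
  (forall S : {set T}, S \subset R -> S != set0 ->
     exists2 x, x \in S & #|[set y in S | (y != x) && (0 < w x y)]| <= d) ->
  exists (p : T -> T) (th : T -> bool),
    [/\ {in R, forall x, p x \in R},
        {in R, forall x, p x != x -> th (p x) = ~~ th x /\ 0 < w x (p x)} &
        \sum_(x in R) \sum_(y in R | y != x) w x y
          <= 2 * d * \sum_(x in R | p x != x) w x (p x)].
Proof.
move=> wsym; have [n] := ubnP #|R|; elim: n R => // n IH R Rn degen.
have [->|R0] := eqVneq R set0.
  by exists id, (fun=> false); split => [x|x|]; rewrite ?inE ?big_set0.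
have [r rR rd] := degen R (subxx _) R0.
have Rr : R :\ r \subset R by apply: subD1set.
have [||p [th [pR pth wp]]] := IH (R :\ r).
- by move: Rn; rewrite (cardsD1 r) rR.
- by move=> S SR; apply: degen; apply: subset_trans SR Rr.
set N := [set y in R | _] in rd.
(* Without remaining neighbours, [r] picks itself and becomes a root. *)
pose b := if [pick y in N] is Some y0 then [arg max_(y > y0 in N) w r y] else r.
have [bN bmax] : (b \in N \/ N = set0 /\ b = r) /\ (forall y, y \in N -> w r y <= w r b).
  rewrite /b; case: pickP => [y0 y0N|N0].
    by case: arg_maxnP => // y yN ymax; split; [left|].
  split; last by move=> y; rewrite N0.
  by right; split=> //; apply/setP => y; rewrite N0 inE.
exists (fun x => if x == r then b else p x), (fun x => if x == r then ~~ th b else th x).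
have NR y : y \in N -> [/\ y \in R, y != r & 0 < w r y] by rewrite inE => /and3P[].
split.
- move=> x xR; case: (x =P r) => [_|/eqP xr]; last by apply/(subsetP Rr)/pR; rewrite !inE xr.
  by case: bN => [/NR[]//|[_ ->]].
- move=> x xR; case: (x =P r) => [->|/eqP xr].
    by case: bN => [/NR[_ /negbTE-> w0] _|[_ ->]]; rewrite ?negbK ?eqxx.
  have xRr : x \in R :\ r by rewrite !inE xr.
  have := pR _ xRr; rewrite !inE => /andP[/negbTE-> _]; exact: pth.
rewrite (big_setD1 r) //=.
have E1 : \sum_(x in R :\ r) \sum_(y in R | y != x) w x y =
   \sum_(x in R :\ r) (w x r + \sum_(y in R :\ r | y != x) w x y).
  apply: eq_bigr => x; rewrite !inE => /andP[xr xR].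
  rewrite (bigD1 r) /=; last by rewrite rR eq_sym.
  by congr addn; apply: eq_bigl => y; rewrite !inE; case: (y == r); rewrite ?andbF ?andbT.
rewrite E1 big_split /=.
have E2 : \sum_(y in R | y != r) w r y = \sum_(y in R :\ r) w r y.
  by apply: eq_bigl => y; rewrite !inE andbC.
have E3 : \sum_(x in R :\ r) w x r = \sum_(y in R :\ r) w r y.
  by apply: eq_bigr => y _; apply: wsym.
(* [r] has at most [d] neighbours left, none heavier than its pick. This weight occurs in both
   orders of the pair, hence the factor [2 * d]. *)
have E4 : \sum_(y in R :\ r) w r y <= d * w r b.
  apply: (@leq_trans (\sum_(y in N) w r b)); last first.
    by rewrite sum_nat_const leq_mul2r rd orbT.
  rewrite big_mkcond [X in _ <= X]big_mkcond /=; apply: leq_sum => y _.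
  case: ifP => [yR|//]; case: ifP => [/bmax//|/negbT].
  move: yR; rewrite !inE => /andP[-> ->] /=; by rewrite -leqNgt.
have E5 : \sum_(x in R | (if x == r then b else p x) != x) w x (if x == r then b else p x)
   = (b != r) * w r b + \sum_(x in R :\ r | p x != x) w x (p x).
  rewrite big_mkcondr (big_setD1 r) //= eqxx [in RHS]big_mkcondr; congr addn.
    by case: (b != r); rewrite ?mul1n ?mul0n.
  by apply: eq_bigr => x; rewrite !inE => /andP[/negbTE-> _].
rewrite E2 E3 E5 mulnDr addnA; apply: leq_add wp.
case: bN => [/NR[_ -> _]|[N0 _]]; first by lia.
suff -> : \sum_(y in R :\ r) w r y = 0 by [].
apply: big1 => y; rewrite !inE => /andP[yr yR].
have : y \notin N by rewrite N0 inE.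
by rewrite inE yR yr /= -eqn0Ngt => /eqP.
Qed.

Lemma card_bigcup_le (I T : finType) (A : {set I}) (F : I -> {set T}) (s : nat) :
  {in A, forall i, #|F i| <= s} -> #|\bigcup_(i in A) F i| <= #|A| * s.
Proof.
move=> Fs; rewrite -sum_nat_const.
apply: (@leq_trans (\sum_(i in A) #|F i|)); last exact: leq_sum.
elim/big_rec2: _ => [|i m B _ IH]; first by rewrite cards0.
by rewrite cardsU; lia.
Qed.

Section Clustering.
Variables (V : finType) (e : rel V) (S : {set V}) (D d : nat).
Hypotheses (esym : symmetric e).
Hypothesis degS : forall v, v \in S -> #|[set u in S | e v u]| <= D.
Hypothesis d_gt0 : 0 < d.
Hypothesis degen : forall (q : V -> V) (R : {set V}),
  (forall r, linked e [set v in S | q v == r]) -> R \subset q @: S -> R != set0 ->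
  #|arcs (quotient_rel e S q) R| <= d * #|R|.

Definition fibre (q : V -> V) r := [set v in S | q v == r].
Definition cut (q : V -> V) := [set p in arcs e S | q p.1 != q p.2].

(** Of the picks of [heavy_forest], only those made by the heavier colour [b] are contracted. A
    picked cluster has the other colour and stays put, so [p'] is idempotent and stars are
    contracted. The arcs in [A] cease to be cut; they are at least a fraction 1/(4d) of the cut, 2d
    coming from the forest and 2 from the choice of a colour. Each satellite of a star contains one
    of the at most s D neighbours of its centre, which bounds the size. *)
Lemma coarsen (q : V -> V) (s : nat) :
  (forall r, linked e (fibre q r)) -> (forall r, #|fibre q r| <= s) ->
  exists q' : V -> V, [/\ forall r, linked e (fibre q' r),
    forall r, #|fibre q' r| <= s + s * (D * s) &
    4 * d * #|cut q'| <= (4 * d).-1 * #|cut q| ].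
Proof.
move=> ql qs.
pose w r r' := #|[set p in arcs e S | (q p.1 == r) && (q p.2 == r')]|.
have wsym r r' : w r r' = w r' r.
  have sw : involutive (fun p : V * V => (p.2, p.1)) by case.
  rewrite /w -(card_imset _ (can_inj sw)); apply: eq_card => -[u v].
  apply/imsetP/idP => [[[u' v'] + [-> ->]]|].
    by rewrite !inE /= esym => /andP[/and3P[-> -> ->] /andP[-> ->]].
  rewrite !inE /= esym => /andP[/and3P[euv uS vS] /andP[qu qv]].
  by exists (v, u); rewrite ?inE /= ?euv ?uS ?vS ?qu ?qv.
have w_gt0 r r' : 0 < w r r' -> exists u v,
    [/\ u \in fibre q r, v \in fibre q r' & e u v].
  rewrite card_gt0 => /set0Pn[[u v]]; rewrite !inE /=.
  case/andP => /and3P[euv uS vS] /andP[qu qv]; exists u, v.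
  by rewrite !inE uS qu vS qv.
have [|p [th [pR pth wp]]] := @heavy_forest V w d (q @: S) wsym.
  move=> R RS R0; have := degen ql RS R0.
  have -> : #|arcs (quotient_rel e S q) R|
      = \sum_(x in R) #|[set y in R | (y != x) && (0 < w x y)]|.
    rewrite -sum1_card [RHS](eq_bigr (fun x => \sum_(y in R | (y != x) && (0 < w x y)) 1)).
      rewrite pair_big_dep /=; apply: eq_bigl => -[x y]; rewrite !inE /= /quotient_rel.
      rewrite (eq_sym x) andbC -andbA; do 2!congr andb; rewrite [RHS]andbC andbC; congr andb.
      rewrite card_gt0; apply/idP/set0Pn.
        case/existsP => u /andP[uS /existsP[v /and4P[vS euv qu qv]]].
        by exists (u, v); rewrite !inE /= euv uS vS qu qv.
      case=> -[u v]; rewrite !inE /= => /andP[/and3P[euv uS vS] /andP[qu qv]].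
      by apply/existsP; exists u; rewrite uS; apply/existsP; exists v; rewrite vS euv qu qv.
    by move=> x _; rewrite -sum1_card; apply: eq_bigl => y; rewrite inE.
  move=> H; apply/exists_inP; rewrite -[X in is_true X]negbK negb_exists_in.
  apply/negP => /forall_inP K; move: H; rewrite leqNgt => /negP; apply.
  have Rpos : 0 < #|R| by rewrite card_gt0.
  apply: (@leq_trans (\sum_(x in R) d.+1)); first by rewrite sum_nat_const; nia.
  by apply: leq_sum => x xR; rewrite ltnNge K.
pose W b := \sum_(x in q @: S | (p x != x) && (th x == b)) w x (p x).
have W2 : \sum_(x in q @: S | p x != x) w x (p x) = W true + W false.
  rewrite (bigID (fun x => th x == true)) /=; congr addn; apply: eq_bigl => x.
    by rewrite andbA.
  by rewrite andbA; case: (th x).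
have [b Wb] : exists b, \sum_(x in q @: S | p x != x) w x (p x) <= 2 * W b.
  by rewrite W2; case: (leqP (W true) (W false)) => ?; [exists false|exists true]; lia.
pose p' x := if (x \in q @: S) && (th x == b) then p x else x.
have p'P x : x \in q @: S -> p' x != x ->
    [/\ p' x \in q @: S, p' (p' x) = p' x, th x = b, p' x = p x & 0 < w x (p' x)].
  move=> xR; rewrite /p' xR /=; case: (th x =P b) => [thx px|]; last by rewrite eqxx.
  have [th1 w0] := pth x xR px; split => //; first exact: pR.
  by rewrite pR //= th1 thx; case: (b).
have fib_sub r : p' r = r -> fibre q r \subset fibre (p' \o q) r.
  by move=> pr; apply/subsetP => v; rewrite !inE => /andP[-> /eqP vr] /=; rewrite vr pr.
exists (p' \o q); split.
- move=> r u v uF vF.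
  have to_r x : x \in fibre (p' \o q) r ->
      exists2 y, y \in fibre q r & connect (rel_in e (fibre (p' \o q) r)) x y.
    rewrite inE /= => /andP[xS /eqP px].
    have qx : q x \in q @: S by apply: imset_f.
    have [pq|pq] := eqVneq (p' (q x)) (q x).
      by exists x; rewrite ?connect0 // inE xS -px pq eqxx.
    have [_ pp _ _ w0] := p'P _ qx pq; rewrite px in pp w0 pq.
    have [x' [y [x'F yF exy]]] := w_gt0 _ _ w0.
    exists y => //; apply: (@connect_trans _ _ x').
      apply: (rel_inS (A := fibre q (q x))); last by apply: ql; rewrite // inE xS eqxx.
      by apply/subsetP => z; rewrite !inE => /andP[-> /eqP zx] /=; rewrite zx px.
    apply: connect1; rewrite /rel_in exy (subsetP (fib_sub _ pp) _ yF) andbT.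
    by move: x'F; rewrite !inE => /andP[-> /eqP zx] /=; rewrite zx px eqxx.
  have [u' u'F cu] := to_r u uF; have [v' v'F cv] := to_r v vF.
  apply: (connect_trans cu); rewrite connect_rel_in_sym //.
  apply: (connect_trans cv); apply: rel_inS (ql r _ _ v'F u'F).
  have [pr|pr] := eqVneq (p' r) r; first exact: fib_sub.
  exfalso; move: uF; rewrite inE /= => /andP[uS /eqP pu].
  have qu : q u \in q @: S by apply: imset_f.
  have [E|ne] := eqVneq (p' (q u)) (q u).
    by move: pr; rewrite -pu E E eqxx.
  have [_ pp _ _ _] := p'P _ qu ne.
  by move: pr; rewrite -pu pp eqxx.
- move=> r; pose N := \bigcup_(v in fibre q r) [set u in S | e v u].
  have cN : #|N| <= s * D.
    apply: (@leq_trans (#|fibre q r| * D)); last by rewrite leq_mul2r qs orbT.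
    by apply: card_bigcup_le => v; rewrite inE => /andP[/degS].
  have -> : s + s * (D * s) = s + (s * D) * s by rewrite mulnA.
  have sub : fibre (p' \o q) r \subset fibre q r :|: \bigcup_(u in N) fibre q (q u).
    apply/subsetP => x; rewrite inE /= => /andP[xS /eqP px].
    have qx : q x \in q @: S by apply: imset_f.
    have [pq|pq] := eqVneq (p' (q x)) (q x).
      by rewrite inE [in X in X || _]inE xS -px pq eqxx.
    have [_ _ _ _ w0] := p'P _ qx pq; rewrite px in w0.
    have [x' [y [x'F yF exy]]] := w_gt0 _ _ w0.
    rewrite inE; apply/orP; right; apply/bigcupP; exists x'.
      apply/bigcupP; exists y => //; rewrite inE esym exy andbT.
      by move: x'F; rewrite inE => /andP[].
    by rewrite inE xS; move: x'F; rewrite inE => /andP[_ /eqP->] /=.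
  apply: (leq_trans (subset_leq_card sub)); rewrite cardsU.
  apply: (leq_trans (leq_subr _ _)); apply: leq_add (qs r) _.
  apply: (@leq_trans (#|N| * s)); first by apply: card_bigcup_le => u _; apply: qs.
  by rewrite leq_mul2r cN orbT.
- have cutE : #|cut q| = \sum_(x in q @: S) \sum_(y in q @: S | y != x) w x y.
    rewrite -sum1_card (partition_big (fun p => (q p.1, q p.2))
       (fun r => (r.1 \in q @: S) && ((r.2 \in q @: S) && (r.2 != r.1)))) /=; last first.
      by move=> [u v]; rewrite !inE /= => /andP[/and3P[_ uS vS] ne]; rewrite !imset_f // eq_sym.
    rewrite [RHS]pair_big_dep /=; apply: eq_bigr => -[r r'] /= /and3P[_ _ ne].
    rewrite /w -sum1_card; apply: eq_bigl => -[u v]; rewrite !inE /= -andbA; congr andb.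
    by rewrite xpair_eqE; case: (q u =P r) => [->|]; rewrite ?andbF //; case: (q v =P r') => [->|]; rewrite ?andbF // (eq_sym r) ne.
  pose A := [set x in cut q | (th (q x.1) == b) && (q x.2 == p (q x.1))].
  have cA : #|A| = W b.
    rewrite -sum1_card (partition_big (fun x => q x.1)
      (fun r => (r \in q @: S) && ((p r != r) && (th r == b)))) /=; last first.
      move=> [u v]; rewrite !inE /= => /andP[/andP[/and3P[_ uS vS] ne] /andP[-> /eqP qv]].
      by rewrite imset_f // -qv eq_sym ne.
    apply: eq_bigr => r /and3P[rR pr thr]; rewrite /w -sum1_card; apply: eq_bigl => -[u v].
    rewrite !inE /= -!andbA; do 3!congr andb.
    case: (q u =P r) => [->|]; rewrite ?andbF //= thr /= andbT.
    by case: (q v =P p r) => [->|]; rewrite ?andbF // eq_sym pr.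
  have AC : A \subset cut q by apply/subsetP => x; rewrite inE => /andP[].
  have CC : cut (p' \o q) \subset cut q :\: A.
    apply/subsetP => -[u v]; rewrite !inE /= => /andP[/and3P[-> uS vS] ne]; rewrite uS vS /=.
    have ne' : q u != q v by apply: contraNneq ne => ->.
    rewrite ne' /= andbT; apply/negP => /andP[thu /eqP qv].
    have qu : q u \in q @: S by apply: imset_f.
    have pu : p' (q u) = p (q u) by rewrite /p' qu thu.
    have pne : p' (q u) != q u by rewrite pu -qv eq_sym.
    have [_ pp _ _ _] := p'P _ qu pne.
    by move: ne; rewrite qv -pu pp eqxx.
  have := subset_leq_card CC; rewrite cardsD (setIidPr AC) => H1.
  have H2 := subset_leq_card AC.
  move: wp; rewrite -cutE => H3.
  have {Wb} H4 : #|cut q| <= 4 * d * #|A|.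
    by rewrite cA; apply: (leq_trans H3); rewrite (_ : 4 * d = 2 * d * 2) -?mulnA ?leq_mul2l ?Wb ?orbT //; lia.
  case E: (4 * d) H4 => [|k]; first by move: d_gt0 E; clear; lia.
  move=> H4 /=; have {H1 H2} H5 : #|cut (p' \o q)| + #|A| <= #|cut q|.
    by move: H1 H2; clear; lia.
  have := leq_mul (leqnn k.+1) H5; move: H4; rewrite mulnDr !mulSn.
  by move=> a c; rewrite -(leq_add2r (#|A| + k * #|A|)); apply: (leq_trans c); rewrite addnC leq_add2l.
Qed.

Fixpoint cluster_size (j : nat) : nat :=
  if j is i.+1 then cluster_size i + cluster_size i * (D * cluster_size i) else 1.

Lemma coarsen_iter (j : nat) : exists q : V -> V,
  [/\ forall r, linked e (fibre q r), forall r, #|fibre q r| <= cluster_size j &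
      (4 * d) ^ j * #|cut q| <= (4 * d).-1 ^ j * (D * #|S|)].
Proof.
elim: j => [|j [q [q1 q2 q3]]].
  exists id; split.
  - by move=> r u v; rewrite !inE => /andP[_ /eqP->] /andP[_ /eqP->]; apply: connect0.
  - move=> r /=; rewrite -(cards1 r); apply/subset_leq_card/subsetP => v.
    by rewrite !inE => /andP[].
  - rewrite !expn0 !mul1n; apply: (@leq_trans #|arcs e S|).
      by apply/subset_leq_card/subsetP => p; rewrite inE => /andP[].
    rewrite mulnC -sum_nat_const.
    have -> : #|arcs e S| = \sum_(v in S) #|[set u in S | e v u]|.
      rewrite -sum1_card [RHS](eq_bigr (fun v => \sum_(u in S | e v u) 1)).
        by rewrite pair_big_dep /=; apply: eq_bigl => -[u v]; rewrite !inE /= andbC -andbA.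
      by move=> v _; rewrite -sum1_card; apply: eq_bigl => u; rewrite inE.
    exact: leq_sum.
have [q' [p1 p2 p3]] := coarsen q1 q2; exists q'; split => //.
rewrite expnSr -mulnA; apply: (leq_trans (leq_mul (leqnn _) p3)).
by rewrite mulnCA [X in _ <= X * _]expnS -mulnA leq_mul2l q3 orbT.
Qed.

End Clustering.

(** [H] is Bernoulli's inequality, (a + 1)^j >= a^j + j a^(j - 1). *)
Lemma ratio_expn_unbounded (a m : nat) : 0 < a -> exists j, m * a.-1 ^ j <= a ^ j.
Proof.
case: a => // a _ /=; exists (m * a + 1)%N.
have H j : a ^ j + j * a ^ j.-1 <= a.+1 ^ j.
  elim: j => [|] // -[|j] IH /=; first by rewrite !expn1 expn0; lia.
  move: IH => /= IH; rewrite [a.+1 ^ _]expnS !expnS in IH *; nia.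
have := H (m * a + 1)%N; rewrite addn1 /= expnS; nia.
Qed.

(** Every round of [coarsen] multiplies the cut by at most 1 - 1/(4d), starting from at most
    [D * #|S|] for singletons. So the number of rounds, and with it [s], depends on [D], [d] and [m]
    only. *)
Lemma bounded_clusters (D d m : nat) : 0 < d -> exists s, forall (V : finType) (e : rel V) (S : {set V}),
  symmetric e -> (forall v, v \in S -> #|[set u in S | e v u]| <= D) ->
  (forall (q : V -> V) (R : {set V}),
    (forall r, linked e [set v in S | q v == r]) -> R \subset q @: S -> R != set0 ->
    #|arcs (quotient_rel e S q) R| <= d * #|R|) ->
  exists q : V -> V, (forall r, #|fibre S q r| <= s) /\ m * #|cut e S q| <= #|S|.
Proof.
move=> d0; have [|j jP] := @ratio_expn_unbounded (4 * d) (m * D); first by lia.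
exists (cluster_size D j) => V e S esym degS degen.
have [q [_ q2 q3]] := coarsen_iter esym degS d0 degen j.
exists q; split=> //.
have H : 0 < (4 * d) ^ j by rewrite expn_gt0; lia.
rewrite -(leq_pmul2l H); move: q3 jP; move: (_ ^ j) (_ ^ j) => x y; nia.
Qed.

(** * Islands and colourings *)

(** [key] names an island by the number of vertices left after its removal, which strictly
    decreases. It replaces components in the induction: monochromatic edges stay within one
    island. *)
Lemma colour_of_islands (V : finType) (e : rel V) (c : nat) :
  symmetric e ->
  (forall W : {set V}, W != set0 -> exists S : {set V},
     [/\ S != set0, S \subset W, #|S| <= c &
         {in S, forall v, #|[set w in W :\: S | e v w]| <= 2}]) ->
  exists (col : V -> 'I_3) (key : V -> nat),
    (forall x y, e x y -> col x = col y -> key x = key y) /\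
    (forall n, #|[set x | key x == n]| <= c).
Proof.
move=> esym island.
suff: forall W : {set V}, exists (col : V -> 'I_3) (key : V -> nat),
    [/\ {in W, forall x, key x < #|W|},
        {in W &, forall x y, e x y -> col x = col y -> key x = key y} &
        forall n, #|[set x in W | key x == n]| <= c].
  case/(_ [set: V]) => col [key [_ H1 H2]]; exists col, key; split.
    by move=> x y; apply: H1; rewrite inE.
  by move=> n; rewrite -(eq_card (_ : [set x in [set: V] | key x == n] =i _)) // => x; rewrite !inE.
move=> W; have [n] := ubnP #|W|; elim: n W => // n IH W Wn.
have [->|W0] := eqVneq W set0.
  exists (fun=> ord0), (fun=> 0); split=> [x|x y|k]; rewrite ?inE //.
  by rewrite (eq_card0 (A := [set _ in _ | _])) // => x; rewrite !inE.
have [S [S0 SW Sc S2]] := island W W0.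
have cW : #|W| = #|S| + #|W :\: S| by rewrite -(cardsID S W) (setIidPr SW).
have cS : 0 < #|S| by rewrite card_gt0.
have [|col [key [k1 k2 k3]]] := IH (W :\: S); first by lia.
have /fin_all_exists[f fP] : forall v : V, exists a : 'I_3, v \in S ->
    forall w, w \in W :\: S -> e v w -> col w != a.
  move=> v; case vS: (v \in S); last by exists ord0.
  have lt : #|col @: [set w in W :\: S | e v w]| < #|'I_3|.
    by rewrite card_ord ltnS; apply: leq_trans (leq_imset_card _ _) (S2 v vS).
  have /set0Pn[a] : ~: (col @: [set w in W :\: S | e v w]) != set0.
    by rewrite -card_gt0 cardsCs setCK subn_gt0.
  rewrite inE => na; exists a => _ w wW evw; apply: contraNneq na => <-.
  by apply: imset_f; rewrite inE wW evw.
exists (fun v => if v \in S then f v else col v).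
exists (fun v => if v \in S then #|W :\: S| else key v); split.
- move=> x xW; case: ifP => [_|xS]; first by lia.
  by have := k1 x; rewrite inE xW xS => /(_ isT); lia.
- move=> x y xW yW exy; case: ifP => xS; case: ifP => yS //.
  + move=> fx; have := fP x xS y; rewrite inE yW yS fx => /(_ isT exy).
    by rewrite eqxx.
  + move=> fy; have := fP y yS x; rewrite inE xW xS fy esym => /(_ isT exy).
    by rewrite eqxx.
  + by apply: k2; rewrite // inE ?xS ?yS.
- move=> k; have [->|ne] := eqVneq k #|W :\: S|.
    apply: leq_trans (subset_leq_card _) Sc; apply/subsetP => x.
    rewrite inE; case: ifP => // xS /andP[xW /eqP E].
    by have := k1 x; rewrite inE xW xS E ltnn => /(_ isT).
  apply: leq_trans (subset_leq_card _) (k3 k); apply/subsetP => x.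
  rewrite !inE; case: ifP => [xS|xS /andP[-> ->] //].
  by rewrite eq_sym (negbTE ne) andbF.
Qed.

Definition incident (V : finType) (e : rel V) (W S : {set V}) : {set V * V} :=
  [set p in arcs e W | (p.1 \in S) || (p.2 \in S)].

(** A vertex removed from the current set has three neighbours in [W] outside that set. The three
    edges, six arcs, do not meet what remains of the set, so nothing is counted twice until [P] is
    exhausted. *)
Lemma no_island_incident (V : finType) (e : rel V) (W P : {set V}) :
  symmetric e -> P \subset W ->
  (forall S : {set V}, S != set0 -> S \subset P ->
     exists2 v, v \in S & 2 < #|[set w in W :\: S | e v w]|) ->
  6 * #|P| <= #|incident e W P|.
Proof.
move=> esym PW noisl.
suff: forall S : {set V}, S \subset P -> 6 * #|S| <= #|incident e W S| by apply.
move=> S; have [n] := ubnP #|S|; elim: n S => // n IH S Sn SP.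
have [->|S0] := eqVneq S set0; first by rewrite cards0 muln0.
have [v vS v3] := noisl S S0 SP.
have {IH} := IH (S :\ v); rewrite (cardsD1 v S) vS in Sn *.
move=> /(_ Sn (subset_trans (subD1set _ _) SP)) IH.
set N := [set w in _ | _] in v3.
pose A1 := [set (v, w) | w in N]; pose A2 := [set (w, v) | w in N].
have c1 : #|A1| = #|N| by apply: card_imset => ? ? [].
have c2 : #|A2| = #|N| by apply: card_imset => ? ? [].
have vW : v \in W by apply: (subsetP PW); apply: (subsetP SP).
have d12 : [disjoint A1 & A2].
  apply/pred0Pn => -[p /andP[/imsetP[w wN ->] /imsetP[w' w'N [vw' wv]]]].
  by move: wN; rewrite wv !inE vS.
have d3 : [disjoint A1 :|: A2 & incident e W (S :\ v)].
  apply/pred0Pn => -[p /andP[]]; rewrite !inE.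
  case/orP => /imsetP[w + ->] /=; rewrite !inE => /andP[/andP[/negbTE-> _] _].
    by rewrite eqxx /= !andbF.
  by rewrite eqxx /= !andbF.
have sub : A1 :|: A2 :|: incident e W (S :\ v) \subset incident e W S.
  apply/subsetP => p; rewrite !inE => /orP[/orP[]/imsetP[w + ->] /=|].
  - by rewrite !inE => /andP[/andP[wS wW] evw]; rewrite evw vW wW vS.
  - by rewrite !inE => /andP[/andP[wS wW] evw]; rewrite esym evw vW wW vS orbT.
  - by move=> /andP[-> /orP[]/andP[_ ->]]; rewrite ?orbT.
have := subset_leq_card sub.
have -> : #|A1 :|: A2 :|: incident e W (S :\ v)| = #|N| + #|N| + #|incident e W (S :\ v)|.
  rewrite cardsU (_ : (A1 :|: A2) :&: _ = set0); last exact/disjoint_setI0.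
  by rewrite cards0 subn0 cardsU (disjoint_setI0 d12) cards0 subn0 c1 c2.
apply: leq_trans; rewrite /= mulnDr; apply: leq_add IH; exact: (leq_add v3 v3).
Qed.

Lemma card_pairs_sum (V : finType) (e : rel V) (A B : {set V}) :
  #|[set p : V * V | [&& p.1 \in A, p.2 \in B & e p.1 p.2]]|
  = \sum_(v in A) #|[set u in B | e v u]|.
Proof.
rewrite -sum1_card [RHS](eq_bigr (fun v => \sum_(u in B | e v u) 1)).
  by rewrite pair_big_dep /=; apply: eq_bigl => -[u v]; rewrite !inE.
by move=> v _; rewrite -sum1_card; apply: eq_bigl => u; rewrite inE.
Qed.

Lemma card_arcs_sum (V : finType) (e : rel V) (A : {set V}) :
  #|arcs e A| = \sum_(v in A) #|[set u in A | e v u]|.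
Proof.
rewrite -card_pairs_sum; apply: eq_card => p; rewrite !inE.
by case: (e p.1 p.2); rewrite /= ?andbT ?andbF.
Qed.

(* Without 4-cycles two vertices of [A] have at most one common neighbour, so
   all but [|A|^2] vertices see [A] at most once. *)
Lemma apex_arcs (V : finType) (e : rel V) (A L : {set V}) :
  (forall a b u v, a != b -> u != v -> e u a -> e u b -> e v a -> e v b -> False) ->
  #|[set p : V * V | [&& p.1 \in L, p.2 \in A & e p.1 p.2]]| <= #|L| + #|A| * #|A|.
Proof.
move=> noC4; rewrite card_pairs_sum.
pose Z v := [set p : V * V | [&& p.1 \in A, p.2 \in A, p.1 != p.2, e v p.1 & e v p.2]].
have step v : #|[set u in A | e v u]| <= 1 + #|Z v|.
  set N := [set u in A | _]; case: (leqP #|N| 1) => [le|gt]; first by lia.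
  have [a aN] : exists a, a \in N by apply/card_gt0P; lia.
  have sub : [set (a, b) | b in N :\ a] \subset Z v.
    apply/subsetP => _ /imsetP[b + ->]; move: aN; rewrite !inE /= => /andP[-> ->].
    by move=> /and3P[ba -> ->]; rewrite eq_sym ba.
  have := subset_leq_card sub; rewrite card_imset; last by move=> ? ? [].
  by rewrite (cardsD1 a N) aN.
apply: (@leq_trans (\sum_(v in L) (1 + #|Z v|))); first exact: leq_sum.
rewrite big_split /= sum1_card leq_add2l.
have -> : \sum_(v in L) #|Z v| = \sum_(p : V * V) #|[set v in L | p \in Z v]|.
  rewrite (eq_bigr (fun v => \sum_(p | p \in Z v) 1)); last by move=> v _; rewrite sum1_card.
  rewrite (exchange_big_dep predT) //=; apply: eq_bigr => p _.
  by rewrite -sum1_card; apply: eq_bigl => v; rewrite inE.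
rewrite -cardsX -sum1_card [X in _ <= X]big_mkcond /=; apply: leq_sum => -[a b] _.
case: ifP => [_|/negbT nab].
  rewrite leqNgt; apply/negP => /card_gt1P[u [v [uZ vZ uv]]].
  move: uZ vZ; rewrite !inE /= => /andP[_ /and5P[_ _ ab ua ub]] /andP[_ /and5P[_ _ _ va vb]].
  exact: (noC4 a b u v).
rewrite leqn0 cards_eq0; apply/eqP/setP => v; rewrite !inE /=.
by move: nab; rewrite inE /= negb_and => /orP[] /negbTE->; rewrite !andbF.
Qed.

(** [u], [h], [l] are the sizes of [U], [H], [L] below; [a], [la], [c] count the arcs in [U], those
    from [L] to the apex set, and those cut between clusters. Up to additive terms h <= 10/123 u, so
    u <= 123/113 l, and the bound on 6 l is at most (10/3 * 123/113 + 2 + 1/12) l < 5.72 l. The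
    factor 100 covers the additive terms. *)
Lemma island_count (a h c l u la A2 k k2 g : nat) :
  3 * a <= 10 * (u + g) -> 41 * h <= a -> 12 * c <= l -> u = h + l -> la <= l + A2 ->
  6 * l <= a + la + la + c -> 100 * (g + k2 + k + 1) < u -> A2 <= k2 -> False.
Proof. lia. Qed.

Lemma bounded_island (gamma k : nat) : exists c, forall (V : finType) (e : rel V) (A W : {set V}),
  symmetric e -> irreflexive e -> #|A| <= k ->
  (forall a b u v, a != b -> u != v -> e u a -> e u b -> e v a -> e v b -> False) ->
  sparse e (~: A) gamma -> W != set0 ->
  exists S : {set V}, [/\ S != set0, S \subset W, #|S| <= c &
         {in S, forall v, #|[set w in W :\: S | e v w]| <= 2}].
Proof.
(* 40 bounds the degrees outside [H], and 12 makes the cut small against the slack in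
   [island_count]. For nonempty [R] the minor bound [6 * (#|R| + gamma)] is at most
   [(6 + 6 * gamma) * #|R|]. *)
have [s sP] := @bounded_clusters 40 (6 + 6 * gamma) 12 (ltn0Sn _).
pose n0 := 100 * (gamma + k * k + k + 1).
exists (n0 + k + s) => V e A W esym eirr Ak noC4 [sub5 minor3] W0.
pose U := W :\: A.
have UA : U \subset ~: A by apply/subsetP => x; rewrite !inE => /andP[].
(* A small [W] is an island itself: nothing of [W] is outside. *)
have [Usmall|Ularge] := leqP #|U| n0.
  exists W; split => //.
    have : #|W| <= #|U| + #|A|.
      rewrite -(cardsID A W) addnC leq_add2l; apply/subset_leq_card/subsetP => x.
      by rewrite inE => /andP[].
    by lia.
  move=> v _; rewrite setDv (eq_card0 (A := [set _ in _ | _])) // => x; by rewrite !inE.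
pose H := [set u in U | 40 < #|[set w in U | e u w]|].
pose L := U :\: H.
have LU : L \subset U by apply: subsetDl.
have HU : H \subset U by apply/subsetP => x; rewrite inE => /andP[].
have cL : #|U| = #|H| + #|L| by rewrite -(cardsID H U) (setIidPr HU).
have aU := sub5 U UA.
have cH : 41 * #|H| <= #|arcs e U|.
  rewrite card_arcs_sum mulnC -sum_nat_const.
  apply: (@leq_trans (\sum_(v in H) #|[set u in U | e v u]|)).
    by apply: leq_sum => v; rewrite inE => /andP[].
  rewrite big_mkcond [X in _ <= X]big_mkcond /=; apply: leq_sum => v _.
  by case: ifP => // /(subsetP HU)->.
have [q [qs qcut]] : exists q : V -> V, (forall r, #|fibre L q r| <= s) /\ 12 * #|cut e L q| <= #|L|.
  apply: sP => //.
  - move=> v; rewrite !inE => /andP[+ vU]; rewrite vU /= -leqNgt; apply: leq_trans.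
    apply/subset_leq_card/subsetP => w; rewrite 2!inE => /andP[wL ->].
    by rewrite (subsetP LU).
  - move=> q R ql RL R0; apply: (leq_trans (minor3 L R q (subset_trans LU UA) ql RL)).
    have : 0 < #|R| by rewrite card_gt0.
    by nia.
have LW : L \subset W by apply: subset_trans LU _; apply: subsetDl.
have [r rI] : exists r, #|incident e W (fibre L q r)| < 6 * #|fibre L q r|.
  apply/existsP; rewrite -[X in is_true X]negbK negb_exists; apply/negP => /forallP no.
  have tot : \sum_r 6 * #|fibre L q r| <= \sum_r #|incident e W (fibre L q r)|.
    by apply: leq_sum => r _; rewrite leqNgt.
  have totL : \sum_r #|fibre L q r| = #|L|.
    rewrite -sum1_card [RHS](partition_big q predT) //=; apply: eq_bigr => r _.
    by rewrite -sum1_card; apply: eq_bigl => x; rewrite inE.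
  pose LA := [set p : V * V | [&& p.1 \in L, p.2 \in A & e p.1 p.2]].
  pose AL := [set p : V * V | (p.2, p.1) \in LA].
  have cAL : #|AL| = #|LA|.
    have sw : involutive (fun p : V * V => (p.2, p.1)) by case.
    rewrite -(card_preimset LA (can_inj sw)); apply: eq_card => p; by rewrite !inE.
  have cLA : #|LA| <= #|L| + #|A| * #|A| by apply: apex_arcs.
  (* An arc counts once for each cluster that it meets: at most once if it lies in [U], once more if
     it is cut, and once, in either direction, if it joins [L] to [A]. *)
  have ub : \sum_r #|incident e W (fibre L q r)| <= #|arcs e U| + #|LA| + #|AL| + #|cut e L q|.
    have cE (B : {set V * V}) : #|B| = \sum_(p : V * V) (p \in B).
      by rewrite -sum1_card big_mkcond /=; apply: eq_bigr => p _; case: (p \in _).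
    rewrite (eq_bigr _ (fun r _ => cE (incident e W (fibre L q r)))) exchange_big /=.
    rewrite (cE (arcs e U)) (cE LA) (cE AL) (cE (cut e L q)) -!big_split /=.
    apply: leq_sum => -[u v] _.
    have [uv|nuv] := boolP (e u v && (u \in W) && (v \in W)); last first.
      rewrite big1 // => r _; apply/eqP; rewrite eqb0; apply: contra nuv.
      by rewrite inE => /andP[+ _]; rewrite inE /= andbA.
    case/andP: uv => /andP[euv uW] vW.
    have H1 x : \sum_r (x \in fibre L q r) = (x \in L).
      rewrite (bigD1 (q x)) //= big1 ?addn0 => [|r rx]; first by rewrite inE eqxx andbT.
      by rewrite inE eq_sym (negbTE rx) andbF.
    have H2 : \sum_r ((u, v) \in incident e W (fibre L q r))
       <= \sum_r ((u \in fibre L q r) + (v \in fibre L q r)).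
      apply: leq_sum => r _; rewrite inE /=; case: (_ \in fibre _ _ _); case: (_ \in fibre _ _ _); rewrite ?andbF //= ?leq_b1 //.
      by case: (_ && _).
    have H3 : u \in L -> v \in L -> q u = q v ->
        \sum_r ((u, v) \in incident e W (fibre L q r)) <= 1.
      move=> uL vL quv; rewrite (bigD1 (q u)) //= big1 ?addn0 ?leq_b1 // => r rq.
      by rewrite inE /= !inE -quv eq_sym (negbTE rq) !andbF.
    move: H2; rewrite big_split /= !H1.
    have LUA x : x \in W -> (x \in U) = (x \notin A) by move=> xW; rewrite inE xW andbT.
    have LU' x : x \in L -> x \in U by apply: (subsetP LU).
    rewrite [(u, v) \in arcs e U]inE [(u, v) \in LA]inE [(u, v) \in AL]inE [(v, u) \in LA]inE.
    rewrite [(u, v) \in cut e L q]inE [(u, v) \in arcs e L]inE /= euv esym euv !andbT /=.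
    move: H3 (LUA u uW) (LUA v vW) (LU' u) (LU' v).
    case: (q u =P q v) => [->|_] H3.
      move: H3; case: (u \in L); case: (v \in L); case: (u \in U); case: (v \in U);
      case: (u \in A); case: (v \in A) => //= H3 ? ? ? ? H5; try lia;
      try (by have := H3 isT isT erefl; lia);
      by auto.
    move=> {H3}; case: (u \in L); case: (v \in L); case: (u \in U); case: (v \in U);
    case: (u \in A); case: (v \in A) => //= ? ? ? ? H5; try lia; by auto.
  rewrite -big_distrr /= totL in tot; rewrite cAL in ub.
  have kk : #|A| * #|A| <= k * k by apply: leq_mul.
  exact: (island_count aU cH qcut cL cLA (leq_trans tot ub) Ularge kk).
set P := fibre L q r in rI.
have PW : P \subset W by apply: subset_trans LW; apply/subsetP => x; rewrite inE => /andP[].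
have [S0|] := boolP [exists S : {set V}, [&& S != set0, S \subset P &
    [forall v in S, #|[set w in W :\: S | e v w]| <= 2]]].
  case/existsP: S0 => S /and3P[S0 SP /forall_inP SI]; exists S; split => //.
  - exact: subset_trans SP PW.
  - by apply: (leq_trans (subset_leq_card SP)); apply: (leq_trans (qs r)); lia.
move=> /existsPn no; move: rI; rewrite ltnNge => /negP[]; apply: no_island_incident => // S S0 SP.
have := no S; rewrite S0 SP /= negb_forall_in => /exists_inP[v vS v2].
by exists v; rewrite // ltnNge.
Qed.

(** * Grids on surfaces glued from squares *)

(* A side is a pair of an axis ([false] is horizontal) and a sign. *)
Definition side := (bool * bool)%type.

(* A surface made of unit squares: the side [f] of a block is identified with
   the side [mate f], with reversal of direction when [flip f]. *)
Record scheme := Scheme {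
  block : finType;
  mate : block * side -> block * side;
  flip : block * side -> bool;
  mateK : involutive mate;
  flip_mate : forall f, flip (mate f) = flip f }.

(** [a] is the coordinate across a side and [t] the one along it: the axis of a side is the
    direction of its normal. *)
Definition along (T : Type) (ax : bool) (a t : T) : T * T := if ax then (t, a) else (a, t).

Section Grid.
Variables (X : scheme) (n : nat).
Local Notation N := n.+1.

Definition gcell := (block X * ('I_N * 'I_N))%type.
(** The position of the cell is stored in the frame of the side, first across and then along it, so
    that crossing a side within a block changes only the first entry. *)
Definition gflag := (block X * side * ('I_N * 'I_N))%type.
Definition gcorner := (block X * ('I_N.+1 * 'I_N.+1))%type.

Definition gown (x : gflag) : gcell := (x.1.1, along x.1.2.1 x.2.1 x.2.2).

Definition rim (sg : bool) : 'I_N := if sg then ord_max else ord0.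

Definition turn (m : nat) (o : bool) (t : 'I_m) : 'I_m := if o then rev_ord t else t.

Definition gopposite (x : gflag) : gflag :=
  if x.2.1 == rim x.1.2.2 then
    (mate x.1, (rim (mate x.1).2.2, turn (flip x.1) x.2.2))
  else (x.1.1, (x.1.2.1, ~~ x.1.2.2),
        (if x.1.2.2 then inord x.2.1.+1 else inord x.2.1.-1, x.2.2)).

Definition gend (k : bool) (x : gflag) : gcorner :=
  (x.1.1, along x.1.2.1 (inord (x.2.1 + x.1.2.2)) (inord (x.2.2 + k))).

Definition gglue (p q : gcorner) : bool := (p == q) ||
  [exists f : block X * side, exists k : 'I_N.+1,
    (p == (f.1, along f.2.1 (if f.2.2 then ord_max else ord0) k)) &&
    (q == ((mate f).1, along (mate f).2.1 (if (mate f).2.2 then ord_max else ord0)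
                         (turn (flip f) k)))].

Lemma turnK m o : involutive (@turn m o).
Proof. by case: o => t //=; apply: rev_ordK. Qed.

Lemma goppositeK : involutive gopposite.
Proof.
case=> [[b [ax sg]] [a t]]; rewrite /gopposite /=.
case: (a =P rim sg) => [->|ne] /=.
  by rewrite eqxx mateK flip_mate /= turnK.
case: sg ne => /= ne; rewrite /rim /=.
  have lt : a.+1 < N.
    rewrite ltn_neqAle ltn_ord andbT; apply/eqP => aN; apply: ne.
    by apply: val_inj => /=; lia.
  case: eqP => [/(congr1 val)/=|_]; first by rewrite inordK //.
  by congr (_, (_, _)); apply: val_inj; rewrite /= !inordK //=; lia.
have gt : 0 < a by rewrite lt0n; apply/eqP => a0; apply: ne; apply: val_inj.
have lt := ltn_ord a.
case: eqP => [/(congr1 val)/=|_]; first by rewrite inordK; lia.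
by congr (_, (_, _)); apply: val_inj; rewrite /= !inordK //=; lia.
Qed.

Lemma gend_rim k (f : block X * side) (t : 'I_N) :
  gend k (f, (rim f.2.2, t))
  = (f.1, along f.2.1 (if f.2.2 then ord_max else ord0) (inord (t + k))).
Proof.
rewrite /gend /=; congr (_, along _ _ _); apply: val_inj.
by case: f.2.2; rewrite /= ?addn1 ?addn0 inordK.
Qed.

Lemma gopposite_ends x :
  (gglue (gend false x) (gend false (gopposite x)) && gglue (gend true x) (gend true (gopposite x)))
  || (gglue (gend false x) (gend true (gopposite x)) && gglue (gend true x) (gend false (gopposite x))).
Proof.
case: x => [[b [ax sg]] [a t]]; rewrite /gopposite /=; have lt := ltn_ord a; have ltt := ltn_ord t.
case: (a =P rim sg) => [->|ne] /=; last first.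
  rewrite /gglue /gend /=; suff -> : (inord (a + sg) : 'I_N.+1)
    = inord ((if sg then inord a.+1 else inord a.-1 : 'I_N) + ~~ sg) by rewrite !eqxx.
  case: sg ne => /= ne; apply: val_inj; rewrite /= !inordK //= ?inordK //; try lia.
  - have : (a : nat) <> n by (move=> an; apply: ne; apply: val_inj). lia.
  - have : (a : nat) <> n by (move=> an; apply: ne; apply: val_inj). lia.
  - have : (a : nat) <> 0 by (move=> an; apply: ne; apply: val_inj). lia.
set f := (b, (ax, sg)); have {1 2 3 4}-> : rim sg = rim f.2.2 by [].
rewrite !gend_rim.
have glueE (k k' : bool) : k' = (if flip f then ~~ k else k) -> gglue
    (b, along ax (if sg then ord_max else ord0) (inord (t + k)))
    ((mate f).1, along (mate f).2.1 (if (mate f).2.2 then ord_max else ord0)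
       (inord (turn (flip f) t + k'))).
  move=> ->.
  apply/orP; right; apply/existsP; exists f; apply/existsP; exists (inord (t + k)); rewrite !eqxx /=.
  apply/eqP; congr (_, along _ _ _); apply: val_inj; rewrite /turn.
  by case: (flip f); rewrite /= !inordK //=; case: k => /=; lia.
case E: (flip f); rewrite E in glueE.
  by rewrite (glueE false true) // (glueE true false) // orbT.
by rewrite (glueE false false) // (glueE true true).
Qed.

Lemma gown_sum (F : gflag -> bool) (c : gcell) :
  \xor_(x | gown x == c) F x =
  (F (c.1, (false, false), (c.2.1, c.2.2)) (+) F (c.1, (false, true), (c.2.1, c.2.2)))
  (+) (F (c.1, (true, false), (c.2.2, c.2.1)) (+) F (c.1, (true, true), (c.2.2, c.2.1))).
Proof.
pose fl (s : side) : gflag := (c.1, s, along s.1 c.2.1 c.2.2).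
rewrite (reindex fl) /=; last first.
  exists (fun x : gflag => x.1.2) => [s _ //|].
  case=> [[b [ax sg]] [a t]]; rewrite /fl inE /gown /= => /eqP <- /=.
  by case: ax.
rewrite (eq_bigl predT); last first.
  by move=> [ax sg]; rewrite /gown /fl /=; case: ax; rewrite /= -!surjective_pairing eqxx.
rewrite (eq_bigr (fun s => F (fl (s.1, s.2)))) => [|[] //].
rewrite -(pair_bigA _ (fun ax sg => F (fl (ax, sg)))) /= !big_bool /=.
by rewrite /fl /= addbC; congr (_ (+) _); apply: addbC.
Qed.

Lemma gcell_even (t : gcorner -> bool) (c : gcell) :
  \xor_(x | gown x == c) (t (gend false x) (+) t (gend true x)) = false.
Proof.
rewrite gown_sum /gend /= !addn0 !addn1.
move: (t (_, (inord c.2.1, inord c.2.2))) (t (_, (inord c.2.1.+1, inord c.2.2))).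
move: (t (_, (inord c.2.1, inord c.2.2.+1))) (t (_, (inord c.2.1.+1, inord c.2.2.+1))).
by move=> [] [] [] [].
Qed.

(* The value of [C] on the side from [along ax a t] to [along ax a t.+1]. *)
Definition at_side (C : gflag -> bool) (b : block X) (ax : bool) (a t : nat) : bool :=
  if a < N then C (b, (ax, false), (inord a, inord t))
  else C (b, (ax, true), (ord_max, inord t)).

(** The integral of [C] from the corner (0, 0) of the block, first along the first axis, then along
    the second. *)
Definition potential (C : gflag -> bool) (b : block X) (p : nat * nat) : bool :=
  \big[addb/false]_(i < p.1) at_side C b true 0 i (+)
  \big[addb/false]_(j < p.2) at_side C b false p.1 j.

(** The jump between the potentials of two glued blocks at the first corner of their common side.
    What matters is that the number of periods depends on the scheme and not on the mesh [n]. *)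
Definition gperiod (C : gflag -> bool) (f : block X * side) : bool :=
  potential C f.1 (along f.2.1 (if f.2.2 then N else 0) 0) (+)
  potential C (mate f).1
    (along (mate f).2.1 (if (mate f).2.2 then N else 0) (if flip f then N else 0)).

Lemma gperiodD C C' f :
  gperiod (fun x => C x (+) C' x) f = gperiod C f (+) gperiod C' f.
Proof.
have sideD b ax a t : at_side (fun x => C x (+) C' x) b ax a t
    = at_side C b ax a t (+) at_side C' b ax a t by rewrite /at_side; case: ifP.
have potD b p : potential (fun x => C x (+) C' x) b p = potential C b p (+) potential C' b p.
  rewrite /potential; under eq_bigr do rewrite sideD.
  under [X in _ (+) X]eq_bigr do rewrite sideD.
  by rewrite !big_split /= addbACA.
by rewrite /gperiod !potD addbACA.
Qed.

Section Exactness.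
Variable C : gflag -> bool.
Hypothesis Copp : forall x, C (gopposite x) = C x.
Hypothesis Ceven : forall c, \xor_(x | gown x == c) C x = false.

Lemma at_sideE b ax sg (a t : 'I_N) : C (b, (ax, sg), (a, t)) = at_side C b ax (a + sg) t.
Proof.
have lt := ltn_ord a.
rewrite /at_side inord_val; case: sg => /=; last first.
  by rewrite addn0 ltn_ord inord_val.
rewrite addn1; case: ltnP => aN; last first.
  by congr (C (_, (_, _))); apply: val_inj => /=; lia.
rewrite -Copp /gopposite /=; case: eqP => [/(congr1 val) /=|_]; first by lia.
by [].
Qed.

Lemma at_side_cell b (i j : nat) : i < N -> j < N ->
  (at_side C b false i j (+) at_side C b false i.+1 j) (+)
  (at_side C b true j i (+) at_side C b true j.+1 i) = false.
Proof.
move=> iN jN; rewrite -[RHS](Ceven (b, (inord i, inord j))) gown_sum /= !at_sideE.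
by rewrite !inordK // !addn0 !addn1.
Qed.

Lemma potential_step b ax a t : a <= N -> t < N ->
  potential C b (along ax a t.+1) = potential C b (along ax a t) (+) at_side C b ax a t.
Proof.
move=> aN tN; case: ax => /=; last by rewrite /potential /= big_ord_recr /= addbA.
elim: a aN => [|j IH] jN.
  by rewrite /potential /= !big_ord0 !addbF big_ord_recr.
have stepy i : potential C b (i, j.+1) = potential C b (i, j) (+) at_side C b false i j.
  by rewrite /potential /= big_ord_recr /= addbA.
rewrite !stepy IH ?(ltnW jN) //; have := at_side_cell b tN jN.
by do 2!case: (at_side C b false _ _); do 2!case: (at_side C b true _ _); case: (potential C b (t, j)).
Qed.

(** The vanishing period is the case [k = 0]; it propagates along the side because [Copp] gives [C]
    equal values on both copies of each step. *)
Lemma potential_glue f (k : nat) : gperiod C f = false -> k <= N ->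
  potential C f.1 (along f.2.1 (if f.2.2 then N else 0) k) =
  potential C (mate f).1
    (along (mate f).2.1 (if (mate f).2.2 then N else 0) (if flip f then N - k else k)).
Proof.
move=> Cf; elim: k => [|k IH] kN.
  move: Cf; rewrite /gperiod subn0; by do 2!case: (potential C _ _).
have bound (sg : bool) : (if sg then N else 0) <= N by case: sg.
rewrite potential_step // IH ?(ltnW kN) //.
have E : at_side C f.1 f.2.1 (if f.2.2 then N else 0) k =
    at_side C (mate f).1 (mate f).2.1 (if (mate f).2.2 then N else 0)
      (if flip f then N - k.+1 else k).
  have flagE g (t : 'I_N) : at_side C g.1 g.2.1 (if g.2.2 then N else 0) t
      = C (g, (rim g.2.2, t)).
    case: g => b [ax sg] /=; rewrite at_sideE; congr at_side; case: sg; rewrite /= ?addn1 ?addn0 //.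
  have kE : k = (inord k : 'I_N) by rewrite inordK.
  rewrite [in LHS]kE flagE -Copp /gopposite /= eqxx -flagE; congr at_side.
  by rewrite /turn; case: (flip f); rewrite /= inordK.
rewrite E; case: (flip f); last by rewrite potential_step.
have -> : N - k = (N - k.+1).+1 by lia.
by rewrite potential_step ?addbK //; lia.
Qed.

Lemma gexactness : (forall f, gperiod C f = false) ->
  exists t : gcorner -> bool, (forall p q, gglue p q -> t p = t q) /\
    (forall x, C x = t (gend false x) (+) t (gend true x)).
Proof.
move=> per; exists (fun p => potential C p.1 (val p.2.1, val p.2.2)); split.
  move=> p q /orP[/eqP-> //|/existsP[f /existsP[k /andP[/eqP-> /eqP->]]]] /=.
  have alongE (T T' : Type) (g : T -> T') ax a t :
     (g (along ax a t).1, g (along ax a t).2) = along ax (g a) (g t) by case: ax.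
  rewrite !(alongE _ _ (@nat_of_ord _)).
  have := @potential_glue f k (per f); rewrite -ltnS => /(_ (ltn_ord k)).
  rewrite !(fun_if (@nat_of_ord _)) /= => ->; congr (potential _ _ (along _ _ _)).
case=> [[b [ax sg]] [a t]]; rewrite at_sideE /gend /=.
have aN := ltn_ord a; have tN := ltn_ord t.
have E (k : nat) : (k <= 1)%N -> (val (along ax (inord (a + sg) : 'I_N.+1) (inord (t + k))).1,
   val (along ax (inord (a + sg) : 'I_N.+1) (inord (t + k))).2) = along ax (a + sg) (t + k).
  by move=> k1; case: ax => /=; rewrite !inordK //; case: sg => /=; lia.
rewrite !E // addn0 addn1 potential_step //; last by case: (sg) => /=; lia.
by rewrite addKb.
Qed.
End Exactness.

Definition grid : complex :=
  @Complex gcell gflag gcorner _ gown gopposite (gend false) (gend true) gglue gperiod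
    goppositeK gopposite_ends gcell_even gperiodD gexactness.
End Grid.

Lemma cell_adj_sym (Q : complex) : symmetric (@cell_adj Q).
Proof.
have aux a b : @cell_adj Q a b -> @cell_adj Q b a.
  case/existsP => x /and3P[xa xb xx]; apply/existsP; exists (opposite x).
  by rewrite oppositeK xa xb eq_sym xx.
by move=> a b; apply/idP/idP; apply: aux.
Qed.

(* The cells met by an edge [u v] that are not in the bag of [v] are given to the
   end [u] of smaller rank. *)
Lemma absorb_model (Q : complex) (V : finType) (e : rel V) (U : {set V})
    (B : V -> {set cell Q}) (M : V -> V -> {set cell Q}) :
  symmetric e -> irreflexive e ->
  (forall v, v \in U -> B v != set0) -> (forall v, v \in U -> linked (@cell_adj Q) (B v)) ->
  (forall u v c, u \in U -> v \in U -> c \in B u -> c \in B v -> u = v) ->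
  (forall u v, M u v = M v u) ->
  (forall u v, u \in U -> v \in U -> e u v -> linked (@cell_adj Q) (M u v)) ->
  (forall u v, u \in U -> v \in U -> e u v -> exists2 c, c \in M u v & c \in B u) ->
  (forall u v w c, u \in U -> v \in U -> w \in U -> e u v -> c \in M u v -> c \in B w ->
     w = u \/ w = v) ->
  (forall u v u' v' c, u \in U -> v \in U -> u' \in U -> v' \in U -> e u v -> e u' v' ->
     c \in M u v -> c \in M u' v' -> (u = u' /\ v = v') \/ (u = v' /\ v = u')) ->
  exists bag : cell Q -> option V, model e U bag.
Proof.
move=> esym eirr B0 Bl Bd Msym Ml MB MBd Md.
pose rk (v : V) := enum_rank v.
(* Only the cells that are reached from [B v] without entering [B u] are taken, which keeps the
   enlarged bag linked. *)
pose arm v u := [set c | [exists c0 in B v, connect (rel_in (@cell_adj Q) (M v u :\: B u)) c0 c]].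
pose Bx v := B v :|: \bigcup_(u in [set u in U | e v u && (rk v < rk u)]) arm v u.
have armP v u c : c \in arm v u -> c \in B v \/ c \in M v u :\: B u.
  rewrite inE => /existsP[c0 /andP[c0B /connectP[p]]].
  case/lastP: p => [_ ->|p c']; first by left.
  rewrite rcons_path last_rcons => /andP[_ /and3P[_ _ c'M]] ->; by right.
have BxP v c : c \in Bx v -> c \in B v \/
    exists u, [/\ u \in U, e v u, rk v < rk u, c \in M v u & c \notin B u].
  case/setUP => [|/bigcupP[u]]; first by left.
  rewrite inE => /andP[uU /andP[evu lt]] /armP[|/setDP[cM cB]]; first by left.
  by right; exists u.
have Bxd v w c : v \in U -> w \in U -> c \in Bx v -> c \in Bx w -> v = w.
  move=> vU wU /BxP[cv|[u [uU evu lt cM cu]]] /BxP[cw|[u' [u'U ewu lt' cM' cu']]].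
  - exact: Bd cv cw.
  - case: (MBd w u' v c) => // vu'; by rewrite -vu' cv in cu'.
  - case: (MBd v u w c) => // wu; by rewrite -wu cw in cu.
  - case: (Md v u w u' c) => // [[]//|[vu' uw]].
    by move: lt lt'; rewrite vu' uw => l1 l2; have := ltn_trans l1 l2; rewrite ltnn.
have BBx v : B v \subset Bx v by apply: subsetUl.
have root_of v c : v \in U -> c \in Bx v ->
    exists2 c0, c0 \in B v & connect (rel_in (@cell_adj Q) (Bx v)) c0 c.
  move=> vU /setUP[cB|/bigcupP[u uE]]; first by exists c; rewrite ?connect0.
  rewrite inE => /existsP[c0 /andP[c0B c0c]]; exists c0 => //.
  suff H a : a \in arm v u -> connect (rel_in (@cell_adj Q) (M v u :\: B u)) a c ->
      connect (rel_in (@cell_adj Q) (Bx v)) a c.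
    by apply: H => //; rewrite inE; apply/existsP; exists c0; rewrite c0B connect0.
  have sub : arm v u \subset Bx v by apply: subset_trans (bigcup_sup u uE) (subsetUr _ _).
  move=> aM /connectP[p + ->]; elim: p a aM => [|b p IH] a aM /=; first by rewrite connect0.
  case/andP => ab pp; have bM : b \in arm v u.
    move: aM; rewrite !inE => /existsP[c1 /andP[c1B c1a]]; apply/existsP; exists c1.
    by rewrite c1B (connect_trans c1a) // connect1.
  apply: connect_trans (IH b bM pp); apply: connect1; move: ab; rewrite /rel_in.
  by case/and3P => -> _ _; rewrite !(subsetP sub).
have csym A := connect_rel_in_sym A (@cell_adj_sym Q).
have Bxl v : v \in U -> linked (@cell_adj Q) (Bx v).
  move=> vU a b /(root_of v _ vU)[a0 a0B aa] /(root_of v _ vU)[b0 b0B bb].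
  apply: connect_trans bb; rewrite csym; apply: connect_trans aa.
  exact: rel_inS (BBx v) _ _ (Bl v vU _ _ b0B a0B).
have edge u v : u \in U -> v \in U -> e u v -> rk u < rk v ->
    exists2 a, a \in Bx u & exists2 b, b \in Bx v & cell_adj a b.
  move=> uU vU euv lt.
  have [c cM cB] := MB u v uU vU euv.
  have evu : e v u by rewrite esym.
  have [d dM dB] := MB v u vU uU evu; rewrite Msym in dM.
  have cBv : c \notin B v.
    by apply/negP => cv; move: euv; rewrite (Bd _ _ _ uU vU cB cv) eirr.
  have cArm : c \in arm u v by rewrite inE; apply/existsP; exists c; rewrite cB connect0.
  have sub : arm u v \subset Bx u.
    by apply: subset_trans (bigcup_sup v _) (subsetUr _ _); rewrite inE vU euv lt.
  (* A walk in [M u v] from [B u] to [B v] stays in [arm u v] until it first enters [B v]; that step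
     is the required adjacency. *)
  have /connectP[p] := Ml u v uU vU euv c d cM dM.
  elim: p c cM cBv cArm {cB} => [|b p IH] c cM cBv cArm /=.
    by move=> _ dc; rewrite -dc dB in cBv.
  case/andP => /and3P[cb _ bM] pp dE.
  have [bB|bB] := boolP (b \in B v).
    exists c; first exact: (subsetP sub).
    by exists b => //; apply: (subsetP (BBx v)).
  apply: (IH b) => //; move: cArm; rewrite !inE => /existsP[c1 /andP[c1B c1c]].
  apply/existsP; exists c1; rewrite c1B (connect_trans c1c) //; apply: connect1.
  by rewrite /rel_in cb !inE cM cBv bM bB.
pose bag c := [pick v in U | c \in Bx v].
have bagP c v : v \in U -> (bag c == Some v) = (c \in Bx v).
  move=> vU; rewrite /bag; case: pickP => [w /andP[wU cw]|no].
    apply/eqP/idP => [[<-]//|cv]; by rewrite (Bxd _ _ _ wU vU cw cv).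
  by have := no v; rewrite vU /= => ->.
exists bag; split.
- move=> v vU; have /set0Pn[c cB] := B0 v vU; exists c; apply/eqP.
  by rewrite bagP // (subsetP (BBx v)).
- move=> v vU; have -> : [set c | bag c == Some v] = Bx v; last exact: Bxl.
  by apply/setP => c; rewrite inE bagP.
- move=> u v uU vU euv.
  have [lt|gt|/val_inj/enum_rank_inj uv] := ltngtP (rk u) (rk v).
  + have [a au [b bv /existsP[x /and3P[/eqP xa /eqP xb _]]]] := edge u v uU vU euv lt.
    by exists x; rewrite xa xb; split; apply/eqP; rewrite bagP.
  + rewrite esym in euv; have [a au [b bv /existsP[x /and3P[/eqP xa /eqP xb _]]]] := edge v u vU uU euv gt.
    by exists (opposite x); rewrite oppositeK xa xb; split; apply/eqP; rewrite bagP.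
  + by rewrite uv eirr in euv.
Qed.

From Stdlib Require Import Relation_Operators.
From mathcomp Require Import all_order all_algebra.
From mathcomp Require Import generic_quotient boolp classical_sets functions cardinality.
From mathcomp Require Import interval_inference reals topology normedtype.
From mathcomp Require Import lra.
Import numFieldNormedType.Exports.
Import Order.TTheory GRing.Theory Num.Theory.
Local Open Scope classical_set_scope.
Local Open Scope ring_scope.
Local Open Scope quotient_scope.

(** * Drawings give minors of fine grids *)

Section Realisation.
Variables (R : realType) (X : scheme).

Definition unit_square : set (R * R) := `[0, 1] `*` `[0, 1].

Definition side_point (s : side) (t : R) : R * R := along s.1 (if s.2 then 1 else 0) t.

Inductive same_point (live : pred (block X)) : block X * (R * R) -> block X * (R * R) -> Prop :=
| same_refl q : same_point live q q
| same_step f t q : live f.1 -> 0 <= t <= 1 ->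
    same_point live ((mate f).1, side_point (mate f).2 (if flip f then 1 - t else t)) q ->
    same_point live (f.1, side_point f.2 t) q.

(** [psi] need not be onto, since only a bounded part of a surface gets covered. It is continuous on
    the whole plane rather than on the square, which avoids subspace topologies. *)
Record realisation (S : topologicalType) (live : pred (block X)) (psi : block X -> R * R -> S) : Prop := {
  psi_continuous : forall b, continuous (psi b);
  live_mate : forall f, live f.1 -> live (mate f).1;
  psi_glue : forall f t, live f.1 -> 0 <= t <= 1 ->
    psi f.1 (side_point f.2 t)
    = psi (mate f).1 (side_point (mate f).2 (if flip f then 1 - t else t));
  psi_inj : forall b b' p p', live b -> live b' -> unit_square p -> unit_square p' ->
    psi b p = psi b' p' -> same_point live (b, p) (b', p') }.

Section Cells.
Variables (S : topologicalType) (live : pred (block X)) (psi : block X -> R * R -> S).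
Hypothesis psiR : realisation live psi.
Variable n : nat.
Local Notation N := n.+1.

Definition in_mesh (a : nat) (x : R) : bool := (a%:R <= N%:R * x <= a.+1%:R).

Definition in_cell (c : gcell X n) : set (R * R) :=
  [set p | in_mesh c.2.1 p.1 && in_mesh c.2.2 p.2].

Definition touched (K : set S) : {set cell (grid X n)} :=
  finset (fun c : gcell X n => `[< live c.1 /\ exists2 p, in_cell c p & K (psi c.1 p) >]).

Lemma touchedP K c :
  (c \in touched K) <-> live c.1 /\ exists2 p, in_cell c p & K (psi c.1 p).
Proof. by rewrite inE; split => /asboolP. Qed.

Lemma N_gt0 : 0 < N%:R :> R. Proof. by rewrite ltr0n. Qed.

Lemma in_mesh_unit (a : 'I_N) x : in_mesh a x -> 0 <= x <= 1.
Proof.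
have aN : a.+1%:R <= N%:R :> R by rewrite ler_nat.
have a0 : 0 <= a%:R :> R by rewrite ler0n.
have N0 := N_gt0; case/andP => h1 h2; apply/andP; split.
  by rewrite -(pmulr_rge0 _ N0) (le_trans a0).
by rewrite -(ler_pM2l N0) mulr1 (le_trans h2).
Qed.

Lemma in_cell_unit c p : in_cell c p -> unit_square p.
Proof. by case/andP => /in_mesh_unit h1 /in_mesh_unit h2; split; rewrite /= in_itv. Qed.

Lemma in_mesh_exists x : 0 <= x <= 1 -> exists a : 'I_N, in_mesh a x.
Proof.
case/andP => x0 x1; have N0 := N_gt0.
have Nx0 : 0 <= N%:R * x by rewrite mulr_ge0 // ltW.
have := truncn_itv Nx0; set a := Num.truncn _ => /andP[h1 h2].
case: (ltnP a N) => aN; first by exists (Ordinal aN); rewrite /in_mesh /= h1 ltW.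
exists ord_max; rewrite /in_mesh /=; have NxN : N%:R * x <= N%:R by rewrite ler_piMr // ltW.
rewrite NxN andbT (le_trans _ h1) // ler_nat; exact: leq_trans (leqnSn _) aN.
Qed.

Lemma in_cell_exists p : unit_square p -> exists q : 'I_N * 'I_N, forall b, in_cell (b, q) p.
Proof.
case=> /=; rewrite !in_itv /= => /in_mesh_exists[a ha] /in_mesh_exists[a' ha'].
by exists (a, a') => b; rewrite /in_cell /= ha ha'.
Qed.

Lemma in_mesh_adjacent (a a' : nat) x : in_mesh a x -> in_mesh a' x -> (a' <= a.+1)%N.
Proof. by case/andP => _ h1 /andP[h2 _]; rewrite -(ler_nat R) (le_trans h2). Qed.

Local Notation linkT K := (connect (rel_in (@cell_adj (grid X n)) (touched K))).

Lemma flag_link K (x : flag (grid X n)) :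
  own x \in touched K -> own (opposite x) \in touched K -> linkT K (own x) (own (opposite x)).
Proof.
move=> h1 h2; have [->|ne] := eqVneq (opposite x) x; first exact: connect0.
apply: connect1; rewrite /rel_in h1 h2 !andbT; apply/existsP; exists x.
by rewrite !eqxx ne.
Qed.

Lemma along_link K b p ax (a a' t : 'I_N) : live b -> K (psi b p) ->
  in_cell (b, along ax a t) p -> in_cell (b, along ax a' t) p ->
  linkT K (b, along ax a t) (b, along ax a' t).
Proof.
move=> lb Kp.
have step (c c' : 'I_N) : c' = c.+1 :> nat ->
   in_cell (b, along ax c t) p -> in_cell (b, along ax c' t) p ->
   linkT K (b, along ax c t) (b, along ax c' t).
  move=> cc h1 h2; have := @flag_link K ((b, (ax, true), (c, t)) : gflag X n).
  have c'lt := ltn_ord c'; rewrite /= /gopposite /= ifN_eq; last first.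
    by apply/eqP => /(congr1 val) /=; lia.
  rewrite /gown /=; have -> : inord c.+1 = c' by apply: val_inj; rewrite /= inordK -cc.
  by apply; apply/touchedP; split => //; exists p.
move=> h1 h2.
have m1 : in_mesh a (if ax then p.2 else p.1) by move: h1; rewrite /in_cell; case: ax {step h2} => /= /andP[].
have m2 : in_mesh a' (if ax then p.2 else p.1) by move: h2; rewrite /in_cell; case: ax {step h1 m1} => /= /andP[].
have le1 := in_mesh_adjacent m1 m2; have le2 := in_mesh_adjacent m2 m1.
have [aa|aa|/val_inj->] := ltngtP a a'; last exact: connect0.
  by apply: step => //; apply/eqP; rewrite eqn_leq le1 aa.
rewrite connect_rel_in_sym; last exact: cell_adj_sym.
by apply: step => //; apply/eqP; rewrite eqn_leq le2 aa.
Qed.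

Lemma block_link K b p (q q' : 'I_N * 'I_N) : live b -> K (psi b p) ->
  in_cell (b, q) p -> in_cell (b, q') p -> linkT K (b, q) (b, q').
Proof.
case: q q' => i j [i' j'] lb Kp h1 h2.
have h3 : in_cell (b, (i', j)) p.
  by move: h1 h2; rewrite /in_cell /= => /andP[_ ->] /andP[-> _].
apply: (connect_trans (@along_link K b p false i i' j lb Kp h1 h3)).
exact: (@along_link K b p true j j' i' lb Kp h3 h2).
Qed.

(** Each identification in [same_point] takes place at a point of [K] on a side; the cells that face
    each other there are both touched. Between two identifications, [block_link] joins cells of one
    block with a common point. *)
Lemma point_link K b p b' p' (q q' : 'I_N * 'I_N) :
  live b -> same_point live (b, p) (b', p') -> K (psi b p) ->
  in_cell (b, q) p -> in_cell (b', q') p' -> linkT K (b, q) (b', q').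
Proof.
move=> lb H; move Ex: (b, p) H => x H; move Ey: (b', p') H => y H.
elim: H b p q lb Ex Ey => [z|f t z lf t01 _ IH] b p q lb Ex Ey Kp h1 h2.
  by move: Ey; rewrite -Ex => -[bb pp]; subst b' p'; apply: block_link Kp h1 h2.
case: Ex Kp h1 => -> -> Kp h1; have N0 := N_gt0.
have [k kq] : exists k : 'I_N, in_mesh k t.
  by exact: in_mesh_exists.
have h3 : in_cell (f.1, along f.2.1 (rim n f.2.2) k) (side_point f.2 t).
  rewrite /in_cell /side_point; case: f {lf IH Kp h1 Ey} => ? [[] []] /=; rewrite kq /in_mesh /=;
  by rewrite ?mulr1 ?mulr0 ?lexx ?ler01 ?ler0n ?ler_nat ?leqnSn.
apply: (connect_trans (block_link lf Kp h1 h3)).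
have lm := live_mate psiR lf.
have Km : K (psi (mate f).1 (side_point (mate f).2 (if flip f then 1 - t else t))).
  by rewrite -(psi_glue psiR).
have h4 : in_cell ((mate f).1, along (mate f).2.1 (rim n (mate f).2.2) (turn (flip f) k))
   (side_point (mate f).2 (if flip f then 1 - t else t)).
  have kq' : in_mesh (turn (flip f) k) (if flip f then 1 - t else t).
    rewrite /turn; case: (flip f) => //=; move: kq; rewrite /in_mesh /= => /andP[k1 k2].
    have kN := ltn_ord k.
    have E1 : (N - k.+1)%:R = N%:R - k.+1%:R :> R by rewrite natrB.
    have E2 : (N - k.+1).+1%:R = N%:R - k%:R :> R by rewrite -subSn // subSS natrB // ltnW.
    by rewrite E1 E2 mulrBr mulr1; apply/andP; split; rewrite lerD2l lerN2.
  rewrite /in_cell /side_point; case: (mate f) => ? [[] []] /=; rewrite kq' /in_mesh /=;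
  by rewrite ?mulr1 ?mulr0 ?lexx ?ler01 ?ler0n ?ler_nat ?leqnSn.
apply: connect_trans (IH _ _ _ lm erefl Ey Km h4 h2).
have := @flag_link K ((f, (rim n f.2.2, k)) : gflag X n).
rewrite /= /gopposite /= eqxx /gown /=; apply; apply/touchedP; split=> //.
  by exists (side_point f.2 t).
by exists (side_point (mate f).2 (if flip f then 1 - t else t)).
Qed.

Definition covered (x : S) : Prop := exists b p, [/\ live b, unit_square p & psi b p = x].

Hypothesis hS : hausdorff_space S.

Lemma in_cell_closed (c : gcell X n) : closed (in_cell c).
Proof.
have mc a : closed [set x : R | in_mesh a x].
  rewrite (_ : [set x | _] = [set x | a%:R <= N%:R * x] `&` [set x | N%:R * x <= a.+1%:R]).
    apply: closedI.
      apply: (@closed_comp _ _ (fun x : R => N%:R * x) [set y | a%:R <= y]); last exact: closed_ge.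
      by move=> x _; apply: mulrl_continuous.
    apply: (@closed_comp _ _ (fun x : R => N%:R * x) [set y | y <= a.+1%:R]); last exact: closed_le.
    by move=> x _; apply: mulrl_continuous.
  by apply/seteqP; split => x /= => [/andP[]//|[h1 h2]]; apply/andP.
rewrite (_ : in_cell c = (fst @^-1` [set x | in_mesh c.2.1 x]) `&` (snd @^-1` [set x | in_mesh c.2.2 x])).
  apply: closedI; apply: closed_comp => //; move=> x _.
    exact: cvg_fst.
  exact: cvg_snd.
by apply/seteqP; split => x /= => [/andP[]//|[h1 h2]]; apply/andP.
Qed.

Lemma unit_square_compact : compact unit_square.
Proof. by apply: compact_setX; apply: segment_compact. Qed.

Lemma psi_cell_closed (c : gcell X n) : closed (psi c.1 @` in_cell c).
Proof.
apply: compact_closed => //; apply: continuous_compact.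
  exact/continuous_subspaceT/(psi_continuous psiR).
apply: (subclosed_compact (@in_cell_closed c) unit_square_compact).
exact: in_cell_unit.
Qed.

(** Otherwise the images of the touched cells linked to [c0], and those of the others, would split
    [K] into two nonempty relatively closed parts, disjoint by [point_link]. *)
Lemma touched_linked (K : set S) :
  connected K -> (forall x, K x -> covered x) -> linked (@cell_adj (grid X n)) (touched K).
Proof.
move=> Kc Kcov c0 c c0T cT; apply: contrapT => nlink.
pose F (P : pred (cell (grid X n))) : set S :=
  \bigcup_(c' in [set c' | P c']) (psi c'.1 @` in_cell c').
pose FA := F (fun c' => linkT K c0 c' && (c' \in touched K)).
pose FB := F (fun c' => ~~ linkT K c0 c' && (c' \in touched K)).
have cF P : closed (F P).
  by apply: closed_bigcup => [|c' _]; [exact: finite_finset | exact: psi_cell_closed].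
have cFA : closed FA by exact: cF.
have cFB : closed FB by exact: cF.
have inF P x : F P x <-> exists2 c', P c' & exists2 p, in_cell c' p & psi c'.1 p = x by [].
have sep x : K x -> FA x -> FB x -> False.
  move=> Kx /inF[a /andP[la aT] [p pa px]] /inF[b /andP[/negP lb bT] [q qb qx]]; apply: lb.
  apply: (connect_trans la).
  have [aL _] := (touchedP K a).1 aT; have [bL _] := (touchedP K b).1 bT.
  have sp : same_point live (a.1, p) (b.1, q).
    apply: (psi_inj psiR) => //; [exact: in_cell_unit pa | exact: in_cell_unit qb | by rewrite px qx].
  have Ka : K (psi a.1 p) by rewrite px.
  have := @point_link K a.1 p b.1 q a.2 b.2 aL sp Ka.
  by rewrite -!surjective_pairing; apply.
have cover x : K x -> FA x \/ FB x.
  move=> Kx; have [b [p [lb pu px]]] := Kcov x Kx.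
  have [q qp] := in_cell_exists pu.
  have bqT : (b, q) \in touched K by apply/touchedP; split=> //; exists p => //; rewrite px.
  have [l|l] := boolP (linkT K c0 (b, q)); [left|right]; apply/inF; exists (b, q).
  - by rewrite l.
  - by exists p.
  - by rewrite l.
  - by exists p.
have [_ [p0 p0c p0K]] := (touchedP K c0).1 c0T.
have /seteqP[_ sub] : K `&` FA = K.
  apply: Kc.
  - exists (psi c0.1 p0); split => //; apply/inF; exists c0; last by exists p0.
    by rewrite connect0.
  - exists (~` FB); first exact: closed_openC.
    apply/seteqP; split => x [Kx Fx]; split => //.
      by move=> /(sep x Kx Fx).
    by case: (cover x Kx).
  - by exists FA.
have [_ [p pc pK]] := (touchedP K c).1 cT.
have [_ FAx] := sub _ pK.
apply: (sep _ pK FAx); apply/inF; exists c; last by exists p.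
by rewrite cT andbT; apply/negP.
Qed.

End Cells.

Lemma in_mesh_dist n (a : nat) (x y : R) : in_mesh n a x -> in_mesh n a y ->
  `|x - y| <= n.+1%:R^-1.
Proof.
have N0 : 0 < n.+1%:R :> R by rewrite ltr0n.
case/andP => h1 h2 /andP[h3 h4]; rewrite -(ler_pM2l N0) mulfV ?gt_eqF //.
rewrite -{1}(gtr0_norm N0) -normrM mulrBr ler_norml.
have E : a.+1%:R = a%:R + 1 :> R by rewrite -addn1 natrD.
rewrite E in h2 h4; lra.
Qed.

Section Drawing.
Variables (S : topologicalType) (live : pred (block X)) (psi : block X -> R * R -> S).
Hypothesis psiR : realisation live psi.
Hypothesis hS : hausdorff_space S.

(** The Lebesgue number argument, pulled back to the unit square so that [S] needs no metric: a cell
    touched by both sets contains points of their preimages that are within the mesh width in each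
    coordinate. *)
Lemma fine_mesh (A A' : set S) : closed A -> closed A' -> (forall x, A x -> A' x -> False) ->
  \forall n \near \oo, forall c : cell (grid X n),
    c \in touched live psi n A -> c \in touched live psi n A' -> False.
Proof.
move=> cA cA' AA'.
have fineb b : \forall n \near \oo, unit_square `<=` [set p | forall p' : R * R,
    `|p.1 - p'.1| <= n.+1%:R^-1 -> `|p.2 - p'.2| <= n.+1%:R^-1 ->
    A (psi b p) -> A' (psi b p') -> False].
  have open_pre (Z : set S) : closed Z -> forall x, ~ Z (psi b x) -> \forall y \near x, ~ Z (psi b y).
    move=> cZ x Zx; apply: (@psi_continuous S live psi psiR b x (~` Z)).
    by apply: open_nbhs_nbhs; split => //; apply: closed_openC.
  have H := (compact_near_coveringP unit_square).1 unit_square_compact nat \oo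
    (fun n p => forall p' : R * R,
    `|p.1 - p'.1| <= n.+1%:R^-1 -> `|p.2 - p'.2| <= n.+1%:R^-1 ->
    A (psi b p) -> A' (psi b p') -> False).
  apply: H => x _ /=.
  have [Ax|nAx] := pselect (A (psi b x)); last first.
    exists ([set y | ~ A (psi b y)], setT) => /=.
      by split; [exact: open_pre | exact: filterT].
    by move=> [y n] [/= nA _] p' _ _ /nA.
  have nA'x : ~ A' (psi b x) by move=> /(AA' _ Ax).
  have /nbhs_ballP[e /= e0 eA'] := open_pre A' cA' x nA'x.
  have e20 : 0 < e / 2 by rewrite divr_gt0.
  exists (ball x (e / 2), [set n | n.+1%:R^-1 < e / 2 :> R]) => /=.
    split; first exact: nbhsx_ballx.
    exact: (near_infty_natSinv_lt (PosNum e20)).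
  move=> [y n] [/= xy ne] p' h1 h2 _ A'p'; apply: (eA' p') => //.
  rewrite (splitr e); apply: ball_triangle xy _.
  by split; apply: le_lt_trans ne.
have : \forall n \near \oo, forall b, unit_square `<=` [set p | forall p' : R * R,
    `|p.1 - p'.1| <= n.+1%:R^-1 -> `|p.2 - p'.2| <= n.+1%:R^-1 ->
    A (psi b p) -> A' (psi b p') -> False].
  exact: filter_forall.
apply: filterS => n H c /touchedP[_ [p pc Ap]] /touchedP[_ [p' p'c A'p']].
apply: (H c.1 p (in_cell_unit pc) p') => //.
  case/andP: pc => m1 _; case/andP: p'c => m2 _; exact: in_mesh_dist m1 m2.
case/andP: pc => _ m1; case/andP: p'c => _ m2; exact: in_mesh_dist m1 m2.
Qed.

(** Only finitely many pairs of disjoint sets must be told apart, so one mesh is fine enough for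
    all. *)
Lemma drawing_model (V : finType) (e : rel V) (U : {set V}%SET)
    (K : V -> set S) (M : V -> V -> set S) :
  symmetric e -> irreflexive e ->
  (forall v, v \in U -> [/\ closed (K v), connected (K v), K v !=set0 &
     forall x, K v x -> covered live psi x]) ->
  (forall u v, M u v = M v u) ->
  (forall u v, u \in U -> v \in U -> e u v -> [/\ closed (M u v), connected (M u v),
     M u v `&` K u !=set0 & forall x, M u v x -> covered live psi x]) ->
  (forall u v x, u \in U -> v \in U -> u <> v -> K u x -> K v x -> False) ->
  (forall u v w x, u \in U -> v \in U -> w \in U -> e u v -> w <> u -> w <> v ->
     M u v x -> K w x -> False) ->
  (forall u v u' v' x, u \in U -> v \in U -> u' \in U -> v' \in U -> e u v -> e u' v' ->
     ~ (u = u' /\ v = v') -> ~ (u = v' /\ v = u') -> M u v x -> M u' v' x -> False) ->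
  exists (n : nat) (bag : cell (grid X n) -> option V), model e U bag.
Proof.
move=> esym eirr KP Msym MP KK MK MM.
pose fine (A A' : set S) n := forall c : cell (grid X n),
    c \in touched live psi n A -> c \in touched live psi n A' -> False.
have imp (P : Prop) (Z : nat -> Prop) : (P -> \forall n \near \oo, Z n) ->
    \forall n \near \oo, P -> Z n.
  by move=> H; have [/H|nP] := pselect P; [apply: filterS | apply: nearW].
pose F1 (p : V * V) n := p.1 \in U -> p.2 \in U -> p.1 <> p.2 -> fine (K p.1) (K p.2) n.
pose F2 (p : V * V * V) n := p.1.1 \in U -> p.1.2 \in U -> p.2 \in U -> e p.1.1 p.1.2 ->
  p.2 <> p.1.1 -> p.2 <> p.1.2 -> fine (M p.1.1 p.1.2) (K p.2) n.
pose F3 (p : (V * V) * (V * V)) n :=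
  p.1.1 \in U -> p.1.2 \in U -> p.2.1 \in U -> p.2.2 \in U -> e p.1.1 p.1.2 -> e p.2.1 p.2.2 ->
  ~ (p.1.1 = p.2.1 /\ p.1.2 = p.2.2) -> ~ (p.1.1 = p.2.2 /\ p.1.2 = p.2.1) ->
  fine (M p.1.1 p.1.2) (M p.2.1 p.2.2) n.
have f1 : \forall n \near \oo, forall p, F1 p n.
  apply: filter_forall => p; do 3!apply: (imp _ _) => ?.
  have [k1 _ _ _] := KP p.1 ltac:(assumption); have [k2 _ _ _] := KP p.2 ltac:(assumption).
  by apply: fine_mesh => // x; apply: KK.
have f2 : \forall n \near \oo, forall p, F2 p n.
  apply: filter_forall => p; do 6!apply: (imp _ _) => ?.
  have [k1 _ _ _] := MP p.1.1 p.1.2 ltac:(assumption) ltac:(assumption) ltac:(assumption).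
  have [k2 _ _ _] := KP p.2 ltac:(assumption).
  by apply: fine_mesh => // x; apply: MK.
have f3 : \forall n \near \oo, forall p, F3 p n.
  apply: filter_forall => p; do 8!apply: (imp _ _) => ?.
  have [k1 _ _ _] := MP p.1.1 p.1.2 ltac:(assumption) ltac:(assumption) ltac:(assumption).
  have [k2 _ _ _] := MP p.2.1 p.2.2 ltac:(assumption) ltac:(assumption) ltac:(assumption).
  by apply: fine_mesh => // x; apply: MM.
have [n [{}f1 [{}f2 {}f3]]] := filter_ex (filterI f1 (filterI f2 f3)).
have meets (A A' : set S) x : A x -> A' x -> covered live psi x ->
    exists2 c, c \in touched live psi n A & c \in touched live psi n A'.
  move=> Ax A'x [b [p [lb pu px]]]; have [q qp] := in_cell_exists n pu.
  by exists (b, q); apply/touchedP; split => //; exists p => //=; rewrite px.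
exists n; apply: (@absorb_model (grid X n) V e U (fun v => touched live psi n (K v))
   (fun u v => touched live psi n (M u v))) => //.
- move=> v /KP[_ _ [x Kx] Kc]; have [c cK _] := meets _ _ x Kx Kx (Kc x Kx).
  by apply/set0Pn; exists c.
- by move=> v /KP[_ Kc _ Kcov]; apply: touched_linked.
- move=> u v c uU vU cu cv; apply: contrapT => uv; exact: (f1 (u, v) uU vU uv c cu cv).
- by move=> u v; rewrite Msym.
- by move=> u v uU vU euv; have [_ Mc _ Mcov] := MP u v uU vU euv; apply: touched_linked.
- move=> u v uU vU euv; have [_ _ [x [Mx Kx]] Mcov] := MP u v uU vU euv.
  exact: meets Mx Kx (Mcov x Mx).
- move=> u v w c uU vU wU euv cM cK; apply: contrapT => /not_orP[wu wv].
  exact: (f2 (u, v, w) uU vU wU euv wu wv c cM cK).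
- move=> u v u' v' c uU vU u'U v'U euv e'uv cM cM'; apply: contrapT => /not_orP[h1 h2].
  exact: (f3 ((u, v), (u', v')) uU vU u'U v'U euv e'uv h1 h2 c cM cM').
Qed.
End Drawing.
End Realisation.

Section EmbeddingModel.
Variables (R : realType) (G : sgraph) (S : topologicalType) (E : embedding R G S).
Hypothesis hS : hausdorff_space S.

Lemma arc_image (u v : G) (a b : R) : adj u v -> 0 <= a -> a <= b -> b <= 1 ->
  closed (edge_arc E u v @` `[a, b]) /\ connected (edge_arc E u v @` `[a, b]).
Proof.
move=> uv a0 ab b1.
have sub : `[a, b] `<=` (`[0, 1] : set R).
  by move=> x /=; rewrite !in_itv /= => /andP[h1 h2]; rewrite (le_trans a0) //= (le_trans h2).
have ct := continuous_subspaceW sub (@arc_continuous _ _ _ E u v uv).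
split.
  by apply: compact_closed => //; apply: continuous_compact => //; apply: segment_compact.
by apply: connected_continuous_connected => //; apply: segment_connected.
Qed.

(** Arcs are cut in thirds. No mesh separates whole arcs with a common end; the middle thirds of
    different edges are disjoint, and each vertex absorbs the outer thirds next to it into its
    [star]. *)
Definition middle (u v : G) : set S :=
  if adj u v then edge_arc E u v @` `[1/3, 2/3] else set0.

Definition star (U : {set G}%SET) (v : G) : set S :=
  [set point_of E v] `|`
  \bigcup_(u in [set u | (u \in U) && adj v u]) edge_arc E v u @` `[0, 1/3].

Lemma middleC u v : middle u v = middle v u.
Proof.
have sub a b : adj a b -> edge_arc E a b @` `[1/3, 2/3] `<=` edge_arc E b a @` `[1/3, 2/3].
  move=> ab x [t /=]; rewrite in_itv /= => /andP[h1 h2] <-.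
  exists (1 - t); first by rewrite /= in_itv /=; lra.
  by rewrite (arc_rev E ab) ?subKr // in_itv /=; lra.
rewrite /middle adj_sym; case: ifP => // vu.
by apply/seteqP; split; apply: sub; rewrite // adj_sym.
Qed.

Lemma middleP u v x : middle u v x ->
  adj u v /\ exists t, [/\ 1/3 <= t, t <= 2/3 & edge_arc E u v t = x].
Proof.
rewrite /middle; case: ifP => // uv [t /=]; rewrite in_itv /= => /andP[h1 h2] <-.
by split => //; exists t.
Qed.

Lemma starP U v x : star U v x -> x = point_of E v \/
  exists u t, [/\ u \in U, adj v u, 0 < t, t <= 1/3 & edge_arc E v u t = x].
Proof.
case=> [->|[u /= /andP[uU vu]] [t /=]]; first by left.
rewrite in_itv /= => /andP[t0 t3] <-.
have [->|tn0] := eqVneq t 0; first by left; rewrite arc0.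
by right; exists u, t; split => //; rewrite lt_def tn0.
Qed.

Lemma arc_eq u v u' v' (t t' : R) : adj u v -> adj u' v' -> 0 < t < 1 -> 0 < t' < 1 ->
  edge_arc E u v t = edge_arc E u' v' t' ->
  (u = u' /\ v = v' /\ t = t') \/ (u = v' /\ v = u' /\ t = 1 - t').
Proof.
move=> uv u'v' t01 t'01 Et.
have [/eqP/setP E2|ne] := boolP ([set u; v]%SET == [set u'; v']%SET); last first.
  by exfalso; apply: (arc_disjoint (e := E) uv u'v' ne _ _ Et); rewrite in_itv.
have := E2 u; have := E2 v; rewrite !inE !eqxx orbT /= => /esym/orP hv /esym/orP hu.
have unv : u <> v by move=> uv'; move: uv; rewrite uv' adj_irrefl.
have I (x : R) : 0 < x < 1 -> x \in `[0, 1].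
  by case/andP => h1 h2; rewrite in_itv /= !ltW.
case: hu => /eqP uE; case: hv => /eqP vE.
- by case: unv; rewrite uE vE.
- left; split=> //; split=> //; subst u' v'.
  exact: (arc_inj (e := E) uv (I _ t01) (I _ t'01) Et).
- right; split=> //; split=> //; subst u' v'.
  move: Et; rewrite (arc_rev E uv (I _ t'01)) => Et.
  exact: (arc_inj (e := E) uv (I _ t01) (I (1 - t') ltac:(lra)) Et).
- by case: unv; rewrite uE vE.
Qed.

Lemma embedding_model (X : scheme) (live : pred (block X)) (psi : block X -> R * R -> S)
    (U : {set G}%SET) :
  realisation live psi ->
  (forall u, u \in U -> covered live psi (point_of E u)) ->
  (forall u v t, u \in U -> v \in U -> adj u v -> 0 <= t <= 1 -> covered live psi (edge_arc E u v t)) ->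
  exists (n : nat) (bag : cell (grid X n) -> option G), model (@adj G) U bag.
Proof.
move=> psiR covp cova.
apply: (drawing_model psiR hS (K := star U) (M := middle)).
- exact: adj_sym.
- exact: adj_irrefl.
- move=> v vU; split.
  + apply: closedU; first by apply: compact_closed => //; apply: compact_set1.
    apply: closed_bigcup => [|u /= /andP[uU vu]]; first exact: finite_finset.
    by apply: (arc_image vu _ _ _).1; lra.
  + have eqS : star U v = \bigcup_(i in [set i : option G | if i is Some u then (u \in U) && adj v u else true])
       (if i is Some u then edge_arc E v u @` `[0, 1/3] else [set point_of E v]).
      apply/seteqP; split => x.
        by case=> [->|[u h Hx]]; [exists None | exists (Some u)].
      by case=> -[u|] h Hx; [right; exists u | left].
    rewrite eqS; apply: bigcup_connected.
      exists (point_of E v) => -[u|] //= /andP[uU vu].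
      by exists 0; [rewrite /= in_itv /=; lra | rewrite arc0].
    move=> [u /= /andP[uU vu]|_]; last exact: connected1.
    by apply: (arc_image vu _ _ _).2; lra.
  + by exists (point_of E v); left.
  + move=> x /starP[->|[u [t [uU vu t0 t3 <-]]]]; first exact: covp.
    by apply: cova => //; lra.
- exact: middleC.
- move=> u v uU vU uv; rewrite /middle uv.
  have [h1 h2] : closed (edge_arc E u v @` `[1/3, 2/3]) /\ connected (edge_arc E u v @` `[1/3, 2/3]).
    by apply: arc_image => //; lra.
  split => //.
    exists (edge_arc E u v (1/3)); split.
      by exists (1/3) => //=; rewrite in_itv /=; lra.
    by right; exists v; [rewrite /= vU uv | exists (1/3) => //=; rewrite in_itv /=; lra].
  move=> x [t /=]; rewrite in_itv /= => ht <-; apply: cova => //; lra.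
- move=> u v x uU vU uv /starP[->|[u' [t [u'U uu' t0 t3 Et]]]] /starP[E2|[v' [t' [v'U vv' t'0 t'3 Et']]]].
  + by apply: uv; apply: (point_of_inj E2).
  + by apply: (arc_avoids_points (e := E) (w := u) vv' _ Et'); rewrite in_itv /=; lra.
  + by apply: (arc_avoids_points (e := E) (w := v) uu' _ (etrans Et E2)); rewrite in_itv /=; lra.
  + have := arc_eq uu' vv' _ _ (etrans Et (esym Et')) => -[||[h _]|[_ [_ h3]]] //; [lra|lra|].
    suff : t < t by rewrite ltxx.
    lra.
- move=> u v w x uU vU wU uv wu wv /middleP[_ [t [t1 t2 Et]]] /starP[E2|[w' [t' [w'U ww' t'0 t'3 Et']]]].
    by apply: (arc_avoids_points (e := E) (w := w) uv _ (etrans Et E2)); rewrite in_itv /=; lra.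
  have := arc_eq uv ww' _ _ (etrans Et (esym Et')) => -[||[h _]|[_ [h _]]]; [lra|lra| |].
    by apply: wu.
  by apply: wv.
- move=> u v u' v' x uU vU u'U v'U uv u'v' n1 n2 /middleP[_ [t [t1 t2 Et]]] /middleP[_ [t' [t'1 t'2 Et']]].
  have := arc_eq uv u'v' _ _ (etrans Et (esym Et')) => -[||[h1 [h2 _]]|[h1 [h2 _]]]; [lra|lra| |].
    by apply: n1.
  by apply: n2.
Qed.
End EmbeddingModel.

(** * The topology of the surfaces *)

Section SurfaceTopology.
Variables (R : realType) (h c : nat).
Local Notation plane := (R * R)%type.
Local Notation sphere := (one_point_compactification plane).
Local Notation m := (2 * h + c)%N.
Local Notation X := (@holed_sphere R h c).
Local Notation Sigma := (surface R h c).
Local Notation centre := (disc_centre R).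

Definition partner (n : nat) : nat :=
  if (n < 2 * h)%N then (if odd n then n.-1 else n.+1) else n.

Definition twist (n : nat) (v : plane) : plane :=
  if (n < 2 * h)%N then (- v.1, v.2) else - v.

(** Both kinds of gluing in one relation, where a cross-cap is its own partner. It is symmetric and
    single-valued, so a class has at most two points and no chains of attachments arise. *)
Definition paired (z z' : plane) : Prop := exists n v,
  [/\ (n < m)%N, max_norm v = 1, z = centre n + v & z' = centre (partner n) + twist n v].

Lemma partner_lt n : (n < m)%N -> (partner n < m)%N.
Proof. by rewrite /partner; case: ifP => //; case: ifP => //; lia. Qed.

Lemma partner_handle n : (partner n < 2 * h)%N = (n < 2 * h)%N.
Proof.
rewrite /partner; case: ifP => // nh; case: ifP => // on; first by lia.
by lia.
Qed.

Lemma partnerK n : partner (partner n) = n.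
Proof.
rewrite {1}/partner partner_handle; case: (ltnP n (2 * h)) => nh; last first.
  by rewrite /partner ltnNge nh.
rewrite /partner nh; case on: (odd n).
  have -> : odd n.-1 = false by case: (n) on => //= k /negbTE.
  by case: (n) on.
by rewrite /= on.
Qed.

Lemma max_norm_twist n v : max_norm (twist n v) = max_norm v.
Proof. by rewrite /twist /max_norm; case: ifP => _ /=; rewrite !normrN. Qed.

Lemma twistK n v : twist (partner n) (twist n v) = v.
Proof.
rewrite /twist partner_handle; case E: (n < 2 * h)%N; last exact: opprK.
by case: v => a b /=; rewrite opprK.
Qed.

Lemma paired_sym z z' : paired z z' -> paired z' z.
Proof.
case=> n [v [nm v1 -> ->]]; exists (partner n), (twist n v).
by rewrite partner_lt // max_norm_twist partnerK twistK.
Qed.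

Lemma max_norm_le (v : plane) (r : R) : max_norm v <= r -> `|v.1| <= r /\ `|v.2| <= r.
Proof. by rewrite /max_norm ge_max => /andP[]. Qed.

Lemma natr_close (n k : nat) : `|(4 * n)%:R - (4 * k)%:R : R| < 4 -> n = k.
Proof.
have H (a b : nat) : (a < b)%N -> (4 <= (4 * b)%:R - (4 * a)%:R :> R).
  by move=> ab; rewrite -natrB ?ler_nat; lia.
rewrite ltr_norml => /andP[h1 h2]; have [nk|kn|//] := ltngtP n k.
  suff : 4 < 4 :> R by rewrite ltxx.
  by have := H _ _ nk; lra.
suff : 4 < 4 :> R by rewrite ltxx.
by have := H _ _ kn; lra.
Qed.

(** Distinct centres are at distance at least 4, while the discs have radius 1. *)
Lemma circle_unique n n' (v v' : plane) : max_norm v <= 1 -> max_norm v' <= 1 ->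
  centre n + v = centre n' + v' -> n = n' /\ v = v'.
Proof.
move=> /max_norm_le[v1 _] /max_norm_le[v'1 _] E.
have nn : n = n'.
  apply: natr_close; have /= := congr1 fst E; move: v1 v'1; rewrite !ler_norml ltr_norml.
  by move=> /andP[? ?] /andP[? ?] E1; apply/andP; split; lra.
by split => //; move: E; rewrite nn => /addrI.
Qed.

Lemma paired_fun z z' z'' : paired z z' -> paired z z'' -> z' = z''.
Proof.
case=> n [v [nm v1 -> ->]] [n' [v' [n'm v'1 E ->]]].
by have [|| -> ->] := circle_unique _ _ E; rewrite ?v1 ?v'1.
Qed.

Lemma paired_holed z z' : paired z z' -> X (Some z).
Proof.
case=> n [v [nm v1 -> _]] [k /= km [w wk [wE]]].
have w1 : max_norm (w - centre k) < 1 by [].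
have [||| nk vw] := @circle_unique n k v (w - centre k).
- by rewrite v1.
- exact: ltW.
- by rewrite [RHS]addrCA subrr addr0 -wE.
by move: w1; rewrite -vw v1 ltxx.
Qed.

Lemma attach_paired x y : attach h c x y -> exists z z' : plane,
  [/\ x = Some z, y = Some z' & paired z z'].
Proof.
case=> [i v ih v1|j v jc v1].
  exists (centre (2 * i) + v), (centre (2 * i).+1 + (- v.1, v.2)); split => //.
  exists (2 * i)%N, v; split => //; first by lia.
  have i2 : (2 * i < 2 * h)%N by lia.
  by rewrite /partner /twist i2 oddM.
exists (centre (2 * h + j) + v), (centre (2 * h + j) - v); split => //.
exists (2 * h + j)%N, v; split => //; first by lia.
by rewrite /partner /twist ltnNge leq_addr.
Qed.

Definition same_class (x y : sphere) : Prop := x = y \/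
  exists z z' : plane, [/\ x = Some z, y = Some z' & paired z z'].

Lemma same_class_sym x y : same_class x y -> same_class y x.
Proof.
case=> [->|[z [z' [-> -> p]]]]; first by left.
by right; exists z', z; split => //; apply: paired_sym.
Qed.

Lemma same_class_trans y x z : same_class x y -> same_class y z -> same_class x z.
Proof.
case=> [->//|[a [b [-> -> p]]]] [<-|[b' [d [[<-] -> p']]]].
  by right; exists a, b.
by left; congr Some; apply: paired_fun p'; apply: paired_sym.
Qed.

Lemma paired_glued (x y : X) z z' : set_val x = Some z -> set_val y = Some z' ->
  paired z z' -> @glued R h c x y.
Proof.
move=> xz yz' [n [v [nm v1 zE z'E]]]; apply/asboolP.
have [nh|nh] := ltnP n (2 * h); last first.
  apply: rst_step; rewrite /= xz yz' zE z'E /partner /twist ltnNge nh /=.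
  have {1 2}-> : n = (2 * h + (n - 2 * h))%N by lia.
  by apply: attach_crosscap => //; lia.
have [on|en] := boolP (odd n).
  apply: rst_sym; apply: rst_step; rewrite /= xz yz'.
  have {}zE : z = centre n + (- (twist n v).1, (twist n v).2).
    by rewrite zE /twist nh /= opprK -surjective_pairing.
  rewrite zE z'E /partner nh on; have nE : n = (2 * n./2).+1 by lia.
  have -> : n.-1 = (2 * n./2)%N by lia.
  have -> : centre n = centre (2 * n./2).+1 by rewrite -nE.
  apply: attach_handle; first by lia.
  by rewrite max_norm_twist.
apply: rst_step; rewrite /= xz yz' zE z'E /partner /twist nh (negbTE en).
have nE : n = (2 * n./2)%N by lia.
by rewrite nE; apply: attach_handle => //; lia.
Qed.

Lemma gluedP (x y : X) : @glued R h c x y <-> same_class (set_val x) (set_val y).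
Proof.
split=> [/asboolP|].
  elim=> [{}x {}y /attach_paired H|{}x|{}x {}y _|{}x {}y z _ xy _].
  - by right.
  - by left.
  - exact: same_class_sym.
  - exact: same_class_trans.
case=> [/val_inj->|[z [z' [xz yz' p]]]]; first exact: glued_refl.
exact: paired_glued xz yz' p.
Qed.

Definition proj (x : X) : Sigma := \pi_Sigma x.

Lemma projP (x y : X) : proj x = proj y <-> same_class (set_val x) (set_val y).
Proof.
rewrite -gluedP /proj; split => [/eqmodP//|H].
by apply/eqmodP.
Qed.

Lemma proj_surj (p : Sigma) : exists x : X, proj x = p.
Proof. by exists (repr p); rewrite /proj reprK. Qed.

End SurfaceTopology.

Section SurfaceHausdorff.
Variables (R : realType) (h c : nat).
Local Notation plane := (R * R)%type.
Local Notation sphere := (one_point_compactification plane).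
Local Notation m := (2 * h + c)%N.
Local Notation X := (@holed_sphere R h c).
Local Notation Sigma := (surface R h c).
Local Notation centre := (disc_centre R).

Lemma max_norm_continuous : continuous (@max_norm R).
Proof.
move=> z; apply: (@continuous_max R plane (fun z => `|z.1|) (fun z => `|z.2|) z).
  by apply: continuous_comp; [exact: cvg_fst | exact: norm_continuous].
by apply: continuous_comp; [exact: cvg_snd | exact: norm_continuous].
Qed.

Lemma plane_locally_compact : locally_compact [set: plane].
Proof.
move=> x _; rewrite withinET.
exists (closed_ball x.1 1 `*` closed_ball x.2 1).
  exists (closed_ball x.1 1, closed_ball x.2 1) => //=; split; apply/nbhs_closedballP; by exists 1%:pos.
split; first by apply: compact_setX; apply: closed_ballR_compact.
apply: (@closedI _ (fst @^-1` closed_ball x.1 1) (snd @^-1` closed_ball x.2 1)).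
  by apply: closed_comp => [z _|]; [exact: cvg_fst | exact: closed_ball_closed].
by apply: closed_comp => [z _|]; [exact: cvg_snd | exact: closed_ball_closed].
Qed.

Lemma sphere_hausdorff : hausdorff_space sphere.
Proof.
apply: one_point_compactification_hausdorff; first exact: plane_locally_compact.
exact: norm_hausdorff.
Qed.

Lemma sphere_normal : normal_space sphere.
Proof.
move=> A; apply: (compact_normal_local sphere_hausdorff (@one_point_compactification_compact plane)).
by rewrite interiorT.
Qed.

Definition circle (n : nat) : set plane := [set z | max_norm (z - centre n) = 1].

Definition reglue (n : nat) (z : plane) : plane := centre (partner h n) + twist h n (z - centre n).

Lemma pair_continuous (T : topologicalType) (f g : T -> R) :
  continuous f -> continuous g -> continuous (fun x => (f x, g x) : plane).
Proof.
move=> cf cg x; apply: (@cvg_pair T R R (nbhs x) (nbhs (f x)) (nbhs (g x)) _ _ _ f g).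
  exact: cf.
exact: cg.
Qed.

Lemma twist_continuous n : continuous (@twist R h n).
Proof.
have -> : @twist R h n = fun v => (- v.1, if (n < 2 * h)%N then v.2 else - v.2).
  by apply/funext => v; rewrite /twist; case: ifP.
apply: pair_continuous => v; first by apply: cvgN; exact: cvg_fst.
by case: (n < 2 * h)%N; [exact: cvg_snd | apply: cvgN; exact: cvg_snd].
Qed.

Lemma shift_continuous (a : plane) : continuous (fun z : plane => z - a).
Proof. by move=> z; apply: cvgB; [exact: cvg_id | exact: cvg_cst]. Qed.

Lemma reglue_continuous n : continuous (reglue n).
Proof.
have tc : continuous (@twist R h n \o (fun z : plane => z - centre n)).
  move=> z; apply: continuous_comp; first exact: shift_continuous.
  exact: twist_continuous.
move=> z; apply: cvgD; first exact: cvg_cst.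
exact: tc.
Qed.

Lemma circle_closed n : closed (circle n).
Proof.
have -> : circle n = (@max_norm R \o (fun z : plane => z - centre n)) @^-1` [set x | x = 1] by [].
apply: closed_comp => [z _|]; last exact: closed_eq.
by apply: continuous_comp; [exact: shift_continuous | exact: max_norm_continuous].
Qed.

Lemma circle_compact n : compact (circle n).
Proof.
have K : compact ((`[(4 * n)%:R - 1, (4 * n)%:R + 1] : set R) `*` (`[-1, 1] : set R)).
  by apply: compact_setX; apply: segment_compact.
apply: (subclosed_compact (@circle_closed n) K).
move=> z zn; have /max_norm_le[] : max_norm (z - centre n) <= 1 by rewrite zn.
rewrite /= !ler_norml !in_itv /= => /andP[? ?] /andP[? ?].
by split; apply/andP; split; lra.
Qed.

Definition saturation (A : set sphere) : set sphere :=
  A `|` \bigcup_(n in [set n | (n < m)%N]) (Some @` (circle n `&` (Some \o reglue n) @^-1` A)).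

(** The points glued to [A] form finitely many compact pieces, one on each circle. With
    [saturationP] this amounts to the projection being a closed map. *)
Lemma saturation_closed A : closed A -> closed (saturation A).
Proof.
move=> cA; apply: closedU => //; apply: closed_bigcup => [|n _].
  exact: finite_II.
apply: compact_closed; first exact: sphere_hausdorff.
apply: continuous_compact.
  exact/continuous_subspaceT/one_point_compactification_some_continuous.
apply: (subclosed_compact _ (@circle_compact n)); last by move=> z [].
apply: closedI; first exact: circle_closed.
have cs : continuous (Some \o reglue n : plane -> sphere).
  move=> z; apply: continuous_comp; first exact: reglue_continuous.
  exact: one_point_compactification_some_continuous.
exact: (closed_comp (fun z _ => cs z) cA).
Qed.

Lemma reglue_paired n z : (n < m)%N -> circle n z -> paired h c z (reglue n z).
Proof. by move=> nm zn; exists n, (z - centre n); split => //; rewrite [RHS]addrCA subrr addr0. Qed.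

Lemma saturationP A (x : X) : saturation A (set_val x) <->
  exists y : X, proj x = proj y /\ A (set_val y).
Proof.
split.
  case=> [Ax|[n /= nm [z [zn Az] xz]]]; first by exists x.
  have p := reglue_paired nm zn.
  have yX : Some (reglue n z) \in X by apply/mem_set/(paired_holed (paired_sym p)).
  exists (exist (fun s : sphere => s \in X) _ yX); split => //; apply/projP; right.
  by exists z, (reglue n z).
case=> y [/projP[xy|[z [z' [xz yz' p]]]] Ay]; first by left; rewrite xy.
right; case: (p) => n [v [nm v1 zE z'E]]; exists n => //; exists z => //.
have vE : z - centre n = v by rewrite zE addrC addKr.
by split; rewrite /circle /reglue /= ?vE // -z'E -yz'.
Qed.

(** The complement of the image of the complement of [U]; it is open for open [U] because the
    projection is closed. *)
Definition core (U : set sphere) : set Sigma :=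
  [set p | forall x : X, proj x = p -> U (set_val x)].

Lemma core_open U : open U -> open (core U).
Proof.
move=> oU; rewrite /open /= /quotient_open.
exists (~` saturation (~` U)).
  by apply: closed_openC; apply: saturation_closed; apply: open_closedC.
apply/seteqP; split => x /=.
  move=> nsat y yx; apply: contrapT => nU; apply: nsat; apply/saturationP.
  by exists y; split.
move=> cx /saturationP[y [xy nU]]; apply: nU; apply: cx.
exact: esym xy.
Qed.

(** The sphere is compact Hausdorff, hence normal. The saturations of two points with different
    classes are disjoint closed sets, and the cores of separating neighbourhoods separate the
    classes. *)
Lemma surface_hausdorff : hausdorff_space Sigma.
Proof.
rewrite open_hausdorff => p q pq.
have [x xp] := proj_surj p; have [y yq] := proj_surj q.
have single_closed (s : sphere) : closed [set s].
  exact: accessible_closed_set1 (hausdorff_accessible sphere_hausdorff) _.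
have cx : closed (saturation [set set_val x]) by apply: saturation_closed.
have cy : closed (saturation [set set_val y]) by apply: saturation_closed.
have holed s (w : X) : saturation [set set_val w] s -> exists u : X, set_val u = s.
  case=> [->|[n /= nm [z [zn _] <-]]]; first by exists w.
  have zX : Some z \in X by apply/mem_set/(paired_holed (reglue_paired nm zn)).
  by exists (exist (fun s : sphere => s \in X) _ zX).
have d : saturation [set set_val x] `&` saturation [set set_val y] = set0.
  apply/seteqP; split => // s [sx sy].
  have [u us] := holed s x sx; move: sx sy; rewrite -us.
  move=> /saturationP[x' [ux' /val_inj x'E]] /saturationP[y' [uy' /val_inj y'E]].
  move: pq; rewrite -xp -yq -x'E -y'E -ux' -uy' eqxx //.
have [U [V [oU oV xU yV UV]]] := (@normal_openP R sphere).1 sphere_normal _ _ cx cy d.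
exists (core U, core V).
  split; apply/mem_set => w wE; [apply: xU | apply: yV]; apply/saturationP.
    by exists x; rewrite wE xp.
  by exists y; rewrite wE yq.
split; [exact: core_open | exact: core_open | apply/eqP/seteqP; split => // r [/= rU rV]].
have [w wr] := proj_surj r.
have : (U `&` V) (set_val w) by split; [apply: rU | apply: rV].
by rewrite UV.
Qed.

End SurfaceHausdorff.

Section Exhaustion.
Variables (R : realType) (h c : nat).
Local Notation plane := (R * R)%type.
Local Notation sphere := (one_point_compactification plane).
Local Notation m := (2 * h + c)%N.
Local Notation X := (@holed_sphere R h c).
Local Notation Sigma := (surface R h c).
Local Notation centre := (disc_centre R).

(** [4 * m + 4] exceeds the reach of every removed disc, so that gluing never leaves a bounded
    part. *)
Definition extent (k : nat) : R := (4 * m + 4 + k)%:R.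

Definition bounded_part (k : nat) : set Sigma :=
  [set p | exists (x : X) (z : plane), [/\ set_val x = Some z, max_norm z < extent k & proj x = p]].

Lemma paired_bounded k z z' : paired h c z z' -> max_norm z < extent k.
Proof.
case=> n [v [nm v1 -> _]]; have [|a1 a2] := @max_norm_le R v 1; first by rewrite v1.
have r4 : (4 * n)%:R + 3 < extent k by rewrite -natrD ltr_nat; lia.
have n0 : 0 <= (4 * n)%:R :> R by rewrite ler0n.
move: a1 a2; rewrite /max_norm gt_max !ltr_norml !ler_norml /= => /andP[? ?] /andP[? ?].
by apply/andP; split; apply/andP; split; lra.
Qed.

Lemma bounded_part_open k : open (bounded_part k).
Proof.
rewrite /open /= /quotient_open.
exists (Some @` [set z : plane | max_norm z < extent k]).
  apply: one_point_compactification_open_some.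
  apply: (@open_comp _ _ (@max_norm R) [set x | x < extent k]); last exact: open_lt.
  by move=> z _; exact: max_norm_continuous.
apply/seteqP; split => x /=.
  by case=> z zk zx; exists x, z; rewrite zx.
case=> y [z [yz zk yx]].
have /projP[yxE|[a [b [ya xb p]]]] : proj y = proj x := yx.
  by exists z => //; rewrite -yxE yz.
by exists b => //; apply: paired_bounded (paired_sym p).
Qed.

Lemma bounded_part_mono k k' : (k <= k')%N -> bounded_part k `<=` bounded_part k'.
Proof.
move=> kk p [x [z [xz zk xp]]]; exists x, z; split => //.
by apply: (lt_le_trans zk); rewrite ler_nat; lia.
Qed.

Lemma infinity_in : (None : sphere) \in X.
Proof. by apply/mem_set => -[n _ [w _]]. Qed.

Definition infinity : Sigma := proj (exist (fun s : sphere => s \in X) _ infinity_in).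

Lemma bounded_part_cover p : p <> infinity -> exists k, bounded_part k p.
Proof.
have [x <-] := proj_surj p; case E: (set_val x) => [z|] xinf; last first.
  by case: xinf; apply/projP; left; rewrite E.
exists (Num.truncn (max_norm z)).+1, x, z; split => //.
have z0 : 0 <= max_norm z by rewrite /max_norm le_max normr_ge0.
have /andP[_ zl] := truncn_itv z0; apply: (lt_le_trans zl).
by rewrite ler_nat; lia.
Qed.

(** The bounded parts form an increasing open cover of everything but [infinity]. *)
Lemma compact_bounded (A : set Sigma) : compact A -> ~ A infinity ->
  \forall k \near \oo, A `<=` bounded_part k.
Proof.
move=> /compact_near_coveringP cA Ainf; apply: (cA nat \oo bounded_part) => x Ax.
have [k kx] : exists k, bounded_part k x by apply: bounded_part_cover => xi; rewrite xi in Ax.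
exists (bounded_part k, [set k' | (k <= k')%N]) => /=.
  split; last exact: nbhs_infty_ge.
  exact: (open_nbhs_nbhs (conj (@bounded_part_open k) kx)).
by move=> [y k'] [/= ky kk]; apply: bounded_part_mono ky.
Qed.

Variables (G : sgraph) (E : embedding R G Sigma).

(* Used at infinity: the remaining drawing lies in a bounded part of the plane. *)
Lemma avoid_point (p : Sigma) : exists D : {set G}%SET, [/\ (#|D| <= 2)%N,
  forall u, u \notin D -> point_of E u <> p &
  forall u v t, u \notin D -> v \notin D -> adj u v -> 0 <= t <= 1 -> edge_arc E u v t <> p].
Proof.
have ends u v t : adj u v -> 0 <= t <= 1 -> ~ (0 < t < 1) ->
    edge_arc E u v t = point_of E u \/ edge_arc E u v t = point_of E v.
  move=> uv /andP[t0 t1] nt; have [->|tn0] := eqVneq t 0; first by left; rewrite arc0.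
  have [->|tn1] := eqVneq t 1; first by right; rewrite arc1.
  by case: nt; rewrite !lt_def tn0 eq_sym tn1 t0 t1.
(* If [p] is a vertex, that vertex is dropped; if [p] is inside an arc, the two ends of the arc are,
   and no other arc passes through [p]. *)
have [[w wp]|nopoint] := pselect (exists w, point_of E w = p).
  exists [set w]%SET; split; first by rewrite cards1.
    by move=> u uw up; move: uw; rewrite inE (point_of_inj (etrans up (esym wp))) eqxx.
  move=> u v t uw vw uv t01 tp; have [t01'|nt] := boolP (0 < t < 1).
    by apply: (arc_avoids_points (e := E) (w := w) uv _ (etrans tp (esym wp))); rewrite in_itv.
  case: (ends u v t uv t01 ltac:(exact/negP)) => up.
    by move: uw; rewrite inE (point_of_inj (etrans (esym up) (etrans tp (esym wp)))) eqxx.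
  by move: vw; rewrite inE (point_of_inj (etrans (esym up) (etrans tp (esym wp)))) eqxx.
have inner u v t : adj u v -> 0 <= t <= 1 -> edge_arc E u v t = p -> 0 < t < 1.
  move=> uv t01 tp; apply: contrapT => nt; apply: nopoint.
  by case: (ends u v t uv t01 nt) => up; [exists u | exists v]; rewrite -up.
have [[u0 [v0 [t0 [uv0 t001 tp0]]]]|noarc] := pselect (exists u v t, [/\ adj u v, 0 <= t <= 1 & edge_arc E u v t = p]).
  exists [set u0; v0]%SET; split; first by rewrite cards2; case: (_ != _).
    by move=> u _ up; apply: nopoint; exists u.
  move=> u v t uD vD uv t01 tp.
  have ne : [set u; v]%SET != [set u0; v0]%SET.
    by apply/eqP => Es; move: uD; rewrite -Es !inE eqxx.
  have i1 := inner u v t uv t01 tp; have i2 := inner u0 v0 t0 uv0 t001 tp0.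
  by apply: (arc_disjoint (e := E) uv uv0 ne _ _ (etrans tp (esym tp0))); rewrite in_itv.
exists (@finset.set0 G); rewrite cards0; split => // [u _ up|u v t _ _ uv t01 tp].
  by apply: nopoint; exists u.
by apply: noarc; exists u, v, t.
Qed.

Lemma bounded_drawing : exists (D : {set G}%SET) (k : nat), [/\ (#|D| <= 2)%N,
  forall u, u \notin D -> bounded_part k (point_of E u) &
  forall u v t, u \notin D -> v \notin D -> adj u v -> 0 <= t <= 1 ->
    bounded_part k (edge_arc E u v t)].
Proof.
have [D [D2 Dp Da]] := avoid_point infinity; exists D.
have imp (P : Prop) (Z : nat -> Prop) : (P -> \forall n \near \oo, Z n) ->
    \forall n \near \oo, P -> Z n.
  by move=> H; have [/H|nP] := pselect P; [apply: filterS | apply: nearW].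
have f1 : \forall k \near \oo, forall u : G, u \notin D -> bounded_part k (point_of E u).
  apply: filter_forall => u; apply: (imp _ _) => uD.
  have cu : compact [set point_of E u] by apply: compact_set1.
  have := compact_bounded cu (fun uinf => Dp u uD (esym uinf)).
  by apply: filterS => k; apply.
have f2 : \forall k \near \oo, forall p : G * G, p.1 \notin D -> p.2 \notin D -> adj p.1 p.2 ->
    (edge_arc E p.1 p.2 @` `[0, 1]) `<=` bounded_part k.
  apply: filter_forall => p; do 3!apply: (imp _ _) => ?; apply: compact_bounded.
    by apply: continuous_compact; [exact: (@arc_continuous _ _ _ E) | exact: segment_compact].
  by case=> t /=; rewrite in_itv /= => t01; apply: Da.
have [k [{}f1 {}f2]] := filter_ex (filterI f1 f2).
exists k; split => // u v t uD vD uv t01.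
by apply: (f2 (u, v) uD vD uv); exists t => //; rewrite /= in_itv.
Qed.
End Exhaustion.

(** * The surfaces as glued squares *)

Section Blocks.
Local Open Scope nat_scope.
Variables (h c : nat).
Local Notation m := (2 * h + c)%N.

(** A bounding square is cut along the lines through the sides of the removed discs. This gives
    [2 * m + 1] columns, every second one with a disc in the middle of its three rows. *)
Definition sblock := ('I_(2 * m).+1 * 'I_3)%type.

Definition movable (k : nat) (sg : bool) (a : 'I_k.+1) : bool := if sg then a < k else 0 < a.

Definition shift (k : nat) (sg : bool) (a : 'I_k.+1) : 'I_k.+1 :=
  if sg then inord a.+1 else inord a.-1.

Lemma val_shift k sg (a : 'I_k.+1) : movable sg a ->
  shift sg a = (if sg then a.+1 else a.-1) :> nat.
Proof. by case: sg => /= H; rewrite inordK //; have := ltn_ord a; lia. Qed.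

Lemma movable_shift k sg (a : 'I_k.+1) : movable sg a -> movable (~~ sg) (shift sg a).
Proof.
move=> H; have := val_shift H; case: sg H => /= H ->; have := ltn_ord a; lia.
Qed.

Lemma shiftK k sg (a : 'I_k.+1) : movable sg a -> shift (~~ sg) (shift sg a) = a.
Proof.
move=> H; apply: val_inj; rewrite /= (val_shift (movable_shift H)) (val_shift H).
by case: sg H => /= H; lia.
Qed.

(** A side on the rim of the square is its own neighbour, which makes it a boundary side of the
    grid. *)
Definition neighbour (f : sblock * side) : sblock * side :=
  if f.2.1 then
    if movable f.2.2 f.1.2 then ((f.1.1, shift f.2.2 f.1.2), (f.2.1, ~~ f.2.2)) else f
  else
    if movable f.2.2 f.1.1 then ((shift f.2.2 f.1.1, f.1.2), (f.2.1, ~~ f.2.2)) else f.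

Lemma neighbourK : involutive neighbour.
Proof.
case=> [[a b] [[] sg]]; rewrite /neighbour /=.
  case H: (movable sg b); last by rewrite /= H.
  by rewrite /= movable_shift // shiftK // negbK.
case H: (movable sg a); last by rewrite /= H.
by rewrite /= movable_shift // shiftK // negbK.
Qed.

(* The block of column [2n+1] in the middle row is the [n]-th removed disc. *)
Definition removed (b : sblock) : bool := odd b.1 && (b.2 == 1 :> nat).

Definition disc_of (b : sblock) : nat := b.1./2.

Lemma removed_disc b : removed b -> disc_of b < m /\ (disc_of b).*2.+1 = b.1.
Proof.
by case: b => a b /andP[/= oa _]; rewrite /disc_of /=; have := ltn_ord a; lia.
Qed.

(** [twist] in terms of sides. The reflection of a handle exchanges the sides with horizontal normal
    and reverses the parameter on the other two; the antipodal map exchanges opposite sides and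
    reverses every parameter. The reversals are in [across_flip]. *)
Definition across (f : sblock * side) : sblock * side :=
  ((inord (partner h (disc_of f.1)).*2.+1, f.1.2),
   (f.2.1, if (disc_of f.1 < 2 * h) && f.2.1 then f.2.2 else ~~ f.2.2)).

Definition across_flip (f : sblock * side) : bool :=
  if disc_of f.1 < 2 * h then f.2.1 else true.

Lemma val_across f : removed f.1 -> (across f).1.1 = (partner h (disc_of f.1)).*2.+1 :> nat.
Proof.
move=> /removed_disc[lt _]; rewrite /across /= inordK //.
by have := @partner_lt h c _ lt; lia.
Qed.

Lemma disc_across f : removed f.1 -> disc_of (across f).1 = partner h (disc_of f.1).
Proof. by move=> fr; rewrite {1}/disc_of val_across //; lia. Qed.

Lemma removed_across f : removed f.1 -> removed (across f).1.
Proof.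
move=> fr; rewrite /removed val_across //=; have /andP[_ ->] := fr.
by rewrite andbT odd_double.
Qed.

Lemma acrossK f : removed f.1 -> across (across f) = f.
Proof.
move=> fr; have [lt E] := removed_disc fr.
rewrite {1}/across disc_across // partnerK partner_handle.
case: f fr lt E => [[a b] [ax sg]] /= fr lt E; congr ((_, _), (_, _)).
  by apply: val_inj; rewrite /= inordK E.
by case: (_ && _); rewrite /= ?negbK.
Qed.

Lemma across_flip_across f : removed f.1 -> across_flip (across f) = across_flip f.
Proof. by move=> fr; rewrite /across_flip disc_across // partner_handle. Qed.

Lemma removed_neighbour f : removed f.1 -> ~~ removed (neighbour f).1.
Proof.
case: f => [[a b] [ax sg]] /andP[/= oa /eqP b1]; have := ltn_ord a => la.
rewrite /neighbour /=; case: ax => /=.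
  have mb : movable sg b by rewrite /movable b1; case: sg.
  by rewrite mb /removed /= (val_shift mb) b1 oa; case: (sg).
have ma : movable sg a by rewrite /movable; case: sg; lia.
rewrite ma /removed /= (val_shift ma) b1 andbT.
by case: (sg); lia.
Qed.

(** A live side that borders a hole is glued through it: into the removed block, across to its
    partner, and out again. Removed blocks are glued among themselves, which makes [smate] an
    involution of all sides. *)
Definition smate (f : sblock * side) : sblock * side :=
  if removed f.1 then across f
  else if removed (neighbour f).1 then neighbour (across (neighbour f)) else neighbour f.

Definition sflip (f : sblock * side) : bool :=
  if removed f.1 then across_flip f
  else if removed (neighbour f).1 then across_flip (neighbour f) else false.

Lemma smateK : involutive smate.
Proof.
move=> f; rewrite {2}/smate; case: ifP => fr.
  by rewrite /smate removed_across // acrossK.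
case: ifP => gr; rewrite /smate; last by rewrite gr neighbourK fr.
have r1 := removed_across gr; have r2 := removed_neighbour r1.
by rewrite (negbTE r2) !neighbourK r1 acrossK // neighbourK.
Qed.

Lemma sflip_mate f : sflip (smate f) = sflip f.
Proof.
rewrite /smate /sflip; case fr: (removed f.1).
  by rewrite removed_across // across_flip_across.
case gr: (removed (neighbour f).1); last by rewrite gr neighbourK fr.
have r1 := removed_across gr; have r2 := removed_neighbour r1.
by rewrite (negbTE r2) !neighbourK r1 across_flip_across.
Qed.

Definition surface_scheme : scheme := Scheme smateK sflip_mate.

Definition live : pred (block surface_scheme) := fun b => ~~ removed b.

Lemma live_smate f : live f.1 -> live (smate f).1.
Proof.
rewrite /live /smate => fl; rewrite (negbTE fl); case: ifP => gr; last by rewrite gr.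
by apply: removed_neighbour; apply: removed_across.
Qed.
End Blocks.

Section Axis.
Variables (R : realType) (K : nat) (F : nat -> R).
Hypothesis Finc : forall a, (a <= K)%N -> F a < F a.+1.

(* The projection onto [0, 1]; it makes the charts continuous on the whole plane. *)
Definition clamp (x : R) : R := (1 + `|x| - `|x - 1|) / 2.

Lemma clamp_unit x : 0 <= clamp x <= 1.
Proof.
rewrite /clamp; have := ler_normD (x - 1) 1; have := ler_normD (- x) 1.
rewrite subrK normrN normr1 addrC -opprB normrN => h1 h2; apply/andP; split; lra.
Qed.

Lemma clamp_id x : 0 <= x <= 1 -> clamp x = x.
Proof.
case/andP => x0 x1; rewrite /clamp ger0_norm // ler0_norm; last by rewrite subr_le0.
lra.
Qed.

Lemma clamp_continuous : continuous clamp.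
Proof.
move=> x; rewrite /clamp; apply: cvgM; last exact: cvg_cst.
apply: cvgB; first by apply: cvgD; [exact: cvg_cst | exact: norm_continuous].
by apply: cvg_norm; apply: cvgB; [exact: cvg_id | exact: cvg_cst].
Qed.

Definition axis (a : nat) (u : R) : R := F a + clamp u * (F a.+1 - F a).

Lemma axis_continuous a : continuous (axis a).
Proof.
move=> x; apply: cvgD; first exact: cvg_cst.
by apply: cvgM; [exact: clamp_continuous | exact: cvg_cst].
Qed.

Lemma axis0 a : axis a 0 = F a.
Proof. by rewrite /axis clamp_id ?lexx ?ler01 // mul0r addr0. Qed.

Lemma axis1 a : axis a 1 = F a.+1.
Proof. by rewrite /axis clamp_id ?lexx ?ler01 // mul1r addrC subrK. Qed.

Lemma axis_mem a u : (a <= K)%N -> F a <= axis a u <= F a.+1.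
Proof.
move=> /Finc aK; have /andP[u0 u1] := clamp_unit u; rewrite /axis; apply/andP; split; nra.
Qed.

Lemma axis_inj a u u' : (a <= K)%N -> 0 <= u <= 1 -> 0 <= u' <= 1 ->
  axis a u = axis a u' -> u = u'.
Proof.
move=> /Finc aK uI u'I; rewrite /axis !clamp_id // => /addrI /mulIf; apply.
by rewrite subr_eq0 gt_eqF.
Qed.

Lemma F_lt a b : (a < b)%N -> (b <= K.+1)%N -> F a < F b.
Proof.
elim: b => // b IH; rewrite ltnS leq_eqVlt ltnS => /orP[/eqP-> /Finc//|ab bK].
by apply: lt_trans (Finc bK); apply: IH => //; apply: leqW.
Qed.

Lemma F_lt_inv a b : (a <= K.+1)%N -> F a < F b -> (a < b)%N.
Proof.
move=> aK Fab; rewrite ltnNge; apply/negP; rewrite leq_eqVlt => /orP[/eqP ba|/F_lt/(_ aK)].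
  by rewrite ba ltxx in Fab.
by move=> ba; have := lt_trans Fab ba; rewrite ltxx.
Qed.

Lemma axis_adjacent a a' u u' : (a < a')%N -> (a' <= K)%N -> 0 <= u <= 1 -> 0 <= u' <= 1 ->
  axis a u = axis a' u' -> [/\ a' = a.+1, u = 1 & u' = 0].
Proof.
move=> aa a'K uI u'I E; have aK : (a <= K)%N by apply: leq_trans (ltnW aa) a'K.
have /andP[_ h1] := axis_mem u aK; have /andP[h2 _] := axis_mem u' a'K.
have [a'E|ne] := eqVneq a' a.+1; last first.
  have := F_lt (a := a.+1) (b := a') ltac:(lia) ltac:(lia) => h3.
  by move: h1; rewrite E leNgt (lt_le_trans h3 h2).
subst a'; have e1 : axis a u = F a.+1 by apply/eqP; rewrite eq_le h1 E h2.
split => //.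
  by apply: (axis_inj aK uI); rewrite ?lexx ?ler01 // axis1.
by apply: (axis_inj a'K u'I); rewrite ?lexx ?ler01 // axis0 -E.
Qed.

Lemma axis_surj a x : (a <= K)%N -> F a <= x <= F a.+1 -> exists2 u, 0 <= u <= 1 & axis a u = x.
Proof.
move=> /Finc aK /andP[h1 h2]; have d0 : 0 < F a.+1 - F a by rewrite subr_gt0.
have uI : 0 <= (x - F a) / (F a.+1 - F a) <= 1.
  by rewrite divr_ge0 ?subr_ge0 ?(ltW aK) //= ler_pdivrMr // mul1r lerD2r.
exists ((x - F a) / (F a.+1 - F a)) => //.
by rewrite /axis clamp_id // divfK ?gt_eqF // addrC subrK.
Qed.

Lemma axis_cover x : F 0 <= x <= F K.+1 -> exists2 a, (a <= K)%N & F a <= x <= F a.+1.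
Proof.
case/andP => h1 h2.
suff H b : (b <= K.+1)%N -> F b <= x \/ (exists2 a, (a <= K)%N & F a <= x <= F a.+1).
  case: (H K.+1 (leqnn _)) => // h3; exists K => //; rewrite h2 andbT.
  by apply: le_trans h3; apply: ltW; apply: Finc.
elim: b => [|b IH] bK; first by left.
case: (IH (ltnW bK)) => [h3|]; last by right.
have [h4|h4] := leP (F b.+1) x; [by left | right; exists b => //].
by rewrite h3 ltW.
Qed.
End Axis.

Lemma same_point_trans (R : realType) (X : scheme) (live : pred (block X))
    (p q r : block X * (R * R)) :
  same_point live p q -> same_point live q r -> same_point live p r.
Proof. by elim=> // f t q' lf t01 _ IH /IH; apply: same_step. Qed.

Lemma double_bounds (n k : nat) : (n.*2.+1 <= 2 * k)%N ->
  [/\ (n < k)%N, (n.*2 <= 2 * k)%N, (n.*2.+1 <= 2 * k)%N & (n.*2.+2 <= 2 * k)%N].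
Proof. by move=> nk; split; lia. Qed.

Section SurfaceRealisation.
Variables (R : realType) (h c : nat) (B : R).
Local Notation plane := (R * R)%type.
Local Notation sphere := (one_point_compactification plane).
Local Notation m := (2 * h + c)%N.
Local Notation X := (@holed_sphere R h c).
Local Notation Sigma := (surface R h c).
Local Notation centre := (disc_centre R).
Local Notation sblock := (sblock h c).
Local Notation live := (@live h c).
Hypothesis Bm : (4 * m + 4)%:R <= B.

(** The inner lines are at -1, 1, 3, 5, ..., so that column 2n + 1 spans [4n - 1, 4n + 1], the width
    of disc n. *)
Definition column (a : nat) : R :=
  if a == 0%N then - B else if a == (2 * m).+1 then B else (2 * a)%:R - 3.

Definition row (b : nat) : R :=
  if b == 0%N then - B else if b == 3 then B else (2 * b)%:R - 3.

Lemma column_inc a : (a <= 2 * m)%N -> column a < column a.+1.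
Proof.
move=> am; rewrite /column /= eqSS (_ : (a == (2 * m).+1)%N = false); last by lia.
have : 4 <= (4 * m + 4)%:R :> R by rewrite ler_nat; lia.
have e1 : (2 * a.+1)%:R = (2 * a)%:R + 2 :> R by rewrite -natrD; congr _%:R; lia.
have a0 : 0 <= (2 * a)%:R :> R by rewrite ler0n.
have : (2 * a)%:R <= (4 * m + 4)%:R :> R by rewrite ler_nat; lia.
case: eqP => a0'; case: eqP => a1; rewrite ?e1; move: Bm => *; lra.
Qed.

Lemma row_inc b : (b <= 2)%N -> row b < row b.+1.
Proof.
have : 4 <= (4 * m + 4)%:R :> R by rewrite ler_nat; lia.
by move: Bm; case: b => [|[|[|]]] //=; rewrite /row /=; lra.
Qed.

Definition chart (b : sblock) (p : plane) : plane :=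
  (axis column b.1 p.1, axis row b.2 p.2).

Lemma chart_continuous b : continuous (chart b).
Proof.
apply: pair_continuous => p.
  by apply: (@continuous_comp _ _ _ fst (axis column b.1)); [exact: cvg_fst | exact: axis_continuous].
by apply: (@continuous_comp _ _ _ snd (axis row b.2)); [exact: cvg_snd | exact: axis_continuous].
Qed.

Lemma column_bound (b : sblock) : (b.1 <= 2 * m)%N.
Proof. by rewrite -ltnS. Qed.

Lemma row_bound (b : sblock) : (b.2 <= 2)%N.
Proof. by rewrite -ltnS. Qed.

Lemma column_disc n : (n < m)%N ->
  column n.*2.+1 = (4 * n)%:R - 1 /\ column n.*2.+2 = (4 * n)%:R + 1.
Proof.
move=> nm; rewrite /column /= !eqSS.
have -> : (n.*2 == 2 * m)%N = false by lia.
have -> : (n.*2.+1 == 2 * m)%N = false by lia.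
have -> : (2 * n.*2.+1)%:R = (4 * n)%:R + 2 :> R by rewrite -natrD; congr _%:R; lia.
have -> : (2 * n.*2.+2)%:R = (4 * n)%:R + 4 :> R by rewrite -natrD; congr _%:R; lia.
by split; lra.
Qed.

Lemma row_disc : row 1 = -1 /\ row 2 = 1.
Proof. by rewrite /row /=; split; lra. Qed.

(** An open disc lies strictly between the lines that bound one removed block, so a point of block
    [b] inside it forces [b] to be that block. *)
Lemma live_holed b p : live b -> X (Some (chart b p)).
Proof.
move=> lb [n /= nm [w wn [wE]]]; case/negP: lb.
have /andP[x1 x2] := axis_mem column_inc p.1 (column_bound b).
have /andP[y1 y2] := axis_mem row_inc p.2 (row_bound b).
have w1 : max_norm (w - centre n) < 1 by [].
move: w1; rewrite wE /max_norm gt_max !ltr_norml /= subr0 => /andP[/andP[x3 x4] /andP[y3 y4]].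
have [c1 c2] := column_disc nm; have [r1 r2] := row_disc.
have h1 : (b.1 < n.*2.+2)%N.
  by apply: (F_lt_inv column_inc (leqW (column_bound b))); rewrite c2; lra.
have h2 : (n.*2.+1 < b.1.+1)%N.
  by apply: (F_lt_inv column_inc); [lia | rewrite c1; lra].
have h3 : (b.2 < 2)%N.
  by apply: (F_lt_inv row_inc (leqW (row_bound b))); rewrite r2; lra.
have h4 : (1 < b.2.+1)%N.
  by apply: (F_lt_inv row_inc) => //; rewrite r1; lra.
have e1 : b.1 = n.*2.+1 :> nat by apply/eqP; rewrite eqn_leq -ltnS h1 -ltnS h2.
have e2 : b.2 = 1%N :> nat by apply/eqP; rewrite eqn_leq -ltnS h3 -ltnS h4.
by rewrite /removed e1 e2 /= odd_double.
Qed.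

(** Infinity is a default value; by [live_holed] it does not occur on live blocks. *)
Definition to_holed (z : plane) : X :=
  match pselect (X (Some z)) with
  | left zX => exist (fun s : sphere => s \in X) _ (mem_set zX)
  | right _ => exist (fun s : sphere => s \in X) _ (infinity_in R h c)
  end.

Lemma to_holedE z : X (Some z) -> set_val (to_holed z) = Some z.
Proof. by move=> zX; rewrite /to_holed; case: pselect. Qed.

Definition parametrise (b : sblock) (p : plane) : Sigma :=
  if live b then proj (to_holed (chart b p)) else infinity R h c.

Lemma parametrise_continuous b : continuous (parametrise b).
Proof.
rewrite /parametrise; case lb: (live b); last by move=> x; exact: cvg_cst.
have cX : continuous (fun p => to_holed (chart b p)).
  apply: continuous_comp_initial.
  have -> : set_val \o (fun p => to_holed (chart b p)) = Some \o chart b :> (plane -> sphere).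
    by apply/funext => p /=; rewrite to_holedE //; apply: live_holed.
  move=> p; apply: continuous_comp; first exact: chart_continuous.
  exact: one_point_compactification_some_continuous.
by move=> p; apply: (continuous_comp (cX p)); exact: pi_continuous.
Qed.

Lemma chart_neighbour (f : sblock * side) t :
  chart f.1 (side_point f.2 t) = chart (neighbour f).1 (side_point (neighbour f).2 t).
Proof.
case: f => [[a b] [[] sg]]; rewrite /neighbour /chart /side_point /=.
  case H: (movable sg b) => //=; rewrite (val_shift H); congr (_, _).
  by case: sg H => /= H; rewrite ?axis0 ?axis1 // prednK.
case H: (movable sg a) => //=; rewrite (val_shift H); congr (_, _).
by case: sg H => /= H; rewrite ?axis0 ?axis1 // prednK.
Qed.

Lemma chart_removed b p : removed b -> unit_square p ->
  chart b p = centre (disc_of b) + (2 * p.1 - 1, 2 * p.2 - 1).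
Proof.
move=> rb [/=]; rewrite !in_itv /= => p1 p2; have [lt E] := removed_disc rb.
have [c1 c2] := column_disc lt; have [r1 r2] := row_disc.
have /andP[_ /eqP b1] := rb.
rewrite /chart /axis -E b1 c1 c2 r1 r2 !clamp_id //.
by rewrite /disc_centre; congr (_, _) => /=; lra.
Qed.

Lemma side_point_unit s (t : R) : 0 <= t <= 1 -> unit_square (side_point s t).
Proof.
by move=> t01; case: s => [[] []]; split; rewrite /= in_itv /= ?t01 ?lexx ?ler01.
Qed.

Lemma flip_unit (o : bool) (t : R) : 0 <= t <= 1 -> 0 <= (if o then 1 - t else t) <= 1.
Proof. by case: o => // /andP[? ?]; apply/andP; split; lra. Qed.

Lemma max_norm_side s (t : R) : 0 <= t <= 1 ->
  max_norm (2 * (side_point s t).1 - 1, 2 * (side_point s t).2 - 1) = 1 :> R.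
Proof.
move=> /andP[t0 t1]; have t2 : `|2 * t - 1| <= 1 by rewrite ler_norml; apply/andP; split; lra.
have e1 : 2 * 1 - 1 = 1 :> R by lra.
have e0 : 2 * 0 - 1 = -1 :> R by lra.
by case: s => [[] []]; rewrite /max_norm /side_point /= ?e1 ?e0 ?normrN ?normr1;
  rewrite ?(max_idPl t2) ?(max_idPr t2).
Qed.

Lemma chart_across (g : sblock * side) t : removed g.1 -> 0 <= t <= 1 ->
  paired h c (chart g.1 (side_point g.2 t))
    (chart (across g).1 (side_point (across g).2 (if across_flip g then 1 - t else t))).
Proof.
move=> rg t01; have [lt E] := removed_disc rg.
exists (disc_of g.1), (2 * (side_point g.2 t).1 - 1, 2 * (side_point g.2 t).2 - 1).
split => //.
- exact: max_norm_side.
- by apply: chart_removed => //; apply: side_point_unit.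
- rewrite chart_removed ?removed_across //; last by apply/side_point_unit/flip_unit.
  rewrite disc_across //; congr (_ + _).
  rewrite /twist /across_flip /across /side_point /=.
  case: (disc_of g.1 < 2 * h)%N; case: (g.2) => [[] []] /=; congr (_, _) => //=; lra.
Qed.

Lemma proj_to_holed z z' : X (Some z) -> X (Some z') -> z = z' \/ paired h c z z' ->
  proj (to_holed z) = proj (to_holed z').
Proof.
move=> zX z'X H; apply/projP; rewrite !to_holedE //.
by case: H => [->|p]; [left | right; exists z, z'].
Qed.

Lemma parametrise_glue f t : live f.1 -> 0 <= t <= 1 ->
  parametrise f.1 (side_point f.2 t)
  = parametrise (smate f).1 (side_point (smate f).2 (if sflip f then 1 - t else t)).
Proof.
move=> lf t01; have lm := live_smate lf.
rewrite /parametrise lf lm; apply: proj_to_holed; try exact: live_holed.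
move: lf; rewrite /live /smate /sflip => /negbTE->; case gr: (removed (neighbour f).1); last first.
  by left; apply: chart_neighbour.
by right; rewrite (chart_neighbour f) -(chart_neighbour (across (neighbour f))); apply: chart_across.
Qed.

Lemma smate_live f : live f.1 -> live (neighbour f).1 -> smate f = neighbour f /\ sflip f = false.
Proof. by rewrite /live /smate /sflip => /negbTE-> /negbTE->. Qed.

Lemma neighbour_step f t q : live f.1 -> live (neighbour f).1 -> 0 <= t <= 1 ->
  q = ((neighbour f).1, side_point (neighbour f).2 t) ->
  @same_point R (surface_scheme h c) live (f.1, side_point f.2 t) q.
Proof.
move=> lf lg t01 ->; apply: same_step => //=; have [-> ->] := smate_live lf lg.
exact: same_refl.
Qed.

Local Notation same := (@same_point R (surface_scheme h c) live).

Lemma same_column (a a' : 'I_(2 * m).+1) (b : 'I_3) u u' v :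
  live (a, b) -> live (a', b) -> 0 <= u <= 1 -> 0 <= u' <= 1 -> 0 <= v <= 1 ->
  axis column a u = axis column a' u' -> same ((a, b), (u, v)) ((a', b), (u', v)).
Proof.
move=> l1 l2 uI u'I vI E; have aK := column_bound (a, b); have a'K := column_bound (a', b).
have [lt|lt|/val_inj aa] := ltngtP a a'.
- have [a'E -> ->] := axis_adjacent column_inc lt a'K uI u'I E.
  have gE : neighbour ((a, b), (false, true)) = ((a', b), (false, false)).
    rewrite /neighbour /=; have -> : (a < 2 * m)%N by rewrite -ltnS -a'E.
    by congr ((_, _), _); apply: val_inj; rewrite /= inordK -a'E.
  by apply: (@neighbour_step ((a, b), (false, true)) v); rewrite ?gE.
- have [aE -> ->] := axis_adjacent column_inc lt aK u'I uI (esym E).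
  have gE : neighbour ((a, b), (false, false)) = ((a', b), (false, true)).
    rewrite /neighbour /=; have -> : (0 < a)%N by rewrite aE.
    by congr ((_, _), _); apply: val_inj; rewrite /= aE /= inordK.
  by apply: (@neighbour_step ((a, b), (false, false)) v); rewrite ?gE.
- by subst a'; rewrite (axis_inj column_inc aK uI u'I E); apply: same_refl.
Qed.

Lemma same_row (a : 'I_(2 * m).+1) (b b' : 'I_3) u v v' :
  live (a, b) -> live (a, b') -> 0 <= u <= 1 -> 0 <= v <= 1 -> 0 <= v' <= 1 ->
  axis row b v = axis row b' v' -> same ((a, b), (u, v)) ((a, b'), (u, v')).
Proof.
move=> l1 l2 uI vI v'I E; have bK := row_bound (a, b); have b'K := row_bound (a, b').
have [lt|lt|/val_inj bb] := ltngtP b b'.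
- have [b'E -> ->] := axis_adjacent row_inc lt b'K vI v'I E.
  have gE : neighbour ((a, b), (true, true)) = ((a, b'), (true, false)).
    rewrite /neighbour /=; have -> : (b < 2)%N by rewrite -ltnS -b'E.
    by congr ((_, _), _); apply: val_inj; rewrite /= inordK -b'E.
  by apply: (@neighbour_step ((a, b), (true, true)) u); rewrite ?gE.
- have [bE -> ->] := axis_adjacent row_inc lt bK v'I vI (esym E).
  have gE : neighbour ((a, b), (true, false)) = ((a, b'), (true, true)).
    rewrite /neighbour /=; have -> : (0 < b)%N by rewrite bE.
    by congr ((_, _), _); apply: val_inj; rewrite /= bE /= inordK.
  by apply: (@neighbour_step ((a, b), (true, false)) u); rewrite ?gE.
- by subst b'; rewrite (axis_inj row_inc bK vI v'I E); apply: same_refl.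
Qed.

(* At most one of the four blocks around a corner is removed, so one can go
   from a block to a diagonally adjacent one through a live block. *)
Lemma same_chart b b' p p' : live b -> live b' -> unit_square p -> unit_square p' ->
  chart b p = chart b' p' -> same (b, p) (b', p').
Proof.
case: b b' p p' => [a b] [a' b'] [u v] [u' v'] l1 l2 [/= uI vI] [/= u'I v'I].
rewrite !in_itv /= in uI vI u'I v'I; case=> E1 E2.
have [l3|l3] := boolP (live (a', b)).
  by apply: same_point_trans (same_column l1 l3 uI u'I vI E1) (same_row l3 l2 u'I vI v'I E2).
have l4 : live (a, b').
  move: l1 l3; rewrite /live /removed /= negbK => l1 /andP[_ b1].
  by rewrite b1 andbT in l1; rewrite negb_and l1.
exact: same_point_trans (same_row l1 l4 uI vI v'I E2) (same_column l4 l2 uI u'I v'I E1).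
Qed.

(** A vector of max norm 1 lies on a side of its disc; [f] is this side seen from the live block
    beyond it. *)
Lemma paired_side z z' : paired h c z z' -> exists (f : sblock * side) t,
  [/\ live f.1, 0 <= t <= 1, z = chart f.1 (side_point f.2 t) &
     z' = chart (smate f).1 (side_point (smate f).2 (if sflip f then 1 - t else t))].
Proof.
move=> pz; have [n [v [nm v1 zE _]]] := pz.
have [|a1 a2] := @max_norm_le R v 1; first by rewrite v1.
have [s [t [t01 vE]]] : exists (s : side) t, 0 <= t <= 1 /\
    v = (2 * (side_point s t).1 - 1, 2 * (side_point s t).2 - 1).
  move: a1 a2; rewrite !ler_norml => /andP[b1 b2] /andP[b3 b4].
  have sg (x : R) : `|x| = 1 -> x = 2 * (if (0 <= x) then 1 else 0) - 1.
    by case: (leP 0 x) => x0; [rewrite ger0_norm // | rewrite ltr0_norm //]; lra.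
  have : `|v.1| = 1 \/ `|v.2| = 1 by move: v1; rewrite /max_norm; case: leP => _; [right | left].
  case=> [/sg e|/sg e].
    exists (false, 0 <= v.1), ((v.2 + 1) / 2); split; first by apply/andP; split; lra.
    by rewrite [LHS]surjective_pairing; congr (_, _) => /=; [exact: e | lra].
  exists (true, 0 <= v.2), ((v.1 + 1) / 2); split; first by apply/andP; split; lra.
  by rewrite [LHS]surjective_pairing; congr (_, _) => /=; [lra | exact: e].
pose b : sblock := (inord n.*2.+1, inord 1).
have rb : removed b by rewrite /removed /b /= !inordK ?odd_double //; lia.
have dn : disc_of b = n by rewrite /disc_of /b /= inordK; lia.
have zb : z = chart b (side_point s t).
  by rewrite chart_removed ?dn -?vE //; apply: side_point_unit.
exists (neighbour (b, s)), t; have lf := removed_neighbour (f := (b, s)) rb.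
have gr : removed (neighbour (neighbour (b, s))).1 by rewrite neighbourK.
split => //; first by rewrite -chart_neighbour.
rewrite /smate /sflip (negbTE lf) gr neighbourK -chart_neighbour.
apply: (paired_fun pz); rewrite zb.
exact: (@chart_across (b, s)).
Qed.

Lemma parametrise_inj b b' p p' : live b -> live b' -> unit_square p -> unit_square p' ->
  parametrise b p = parametrise b' p' -> same (b, p) (b', p').
Proof.
move=> lb lb' pI p'I; rewrite /parametrise lb lb' => /projP.
rewrite !to_holedE; try exact: live_holed.
case=> [/Some_inj E|[z [z' [/Some_inj zE /Some_inj z'E pz]]]]; first exact: same_chart.
have [f [t [lf t01 zf z'f]]] := paired_side pz.
have tI := side_point_unit f.2 t01.
have t'I := side_point_unit (smate f).2 (flip_unit (sflip f) t01).
apply: (same_point_trans (same_chart lb lf pI tI _)); first by rewrite zE.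
apply: same_step => //=.
apply: same_chart => //; first exact: live_smate.
by rewrite z'E.
Qed.

Lemma surface_realisation : @realisation R (surface_scheme h c) Sigma live parametrise.
Proof.
split.
- exact: parametrise_continuous.
- exact: live_smate.
- exact: parametrise_glue.
- exact: parametrise_inj.
Qed.

Lemma parametrise_cover z : X (Some z) -> max_norm z <= B ->
  @covered R (surface_scheme h c) Sigma live parametrise (proj (to_holed z)).
Proof.
move=> zX zB; have [] := max_norm_le zB; rewrite !ler_norml => z1 z2.
have [a aK za] : exists2 a, (a <= 2 * m)%N & column a <= z.1 <= column a.+1.
  by apply: (axis_cover column_inc); rewrite /column /= eqxx.
have [b bK zb] : exists2 b, (b <= 2)%N & row b <= z.2 <= row b.+1.
  exact: (axis_cover row_inc).
suff [a' [b' [a'K b'K [za' zb'] lb]]] : exists a' b' : nat, [/\ (a' <= 2 * m)%N, (b' <= 2)%N,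
    (column a' <= z.1 <= column a'.+1) /\ (row b' <= z.2 <= row b'.+1) & ~~ (odd a' && (b' == 1%N))].
  have [u uI uE] := axis_surj column_inc a'K za'.
  have [v vI vE] := axis_surj row_inc b'K zb'.
  have lab : live (inord a', inord b') by rewrite /live /removed /= !inordK.
  exists (inord a', inord b'), (u, v); split; [exact: lab | by split; rewrite /= in_itv |].
  rewrite /parametrise lab; congr (proj (to_holed _)).
  by rewrite /chart /= !inordK // uE vE -surjective_pairing.
(* The block found may be removed. Its interior is a hole, so the point then lies on an edge of it,
   and the block beyond that edge is live. *)
have [/andP[oa /eqP b1]|lab] := boolP (odd a && (b == 1%N)); last by exists a, b.
have aE : a = (a./2).*2.+1 by rewrite -{1}(odd_double_half a) oa.
have [nm k0 k1 k2] : [/\ (a./2 < m)%N, ((a./2).*2 <= 2 * m)%N, ((a./2).*2.+1 <= 2 * m)%N &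
    ((a./2).*2.+2 <= 2 * m)%N] by apply: double_bounds; rewrite -aE.
have [c1 c2] := column_disc nm; have [r1 r2] := row_disc.
rewrite b1 r1 r2 in zb; rewrite aE c1 c2 in za.
case/andP: za => x1 x2; case/andP: zb => y1 y2.
have ci : forall i, (i <= 2 * m)%N -> column i <= column i.+1 by move=> i iK; apply/ltW/column_inc.
have ri : forall i, (i <= 2)%N -> row i <= row i.+1 by move=> i iK; apply/ltW/row_inc.
have on_edge : `|z.1 - (4 * a./2)%:R| = 1 \/ `|z.2| = 1.
  apply: contrapT => /not_orP[/eqP n1 /eqP n2]; apply: zX; exists a./2 => //=; exists z => //.
  rewrite /= /max_norm gt_max /= subr0 !lt_neqAle n1 n2 !ler_norml /=.
  by apply/andP; split; apply/andP; split; lra.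
have za1 : column (a./2).*2.+1 <= z.1 <= column (a./2).*2.+2 by rewrite c1 c2; apply/andP.
have zb1 : row 1 <= z.2 <= row 2 by rewrite r1 r2; apply/andP.
case: on_edge => [/eqP|/eqP]; rewrite eqr_norml ler01 andbT => /orP[]/eqP E.
- exists (a./2).*2.+2, 1%N; split; [exact: k2 | by [] | split => // | by rewrite /= odd_double].
  have := ci _ k2 => h1; apply/andP; split; first by rewrite c2; lra.
  by apply: le_trans h1; rewrite c2; lra.
- exists (a./2).*2, 1%N; split; [exact: k0 | by [] | split => // | by rewrite odd_double].
  have := ci _ k0 => h1; apply/andP; split; last by rewrite c1; lra.
  by apply: (le_trans h1); rewrite c1; lra.
- exists (a./2).*2.+1, 2%N; split; [exact: k1 | by [] | split => // | by rewrite andbF].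
  have := ri 2 isT => h1; apply/andP; split; first by rewrite r2; lra.
  by apply: le_trans h1; rewrite r2; lra.
- exists (a./2).*2.+1, 0%N; split; [exact: k1 | by [] | split => // | by rewrite andbF].
  have := ri 0%N isT => h1; apply/andP; split; last by rewrite r1; lra.
  by apply: (le_trans h1); rewrite r1; lra.
Qed.
End SurfaceRealisation.

(** * The theorem *)

Lemma model_image (Q : complex) (V V' : finType) (e : rel V) (e' : rel V') (U : {set V}%SET)
    (bag : cell Q -> option V) (f : V -> V') :
  injective f -> (forall u v, e' (f u) (f v) -> e u v) -> model e U bag ->
  model e' (f @: U)%SET (omap f \o bag).
Proof.
move=> finj ee' [m1 m2 m3].
have bagE c v : (omap f (bag c) == Some (f v)) = (bag c == Some v).
  by case: (bag c) => [w|] //=; apply/eqP/eqP => [[/finj->]|[->]].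
split.
- move=> _ /imsetP[v vU ->]; have [c cv] := m1 v vU.
  by exists c; rewrite /= cv.
- move=> _ /imsetP[v vU ->]; have := m2 v vU.
  by congr (linked _ _); apply/setP => c; rewrite !inE bagE.
- move=> _ _ /imsetP[u uU ->] /imsetP[v vU ->] /ee' euv.
  by have [x [xu xv]] := m3 u v uU vU euv; exists x; rewrite /= xu xv.
Qed.

Lemma sparse_mono (V : finType) (e : rel V) (U : {set V}%SET) (g g' : nat) :
  (g <= g')%N -> sparse e U g -> sparse e U g'.
Proof.
move=> gg [s1 s2]; split.
  by move=> S SU; apply: leq_trans (s1 S SU) _; rewrite leq_mul2l leq_add2l gg.
by move=> S T q SU ql TS; apply: leq_trans (s2 S T q SU ql TS) _; rewrite leq_mul2l leq_add2l gg.
Qed.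

Lemma girth_no_square (G : sgraph) (a b u v : G) : girth_at_least 5 G ->
  a != b -> u != v -> adj u a -> adj u b -> adj v a -> adj v b -> False.
Proof.
move=> girth ab uv ua ub va vb.
have ne (x y : G) : adj x y -> x != y by apply: contraTneq => ->; rewrite adj_irrefl.
suff : (5 <= size [:: u; a; v; b])%N by [].
apply: girth => //; apply/andP; split; first by rewrite /= ua adj_sym va vb adj_sym ub.
rewrite /= !inE !negb_or (ne _ _ ua) uv (ne _ _ ub) (eq_sym a v) (ne _ _ va) ab (ne _ _ vb).
by [].
Qed.

(** There is one period for each of the four sides of [3 * (2 * m + 1)] blocks, where m = 2h + c <=
    gamma: hence the constant 12. Dropping [D] keeps the drawing away from infinity. *)
Lemma bounded_genus_model (R : realType) (gamma : nat) (G : sgraph) :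
  euler_genus_at_most R gamma G -> exists (D : {set G}%SET) (Q : complex) (bag : cell Q -> option G),
  [/\ (#|D| <= 2)%N, (#|period_index Q| <= 12 * (2 * gamma + 1))%N & model (@adj G) (~: D)%SET bag].
Proof.
case=> h [c [hc [E]]]; have [D [k [D2 Dp Da]]] := bounded_drawing E; exists D.
have BM : (4 * (2 * h + c) + 4)%:R <= extent R h c k by rewrite ler_nat leq_addr.
have cov p : bounded_part k p -> covered (@live h c) (@parametrise R h c (extent R h c k)) p.
  case=> x [z [xz zk <-]]; have zX : holed_sphere h c (Some z) by rewrite -xz; apply: set_valP.
  have -> : x = to_holed h c z by apply: val_inj; exact: etrans xz (esym (to_holedE zX)).
  by apply: (parametrise_cover BM zX); apply: ltW.
have [||n [bag mod]] := embedding_model (E := E) (@surface_hausdorff R h c) (U := (~: D)%SET) (surface_realisation BM).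
- by move=> u; rewrite inE => uD; apply/cov/Dp.
- by move=> u v t; rewrite !inE => uD vD uv t01; apply/cov/Da.
exists (grid (surface_scheme h c) n), bag; split => //.
rewrite /= !card_prod !card_bool !card_ord; lia.
Qed.

Lemma clustering_of_key (G : sgraph) (K : finType) (col : G -> K) (key : G -> nat) (c : nat) :
  (forall x y, adj x y -> col x = col y -> key x = key y) ->
  (forall n, #|[set x | key x == n]%SET| <= c)%N -> has_clustering col c.
Proof.
move=> keyE keyc a x.
apply: leq_trans (keyc (key (val x))).
have <- : #|[set val y | y in component x]%SET| = #|component x| by apply: card_imset; apply: val_inj.
apply/subset_leq_card/fintype.subsetP => _ /imsetP[y + ->]; rewrite !inE.
case/connectP => p + ->; elim: p x => [|z p IH] x /=; first by rewrite eqxx.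
case/andP => xz /IH /eqP->; apply/eqP; apply: esym; apply: keyE => //.
by have := valP x; have := valP z; rewrite !inE => /eqP-> /eqP->.
Qed.

Theorem theorem26 (R : realType) :
  exists f : nat -> nat -> nat,
    forall (gamma k : nat) (G : sgraph),
      apex R gamma k G ->
      girth_at_least 5 G ->
      colourable_with_clustering 3 G (f gamma k).
Proof.
have /choice[f fP] : forall p : nat * nat, exists c,
    forall G : sgraph, apex R p.1 p.2 G -> girth_at_least 5 G -> colourable_with_clustering 3 G c.
  (* [k + 2] because the apex set is [A] together with the at most two vertices of [D]. *)
  case=> gamma k /=; have [c cP] := bounded_island (12 * (2 * gamma + 1)) (k + 2).
  exists c => G [A [Ak genus]] girth.
  have [D [Q [bag [D2 Qg mod]]]] := bounded_genus_model genus.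
  pose U : {set G} := [set val x | x in (~: D)%SET]%SET.
  have modU : model (@adj G) U (omap val \o bag).
    by apply: model_image mod => [|u v //]; apply: val_inj.
  have sparseU : sparse (@adj G) (~: ~: U)%SET (12 * (2 * gamma + 1)).
    rewrite finset.setCK; apply: (sparse_mono Qg); apply: model_sparse modU => //.
      exact: adj_sym.
    exact: adj_irrefl.
  have cardU : (#|(~: U)%SET| <= k + 2)%N.
    apply: (@leq_trans (#|A| + #|[set val x | x in D]%SET|)); last first.
      by apply: leq_add => //; apply: leq_trans (leq_imset_card _ _) D2.
    apply: leq_trans (leq_card_setU _ _); apply/subset_leq_card/fintype.subsetP => x.
    rewrite !inE => xU; apply/negPn/negP => /norP[xA xD].
    have xA' : x \in (~: A)%SET by rewrite inE.
    case/negP: xU; apply/imsetP; exists (exist _ x xA') => //; rewrite inE.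
    by apply: contra xD => H; apply/imsetP; exists (exist _ x xA').
  have [|col [key [h1 h2]]] := @colour_of_islands G (@adj G) c (@adj_sym G).
    move=> W W0; apply: (cP G (@adj G) (~: U)%SET W) => //.
    - exact: adj_sym.
    - exact: adj_irrefl.
    - move=> a b u v; exact: girth_no_square.
  by exists col; apply: clustering_of_key h1 h2.
by exists (fun gamma k => f (gamma, k)) => gamma k; apply: (fP (gamma, k)).
Qed.
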